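(* Let $(M,\vec\xi,\eta,\varphi,g,D)$ be an almost quasi-Sasakian manifold whose canonical connection $\nabla^N$, $N=2\psi$, has parallel torsion. Then $M$ is an Einstein manifold with respect to $\nabla^N$ if and only if, in adapted coordinates, $$r_{ab}=4\,\omega_{da}\,\psi^d_b ,$$ where $r$ is the Ricci–Wagner tensor.
   Context: An almost contact metric structure $(M,\vec\xi,\eta,\varphi,g,D)$ on a smooth manifold $M$ of odd dimension $n=2m+1$ consists of a $(1,1)$-tensor $\varphi$, a vector field $\vec\xi$, a 1-form $\eta$ and a (pseudo-)Riemannian metric $g$ with $\varphi^2=-I+\eta\otimes\vec\xi$, $\eta(\vec\xi)=1$, $g(\varphi X,\varphi Y)=g(X,Y)-\eta(X)\eta(Y)$; $D=\ker\eta$. Consequently $\varphi\vec\xi=0$, $\eta\circ\varphi=0$, $\eta(X)=g(X,\vec\xi)$. Put $\Omega(X,Y)=g(X,\varphi Y)$, $\omega=d\eta$, with convention $2d\eta(X,Y)=X\eta(Y)-Y\eta(X)-\eta([X,Y])$, and $$N_\varphi(X,Y)=[\varphi X,\varphi Y]+\varphi^2[X,Y]-\varphi[\varphi X,Y]-\varphi[X,\varphi Y].$$ The structure is almost quasi-Sasakian if $d\Omega=0$, $\tilde N_\varphi:=N_\varphi+2\varphi^*d\eta\otimes\vec\xi=0$ (where $\varphi^*d\eta(X,Y)=d\eta(\varphi X,\varphi Y)$) and $d\eta(\vec\xi,\cdot)=0$. The endomorphism $\psi$ is defined by $\omega(X,Y)=g(\psi X,Y)$, and $C$ by $g(CX,Y)=\frac12(L_{\vec\xi}\,g)(X,Y)$.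 With $\widetilde\nabla$ the Levi-Civita connection and $N=2\psi$, the canonical connection is $$\nabla^N_XY=\widetilde\nabla_XY+(\widetilde\nabla_X\eta)(Y)\vec\xi-\eta(Y)\widetilde\nabla_X\vec\xi-\eta(X)(\widetilde\nabla_{\vec\xi}\,\eta)(Y)\vec\xi-\eta(X)(C+\psi-N)Y.$$ Its torsion is $S(X,Y)=\nabla^N_XY-\nabla^N_YX-[X,Y]$, $\tilde S(X,Y,Z)=g(S(X,Y),Z)$; parallel torsion means $\nabla^N\tilde S=0$. Let $K(X,Y)Z=\nabla^N_X\nabla^N_YZ-\nabla^N_Y\nabla^N_XZ-\nabla^N_{[X,Y]}Z$ be its curvature tensor, and let its Ricci tensor be $k(X,Z)=\mathrm{tr}(Y\mapsto K(X,Y)Z)$. $M$ is Einstein with respect to $\nabla^N$ if $k=\lambda g$ for some function $\lambda$. Let $P:TM\to D$ be the projection along $\vec\xi$ and $Q=1-P$. The inner connection is $\nabla_XY=P\widetilde\nabla_XY$ for $X,Y\in\Gamma(D)$. The Schouten curvature tensor is, for $X,Y,Z\in\Gamma(D)$, $$R(X,Y)Z=\nabla_X\nabla_YZ-\nabla_Y\nabla_XZ-\nabla_{P[X,Y]}Z-P[Q[X,Y],Z],$$ and the Ricci–Wagner tensor is $r(X,Z)=\mathrm{tr}(Y\mapsto R(X,Y)Z)$, $X,Z\in\Gamma(D)$ (trace over $D$). A chart $(x^1,\dots,x^n)$ is adapted if $\partial_n=\vec\xi$; then $\vec e_a=P(\partial_a)=\partial_a-\Gamma^n_a\partial_n$,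 $a=1,\dots,n-1$, is a local frame of $D$. Indices $a,b,d$ range over $1,\dots,n-1$, components are taken in this frame: $r_{ab}=r(\vec e_a,\vec e_b)$, $\omega_{ab}=\omega(\vec e_a,\vec e_b)$, $\psi\vec e_a=\psi^b_a\vec e_b$; summation over repeated indices. *)

(* Defs.v *)
From HB Require Import structures.
From mathcomp Require Import all_boot all_order all_algebra.
From mathcomp Require Import all_classical all_reals all_analysis.
Set Implicit Arguments.
Unset Strict Implicit.
Unset Printing Implicit Defensive.
Import Order.TTheory GRing.Theory Num.Theory.
Import numFieldNormedType.Exports.
Local Open Scope classical_set_scope.
Local Open Scope ring_scope.

Section Smooth.
Context {R : realType} {n : nat}.

Definition iter_partial (s : seq 'I_n) (f : 'rV[R]_n -> R) : 'rV[R]_n -> R :=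
  foldr (fun i h y => 'D_(delta_mx 0 i) h y) f s.

(* C^oo in a neighbourhood of x: there, all iterated partial derivatives are
   Frechet differentiable. *)
Definition smooth_at (f : 'rV[R]_n -> R) (x : 'rV[R]_n) : Prop :=
  \forall y \near x, forall s : seq 'I_n, differentiable (iter_partial s f) y.

Definition smoothv_at (f : 'rV[R]_n -> 'rV[R]_n) (x : 'rV[R]_n) : Prop :=
  forall i, smooth_at (fun y => f y 0 i) x.

End Smooth.

Section Manifold.
Context {R : realType} {M : topologicalType} {n : nat}.

(* [cmap] is meaningful on [cdom] only, and [cinv] on [cmap @` cdom] only. *)
Record chart := Chart {
  cdom : set M;
  cmap :> M -> 'rV[R]_n;
  cinv : 'rV[R]_n -> M }.

Record is_chart (c : chart) : Prop := IsChart {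
  cdom_open : open (cdom c);
  cimage_open : open (c @` cdom c);
  cmapK : forall p, cdom c p -> cinv c (c p) = p;
  cmap_continuous : forall p, cdom c p -> {for p, continuous c};
  cinv_continuous :
    forall x, (c @` cdom c) x -> {for x, continuous (cinv c)} }.

Definition smooth_transition (c d : chart) : Prop :=
  forall p, cdom c p -> cdom d p -> smoothv_at (d \o cinv c) (c p).

(* The smooth structure is the maximal atlas generated by [atlas], see
   [max_atlas].  [chart_at p] is a preferred chart around p, used to
   identify the tangent space T_p M with 'rV[R]_n. *)
Record smooth_manifold := SmoothManifold {
  atlas : set chart;
  chart_at : M -> chart;
  atlas_chart : forall c, atlas c -> is_chart c;
  atlas_compatible : forall c d, atlas c -> atlas d -> smooth_transition c d;
  chart_at_atlas : forall p, atlas (chart_at p);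
  mem_chart_at : forall p, cdom (chart_at p) p;
  manifold_hausdorff : hausdorff_space M;
  manifold_second_countable : @second_countable M }.

Variable A : smooth_manifold.

Definition max_atlas (c : chart) : Prop :=
  is_chart c /\
  forall d, atlas A d -> smooth_transition c d /\ smooth_transition d c.

(* An element of T_p M is given by its components in [chart_at A p]; in
   another chart c around p they are transformed by the Jacobian of the
   transition map. *)
Definition tangent_coord (c : chart) (p : M) (v : 'rV[R]_n) : 'rV[R]_n :=
  'd (c \o cinv (chart_at A p)) (chart_at A p p) v.

Definition tangent_of_coord (c : chart) (p : M) (u : 'rV[R]_n) : 'rV[R]_n :=
  'd (chart_at A p \o cinv c) (c p) u.

(* Vector fields are total functions; a local field on an open set U is one
   that is smooth at the points of U (with irrelevant values outside U).  The
   operators below are local: their value at p depends on germs at p only. *)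
Definition vfield := M -> 'rV[R]_n.

Definition vf_in_chart (c : chart) (X : vfield) (x : 'rV[R]_n) : 'rV[R]_n :=
  tangent_coord c (cinv c x) (X (cinv c x)).

Definition smooth_fun_at (p : M) (f : M -> R) : Prop :=
  smooth_at (f \o cinv (chart_at A p)) (chart_at A p p).

Definition smooth_vf_at (p : M) (X : vfield) : Prop :=
  smoothv_at (vf_in_chart (chart_at A p) X) (chart_at A p p).

Definition coord_vf (c : chart) (i : 'I_n) : vfield :=
  fun p => tangent_of_coord c p (delta_mx 0 i).

Definition vf_der (X : vfield) (f : M -> R) : M -> R :=
  fun p => 'D_(X p) (f \o cinv (chart_at A p)) (chart_at A p p).

Definition lie (X Y : vfield) : vfield := fun p =>
  let c := chart_at A p in
  'D_(X p) (vf_in_chart c Y) (c p) - 'D_(Y p) (vf_in_chart c X) (c p).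

(* Tensor fields act on row vectors: a (1,1)-tensor F by v |-> v *m F p, a
   1-form a by v |-> v *m a p, a bilinear form b by (u,v) |-> u *m b p *m v^T. *)
Definition endo_field := M -> 'M[R]_n.
Definition form1 := M -> 'cV[R]_n.
Definition bil_field := M -> 'M[R]_n.

Definition app_endo (F : endo_field) (X : vfield) : vfield :=
  fun p => X p *m F p.
Definition app_form (a : form1) (X : vfield) : M -> R :=
  fun p => (X p *m a p) 0 0.
Definition app_bil (b : bil_field) (X Y : vfield) : M -> R :=
  fun p => (X p *m b p *m (Y p)^T) 0 0.

Definition smooth_endo (F : endo_field) : Prop := forall p X,
  smooth_vf_at p X -> smooth_vf_at p (app_endo F X).
Definition smooth_form (a : form1) : Prop := forall p X,
  smooth_vf_at p X -> smooth_fun_at p (app_form a X).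
Definition smooth_bil (b : bil_field) : Prop := forall p X Y,
  smooth_vf_at p X -> smooth_vf_at p Y -> smooth_fun_at p (app_bil b X Y).

Definition pseudo_riemannian (g : bil_field) : Prop :=
  [/\ smooth_bil g, forall p, (g p)^T = g p & forall p, g p \in unitmx].

(* Normalized by 2 d a (X,Y) = X a(Y) - Y a(X) - a([X,Y]). *)
Definition dform1 (a : form1) (X Y : vfield) : M -> R := fun p =>
  2^-1 * (vf_der X (app_form a Y) p - vf_der Y (app_form a X) p
          - app_form a (lie X Y) p).

Definition dform2 (w : vfield -> vfield -> M -> R) (X Y Z : vfield) : M -> R :=
  fun p =>
  3^-1 * (vf_der X (w Y Z) p - vf_der Y (w X Z) p + vf_der Z (w X Y) p
          - w (lie X Y) Z p + w (lie X Z) Y p - w (lie Y Z) X p).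

Definition lie_bil (X : vfield) (b : bil_field) (Y Z : vfield) : M -> R :=
  fun p => vf_der X (app_bil b Y Z) p
           - app_bil b (lie X Y) Z p - app_bil b Y (lie X Z) p.

Definition connection_op := vfield -> vfield -> vfield.

Record is_connection (nabla : connection_op) : Prop := IsConnection {
  conn_smooth : forall p X Y, smooth_vf_at p X -> smooth_vf_at p Y ->
    smooth_vf_at p (nabla X Y);
  conn_addl : forall p X X' Y,
    smooth_vf_at p X -> smooth_vf_at p X' -> smooth_vf_at p Y ->
    nabla (fun q => X q + X' q) Y p = nabla X Y p + nabla X' Y p;
  conn_scalel : forall p (f : M -> R) X Y,
    smooth_fun_at p f -> smooth_vf_at p X -> smooth_vf_at p Y ->
    nabla (fun q => f q *: X q) Y p = f p *: nabla X Y p;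
  conn_addr : forall p X Y Y',
    smooth_vf_at p X -> smooth_vf_at p Y -> smooth_vf_at p Y' ->
    nabla X (fun q => Y q + Y' q) p = nabla X Y p + nabla X Y' p;
  conn_leibniz : forall p (f : M -> R) X Y,
    smooth_fun_at p f -> smooth_vf_at p X -> smooth_vf_at p Y ->
    nabla X (fun q => f q *: Y q) p = vf_der X f p *: Y p + f p *: nabla X Y p
  }.

Record levi_civita (g : bil_field) (nabla : connection_op) : Prop :=
  LeviCivita {
  lc_connection : is_connection nabla;
  lc_torsion_free : forall p X Y, smooth_vf_at p X -> smooth_vf_at p Y ->
    nabla X Y p - nabla Y X p = lie X Y p;
  lc_metric : forall p X Y Z,
    smooth_vf_at p X -> smooth_vf_at p Y -> smooth_vf_at p Z ->
    vf_der X (app_bil g Y Z) p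
      = app_bil g (nabla X Y) Z p + app_bil g Y (nabla X Z) p }.

Definition torsion (nabla : connection_op) (X Y : vfield) : vfield :=
  fun p => nabla X Y p - nabla Y X p - lie X Y p.

Definition lower_torsion (g : bil_field) (nabla : connection_op)
  (X Y Z : vfield) : M -> R := app_bil g (torsion nabla X Y) Z.

Definition parallel_torsion (g : bil_field) (nabla : connection_op) : Prop :=
  forall p W X Y Z,
    smooth_vf_at p W -> smooth_vf_at p X -> smooth_vf_at p Y ->
    smooth_vf_at p Z ->
    let S := lower_torsion g nabla in
    vf_der W (S X Y Z) p - S (nabla W X) Y Z p - S X (nabla W Y) Z p
      - S X Y (nabla W Z) p = 0.

Definition curvature (nabla : connection_op) (X Y Z : vfield) : vfield :=
  fun p => nabla X (nabla Y Z) p - nabla Y (nabla X Z) p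
           - nabla (lie X Y) Z p.

(* Matrix of the endomorphism of T_p M induced by a C^oo-linear operator on
   vector fields. *)
Definition endo_at (p : M) (F : vfield -> vfield) : 'M[R]_n :=
  \matrix_(i < n) F (coord_vf (chart_at A p) i) p.

Definition ricci (nabla : connection_op) (X Z : vfield) : M -> R :=
  fun p => \tr (endo_at p (fun Y => curvature nabla X Y Z)).

Definition einstein (g : bil_field) (nabla : connection_op) : Prop :=
  exists lambda : M -> R, forall p X Z,
    smooth_vf_at p X -> smooth_vf_at p Z ->
    ricci nabla X Z p = lambda p * app_bil g X Z p.

End Manifold.

Arguments chart : clear implicits.
Arguments smooth_manifold : clear implicits.
Arguments vfield : clear implicits.
Arguments endo_field : clear implicits.
Arguments form1 : clear implicits.
Arguments bil_field : clear implicits.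
Arguments connection_op : clear implicits.

Section AlmostContact.
Context {R : realType} {M : topologicalType} {n : nat}.
Variable A : smooth_manifold R M n.
Variables (xi : vfield R M n) (eta : form1 R M n).
Variables (phi : endo_field R M n) (g : bil_field R M n).

Definition almost_contact_metric : Prop :=
  [/\ pseudo_riemannian A g,
      (forall p, smooth_vf_at A p xi) /\ smooth_form A eta /\ smooth_endo A phi,
      forall p (v : 'rV[R]_n),
        v *m phi p *m phi p = - v + (v *m eta p) 0 0 *: xi p,
      forall p, (xi p *m eta p) 0 0 = 1 &
      forall p (u v : 'rV[R]_n),
        ((u *m phi p) *m g p *m (v *m phi p)^T) 0 0
          = (u *m g p *m v^T) 0 0 - (u *m eta p) 0 0 * (v *m eta p) 0 0 ].

Definition fundamental_form (X Y : vfield R M n) : M -> R :=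
  app_bil g X (app_endo phi Y).

Definition nijenhuis (X Y : vfield R M n) : vfield R M n := fun p =>
  let f := app_endo phi in
  lie A (f X) (f Y) p + f (f (lie A X Y)) p
  - f (lie A (f X) Y) p - f (lie A X (f Y)) p.

Definition nijenhuis_tilde (X Y : vfield R M n) : vfield R M n := fun p =>
  nijenhuis X Y p
  + (2 * dform1 A eta (app_endo phi X) (app_endo phi Y) p) *: xi p.

Definition almost_quasi_sasakian : Prop :=
  [/\ almost_contact_metric,
      forall p X Y Z,
        smooth_vf_at A p X -> smooth_vf_at A p Y -> smooth_vf_at A p Z ->
        dform2 A fundamental_form X Y Z p = 0,
      forall p X Y, smooth_vf_at A p X -> smooth_vf_at A p Y ->
        nijenhuis_tilde X Y p = 0 &
      forall p Y, smooth_vf_at A p Y -> dform1 A eta xi Y p = 0].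

Definition is_psi (psi : endo_field R M n) : Prop :=
  forall p X Y, smooth_vf_at A p X -> smooth_vf_at A p Y ->
    dform1 A eta X Y p = app_bil g (app_endo psi X) Y p.

Definition is_C (C : endo_field R M n) : Prop :=
  forall p X Y, smooth_vf_at A p X -> smooth_vf_at A p Y ->
    app_bil g (app_endo C X) Y p = 2^-1 * lie_bil A xi g X Y p.

Variable nabla : connection_op R M n.

Definition cov_eta (X Y : vfield R M n) : M -> R :=
  fun p => vf_der A X (app_form eta Y) p - app_form eta (nabla X Y) p.

(* The connection nabla^N, when [nabla] is the Levi-Civita connection. *)
Definition canonical_connection (C psi N : endo_field R M n) :
    connection_op R M n := fun X Y p =>
  nabla X Y p + cov_eta X Y p *: xi p
  - app_form eta Y p *: nabla X xi p
  - (app_form eta X p * cov_eta xi Y p) *: xi p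
  - app_form eta X p *: (Y p *m (C p + psi p - N p)).

Definition projQ (X : vfield R M n) : vfield R M n :=
  fun p => app_form eta X p *: xi p.

Definition projP (X : vfield R M n) : vfield R M n :=
  fun p => X p - projQ X p.

Definition inner_connection (X Y : vfield R M n) : vfield R M n :=
  projP (nabla X Y).

Definition schouten (X Y Z : vfield R M n) : vfield R M n := fun p =>
  let D := inner_connection in
  D X (D Y Z) p - D Y (D X Z) p - D (projP (lie A X Y)) Z p
  - projP (lie A (projQ (lie A X Y)) Z) p.

(* The rows of [kermx (eta p)] span D_p = ker eta_p, so this is the trace over
   D_p; the argument Y of the Schouten tensor has to be a section of D, whence
   the projection. *)
Definition ricci_wagner (X Z : vfield R M n) : M -> R := fun p =>
  \tr (restrictmx (kermx (eta p)) (endo_at A p (fun Y => schouten X (projP Y) Z))).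

End AlmostContact.

Section Adapted.
Context {R : realType} {M : topologicalType} {k : nat}.
Variable A : smooth_manifold R M k.+1.
Variables (xi : vfield R M k.+1) (eta : form1 R M k.+1).

Definition adapted_chart (c : chart R M k.+1) : Prop :=
  max_atlas A c /\ forall p, cdom c p -> coord_vf A c ord_max p = xi p.

(* The indices a = 1, .., n-1 of the adapted frame are shifted to 'I_(n-1). *)
Definition adapted_frame (c : chart R M k.+1) (a : 'I_k) : vfield R M k.+1 :=
  projP xi eta (coord_vf A c (widen_ord (leqnSn k) a)).

(* F^b_a, where F e_a = \sum_b F^b_a e_b at p. *)
Definition endo_comp (c : chart R M k.+1) (F : endo_field R M k.+1)
    (b a : 'I_k) (p : M) : R :=
  (app_endo F (adapted_frame c a) p
     *m pinvmx (\matrix_(d < k) adapted_frame c d p)) 0 b.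

End Adapted.

(* Main.v *)
From HB Require Import structures.
Require Import Defs.
From mathcomp Require Import all_boot all_order all_algebra.
From mathcomp Require Import all_classical all_reals all_analysis.
From mathcomp Require Import ring lra.
Set Implicit Arguments.
Unset Strict Implicit.
Unset Printing Implicit Defensive.
Import Order.TTheory GRing.Theory Num.Theory.
Import numFieldNormedType.Exports.
Local Open Scope classical_set_scope.
Local Open Scope ring_scope.

(** From d eta(xi, .) = 0 one gets L_xi eta = 0, then L_xi phi = 0 from
    N~ = 0, and d Omega = 0 becomes (L_xi g)(Y, phi Z) = 0; hence xi is Killing,
    C = 0, psi X is the Levi-Civita derivative of xi along X, and nabla^N is a
    metric connection with nabla^N xi = 0 and torsion
      S(X,Y) = 2 g(psi X, Y) xi + 2 eta(X) psi Y - 2 eta(Y) psi X.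
    Putting X = xi in nabla^N S = 0 gives nabla^N psi = 0.  With the Jacobi
    identity this makes K(xi,Y)Z symmetric in Y, Z; as g(K(X,Y)Z, W) is skew in
    Z, W, it follows that K(xi,Y)Z = 0.  On D one finds
    K(X,Y)Z = R(X,Y)Z + 4 g(psi X, Y) psi Z, and tracing over Y,
    k(X,Z) = r(X,Z) + 4 g(psi X, psi Z), whereas k vanishes as soon as one
    argument is xi.  So the Einstein factor is k(xi,xi) = 0, and the Einstein
    condition reads r_ab = - 4 g(psi e_a, psi e_b) = 4 omega_da psi^d_b.
    Conversely, that equation in adapted charts yields k = 0 only where such
    charts exist: they are obtained at every point by straightening xi along its
    flow.  Smoothness of the flow comes from differentiability in the initial
    value, applied again and again to the tangent system. *)

(** * Smooth functions on R^n *)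

(** Smoothness means that all iterated partial derivatives are Frechet differentiable near the
    point. It is proved coinductively each time: one exhibits a class of differentiable functions
    that is stable under partial derivatives. Products, composites, reciprocals, inverse maps and
    flows each have such a class, which replaces an induction on the order of differentiability. The
    derivatives in the differential equations are two-sided, while solutions are controlled on
    [0, 1] only; hence the clamped times and the care taken at the endpoints. Fields are total
    functions that are smooth at the point considered, so identities between fields hold only near
    it. Every differentiation of such an identity is therefore preceded by a locality argument. On
    the geometric side the choice N = 2 psi enters through nabla^N_xi U = [xi, U] + 2 psi U:
    derivatives along xi become brackets, to which the Jacobi identity applies, plus an algebraic
    term that is parallel. *)

Section SmoothFunctions.
Context {R : realType}.

Definition partial n (i : 'I_n) (f : 'rV[R]_n -> R) (y : 'rV[R]_n) : R :=
  'D_(delta_mx 0 i) f y.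

Lemma diffE_partial n (f : 'rV[R]_n -> R) x v : differentiable f x ->
  'd f x v = \sum_i v 0 i * partial i f x.
Proof.
move=> df; rewrite {1}(row_sum_delta v) linear_sum /=.
by apply: eq_bigr => i _; rewrite linearZ /= /partial deriveE.
Qed.

Lemma deriveE_partial n (f : 'rV[R]_n -> R) x v : differentiable f x ->
  'D_v f x = \sum_i v 0 i * partial i f x.
Proof. by move=> df; rewrite deriveE// diffE_partial. Qed.

Lemma differentiable_row (V : normedModType R) n (F : V -> 'rV[R]_n) x :
  (forall i, differentiable (fun y => F y 0 i) x) -> differentiable F x.
Proof.
move=> dF.
have -> : F = \sum_(i < n) (fun y => F y 0 i *: delta_mx 0 i).
  by apply/funext => y; rewrite fct_sumE -row_sum_delta.
by apply: differentiable_sum => i; exact: differentiableZl.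
Qed.

Lemma differentiable_row_coord (V : normedModType R) n (F : V -> 'rV[R]_n) x i :
  differentiable F x -> differentiable (fun y => F y 0 i) x.
Proof.
move=> dF; apply: (@differentiable_comp _ _ _ _ F (fun v : 'rV[R]_n => v 0 i)) => //.
exact: differentiable_coord.
Qed.

Lemma diff_row_coord (V : normedModType R) n (F : V -> 'rV[R]_n) x v i :
  differentiable F x -> ('d F x v) 0 i = 'd (fun y => F y 0 i) x v.
Proof.
move=> dF; rewrite -!deriveE ?derive_mx ?mxE//; last exact: differentiable_row_coord.
exact: diff_derivable.
Qed.

Lemma diff_row n m (F : 'rV[R]_m -> 'rV[R]_n) x v i : differentiable F x ->
  ('d F x v) 0 i = \sum_j v 0 j * partial j (fun y => F y 0 i) x.
Proof.
by move=> dF; rewrite diff_row_coord// diffE_partial//; exact: differentiable_row_coord.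
Qed.

Lemma partial_comp n m (F : 'rV[R]_m -> 'rV[R]_n) (h : 'rV[R]_n -> R) x i :
  differentiable F x -> differentiable h (F x) ->
  partial i (h \o F) x
  = \sum_j partial j h (F x) * partial i (fun y => F y 0 j) x.
Proof.
move=> dF dh; rewrite /partial deriveE; last exact: differentiable_comp.
rewrite diff_comp//= diffE_partial//; apply: eq_bigr => j _.
rewrite mulrC diff_row_coord//; congr (_ * _).
by rewrite /partial deriveE//; exact: differentiable_row_coord.
Qed.

Lemma differentiable_linear_approx (V W : normedModType R) (f : V -> W)
    (L : {linear V -> W}) x : continuous L ->
  (forall e, 0 < e -> \forall h \near (0 : V),
     `|f (h + x) - f x - L h| <= e * `|h|) ->
  differentiable f x /\ 'd f x = L :> (V -> W).
Proof.
move=> cL fL.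
have E : f \o shift x = cst (f x) + L +o_ (0 : V) id.
  apply/eqaddoP => e e0; apply: filterS (fL e e0) => h /=.
  by rewrite !fctE opprD addrA.
have dL : 'd f x = L :> (V -> W) by exact: diff_unique.
by split=> //; apply/diff_locallyP; rewrite dL.
Qed.

Lemma linear_approx (V W : normedModType R) (f : V -> W) x :
  differentiable f x -> forall e, 0 < e -> \forall h \near (0 : V),
     `|f (h + x) - f x - 'd f x h| <= e * `|h|.
Proof.
move=> /diff_locally /eqaddoP df e e0; apply: filterS (df e e0) => h /=.
by rewrite !fctE opprD addrA.
Qed.

Lemma near_eq_differentiable (V W : normedModType R) (f g : V -> W) x :
  (\near x, f x = g x) -> differentiable f x -> differentiable g x.
Proof.
move=> fg df; have E := nbhs_singleton fg.
have [] // := @differentiable_linear_approx _ _ g ('d f x) x.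
  exact: diff_continuous.
move=> e e0.
have : \forall h \near (0 : V), f (h + x) = g (h + x).
  have cv : (h + x) @[h --> (0 : V)] --> x.
    by rewrite -{2}(add0r x); apply: cvgD; [exact: cvg_id|exact: cvg_cst].
  exact: cv fg.
by apply: filterS2 (linear_approx df e0) => h + <-; rewrite -E.
Qed.

(** For functions whose partial derivatives are guessed beforehand: from the linearized equation for
    flows, from the inverse Jacobian for inverse maps. *)
Lemma differentiable_eps n (f : 'rV[R]_n -> R) (a : 'I_n -> R) x :
  (forall e, 0 < e -> \forall h \near (0 : 'rV[R]_n),
     `|f (h + x) - f x - \sum_i h 0 i * a i| <= e * `|h|) ->
  differentiable f x /\ forall i, partial i f x = a i.
Proof.
move=> fa.
pose l (h : 'rV[R]_n) := \sum_i h 0 i * a i.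
have lL : linear l.
  move=> k u v; rewrite /l scaler_sumr -big_split; apply: eq_bigr => i _ /=.
  by rewrite !mxE mulrDl scalerAl.
pose L : {linear 'rV[R]_n -> R} := HB.pack l (GRing.isLinear.Build _ _ _ _ _ lL).
have cL : continuous L.
  move=> v; apply: differentiable_continuous.
  rewrite (_ : (L : _ -> _) = \sum_i (fun h : 'rV[R]_n => h 0 i * a i)); last first.
    by apply/funext => h; rewrite fct_sumE.
  apply: differentiable_sum => i; apply: differentiableM => //.
  exact: differentiable_coord.
have [df dE] := @differentiable_linear_approx _ _ f L x cL fa.
split=> // i; rewrite /partial deriveE// dE /= /l (bigD1 i)//= big1 ?addr0 ?mxE ?eqxx ?mul1r//.
by move=> j ji; rewrite mxE (negPf ji) andbF mul0r.
Qed.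

(* Smoothness on a set, pointwise: for an open [U] this is [smooth_at] at
   every point of [U]. *)
Definition smooth_on n (U : set 'rV[R]_n) (f : 'rV[R]_n -> R) :=
  forall y, U y -> forall s, differentiable (iter_partial s f) y.

Lemma eq_iter_partial n (U : set 'rV[R]_n) f g s : open U ->
  (forall y, U y -> f y = g y) ->
  forall y, U y -> iter_partial s f y = iter_partial s g y.
Proof.
move=> oU; elim: s f g => //= i s IH f g fg y Uy.
by apply: near_eq_derive; apply: filterS (open_nbhs_nbhs (conj oU Uy)); exact: IH.
Qed.

Lemma iter_partial_rcons n s i (f : 'rV[R]_n -> R) :
  iter_partial (rcons s i) f = iter_partial s (partial i f).
Proof. by rewrite /iter_partial foldr_rcons. Qed.

Lemma eq_smooth_on n (U : set 'rV[R]_n) f g : open U ->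
  (forall y, U y -> f y = g y) -> smooth_on U f -> smooth_on U g.
Proof.
move=> oU fg sf y Uy s; apply: near_eq_differentiable (sf y Uy s).
apply: filterS (open_nbhs_nbhs (conj oU Uy)); exact: eq_iter_partial.
Qed.

(* Smoothness is the greatest property stable under partial derivatives and
   implying differentiability. *)
Lemma smooth_on_coind n (U : set 'rV[R]_n) (P : ('rV[R]_n -> R) -> Prop) :
  open U ->
  (forall f, P f -> forall y, U y -> differentiable f y) ->
  (forall f, P f -> forall i, exists2 g, P g &
     forall y, U y -> partial i f y = g y) ->
  forall f, P f -> smooth_on U f.
Proof.
move=> oU Pd Pp f Pf y Uy s.
elim/last_ind: s f Pf y Uy => [|s i IH] f Pf y Uy; first exact: Pd.
rewrite iter_partial_rcons; have [g Pg fg] := Pp f Pf i.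
apply: near_eq_differentiable (IH g Pg y Uy).
apply: filterS (open_nbhs_nbhs (conj oU Uy)) => z Uz.
by apply/esym; exact: eq_iter_partial Uz.
Qed.

Lemma smooth_on_differentiable n (U : set 'rV[R]_n) f y :
  smooth_on U f -> U y -> differentiable f y.
Proof. by move=> sf Uy; exact: (sf y Uy [::]). Qed.

Lemma smooth_on_partial n (U : set 'rV[R]_n) f i :
  smooth_on U f -> smooth_on U (partial i f).
Proof. by move=> sf y Uy s; rewrite -iter_partial_rcons; exact: sf. Qed.

Lemma smooth_on_sub n (U V : set 'rV[R]_n) f :
  U `<=` V -> smooth_on V f -> smooth_on U f.
Proof. by move=> UV sf y /UV; exact: sf. Qed.

Lemma smooth_on_cst n (U : set 'rV[R]_n) c : open U -> smooth_on U (fun=> c).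
Proof.
move=> oU; apply: (@smooth_on_coind _ _ (fun f => exists c, f = fun=> c)) => //.
- by move=> _ [d ->] y _; exact: differentiable_cst.
- move=> _ [d ->] i; exists (fun=> 0); first by exists 0.
  by move=> y _; rewrite /partial (derive_cst d).
- by exists c.
Qed.

Lemma partial_coord n i j (y : 'rV[R]_n) :
  partial j (fun y => y 0 i) y = (delta_mx 0 j : 'rV[R]_n) 0 i.
Proof.
rewrite /partial deriveE; last exact: differentiable_coord.
have di : is_diff y id (id : 'rV[R]_n -> 'rV[R]_n) by exact: is_diff_id.
by rewrite -(@diff_row_coord _ n id) ?diff_val//; exact: ex_diff di.
Qed.

Lemma smooth_on_coord n (U : set 'rV[R]_n) i : open U ->
  smooth_on U (fun y => y 0 i).
Proof.
move=> oU y Uy s; elim/last_ind: s y Uy => [|s j _] y Uy; first exact: differentiable_coord.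
rewrite iter_partial_rcons.
have sc := @smooth_on_cst n U ((delta_mx 0 j : 'rV[R]_n) 0 i) oU.
have := @eq_smooth_on n U _ (partial j (fun y => y 0 i)) oU _ sc.
by apply => // z Uz; rewrite partial_coord.
Qed.

Section SmoothOn.
Context {n : nat} {U : set 'rV[R]_n}.
Hypothesis oU : open U.

(** The partial derivative of a product is a sum of products, so the coinduction runs on the algebra
    generated by the smooth functions rather than on single products. *)
Inductive smooth_alg : ('rV[R]_n -> R) -> Prop :=
| SmoothAlg0 f : smooth_on U f -> smooth_alg f
| SmoothAlgD f g : smooth_alg f -> smooth_alg g -> smooth_alg (f \+ g)
| SmoothAlgM f g : smooth_alg f -> smooth_alg g -> smooth_alg (f \* g).

Lemma smooth_algP f : smooth_alg f -> smooth_on U f.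
Proof.
apply: smooth_on_coind => //.
  move=> {}f; elim=> [{}f sf|{}f g _ IHf _ IHg|{}f g _ IHf _ IHg] y Uy.
  - exact: smooth_on_differentiable sf Uy.
  - exact: (differentiableD (IHf _ Uy) (IHg _ Uy)).
  - exact: (differentiableM (IHf _ Uy) (IHg _ Uy)).
move=> {}f af i.
(* The product rule needs both factors differentiable, so differentiability is carried along the
   induction. *)
suff : (forall y, U y -> differentiable f y) /\ exists2 g, smooth_alg g &
     forall y, U y -> partial i f y = g y by case.
elim: af => [{}f sf|{}f g _ [df [f' sf' Ef]] _ [dg [g' sg' Eg]]|{}f g af [df [f' sf' Ef]] ag [dg [g' sg' Eg]]].
- split=> [y Uy|]; first exact: smooth_on_differentiable sf Uy.
  by exists (partial i f) => //; apply: SmoothAlg0; exact: smooth_on_partial.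
- split=> [y Uy|]; first exact: (differentiableD (df _ Uy) (dg _ Uy)).
  exists (f' \+ g'); first exact: SmoothAlgD.
  move=> y Uy; rewrite /= -Ef// -Eg// /partial (deriveD (f:=f) (g:=g))//; apply: diff_derivable; auto.
- split=> [y Uy|]; first exact: (differentiableM (df _ Uy) (dg _ Uy)).
  exists ((f \* g') \+ (g \* f')); first by apply: SmoothAlgD; apply: SmoothAlgM.
  move=> y Uy; rewrite /= -Ef// -Eg// /partial (deriveM (f:=f) (g:=g))//; apply: diff_derivable; auto.
Qed.

Lemma smooth_onD f g : smooth_on U f -> smooth_on U g -> smooth_on U (f \+ g).
Proof. by move=> sf sg; apply/smooth_algP/SmoothAlgD; exact: SmoothAlg0. Qed.

Lemma smooth_onM f g : smooth_on U f -> smooth_on U g -> smooth_on U (f \* g).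
Proof. by move=> sf sg; apply/smooth_algP/SmoothAlgM; exact: SmoothAlg0. Qed.

Lemma smooth_onN f : smooth_on U f -> smooth_on U (\- f).
Proof.
move=> sf; have := smooth_onM (@smooth_on_cst n U (-1) oU) sf.
by apply: eq_smooth_on => // y _ /=; rewrite mulN1r.
Qed.

Lemma smooth_onB f g : smooth_on U f -> smooth_on U g -> smooth_on U (f \- g).
Proof. by move=> sf sg; apply: (smooth_onD sf (smooth_onN sg)). Qed.

Lemma smooth_on_sum (I : Type) (r : seq I) (F : I -> 'rV[R]_n -> R) :
  (forall i, smooth_on U (F i)) -> smooth_on U (fun y => \sum_(i <- r) F i y).
Proof.
move=> sF; elim: r => [|i r IH].
  by apply: eq_smooth_on (@smooth_on_cst n U 0 oU) => // y _; rewrite big_nil.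
by apply: eq_smooth_on (smooth_onD (sF i) IH) => // y _; rewrite big_cons.
Qed.

Lemma smooth_on_prod (I : Type) (r : seq I) (F : I -> 'rV[R]_n -> R) :
  (forall i, smooth_on U (F i)) -> smooth_on U (fun y => \prod_(i <- r) F i y).
Proof.
move=> sF; elim: r => [|i r IH].
  by apply: eq_smooth_on (@smooth_on_cst n U 1 oU) => // y _; rewrite big_nil.
by apply: eq_smooth_on (smooth_onM (sF i) IH) => // y _; rewrite big_cons.
Qed.

End SmoothOn.

Lemma smooth_on_comp m n (U : set 'rV[R]_m) (V : set 'rV[R]_n)
    (F : 'rV[R]_m -> 'rV[R]_n) h : open U -> open V ->
  (forall y, U y -> V (F y)) -> (forall i, smooth_on U (fun y => F y 0 i)) ->
  smooth_on V h -> smooth_on U (h \o F).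
Proof.
move=> oU oV UV sF sh.
(* Sums of such products are stable: by the chain rule a term yields n terms of the same kind, plus
   one from the derivative of its factor a, which accounts for the index type [I * ('I_n + 'I_1)]
   below. *)
pose P f := exists (I : finType) (h : I -> 'rV[R]_n -> R) (a : I -> 'rV[R]_m -> R),
  [/\ forall i, smooth_on V (h i), forall i, smooth_on U (a i) &
      f = fun y => \sum_i h i (F y) * a i y].
have dF y : U y -> differentiable F y.
  by move=> Uy; apply: differentiable_row => i; exact: smooth_on_differentiable (sF i) Uy.
have dhF k y : smooth_on V k -> U y -> differentiable (k \o F) y.
  move=> sk Uy; apply: differentiable_comp; first exact: dF.
  exact: smooth_on_differentiable sk (UV _ Uy).
apply: (@smooth_on_coind _ _ P) => //; last first.
- exists 'I_1, (fun=> h), (fun=> fun=> 1); split=> //.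
    by move=> _; exact: smooth_on_cst.
  by apply/funext => y; rewrite big_ord1 mulr1.
- move=> _ [I [k [a [sk sa ->]]]] j.
  pose k' i (o : 'I_n + 'I_1) := if o is inl l then partial l (k i) else k i.
  pose a' i (o : 'I_n + 'I_1) :=
    if o is inl l then a i \* partial j (fun y => F y 0 l) else partial j (a i).
  exists (fun y => \sum_(p : I * ('I_n + 'I_1)) k' p.1 p.2 (F y) * a' p.1 p.2 y).
    exists (I * ('I_n + 'I_1))%type, (fun p => k' p.1 p.2), (fun p => a' p.1 p.2).
    split=> //; first by move=> [i [l|l]] //=; exact: smooth_on_partial.
    move=> [i [l|l]] /=; last exact: smooth_on_partial.
    by apply: smooth_onM => //; exact: smooth_on_partial.
  move=> y Uy; rewrite -(pair_bigA _ (fun i o => k' i o (F y) * a' i o y)) /=.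
  have -> : (fun y => \sum_i k i (F y) * a i y) =
      \sum_(i <- index_enum I) ((k i \o F) \* a i).
    by apply/funext => z; rewrite fct_sumE.
  have dd i : derivable ((k i \o F) \* a i) y (delta_mx 0 j).
    apply: diff_derivable; apply: differentiableM; first exact: dhF.
    exact: smooth_on_differentiable (sa i) Uy.
  transitivity (\sum_i partial j ((k i \o F) \* a i) y).
    elim: (index_enum I) => [|i r IH]; first by rewrite !big_nil /partial (derive_cst 0).
    rewrite !big_cons -IH /partial deriveD//.
    elim: (r) => [|i' r' IH']; first by rewrite big_nil; exact: derivable_cst.
    by rewrite big_cons; exact: derivableD.
  apply: eq_bigr => i _; rewrite big_sumType/= big_ord1 /= addrC.
  rewrite /partial deriveM; last first.
  + by apply: diff_derivable; exact: smooth_on_differentiable (sa i) Uy.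
  + by apply: diff_derivable; exact: dhF.
  congr (_ + _); rewrite -/(partial j (k i \o F) y) partial_comp; [|exact: dF|].
    by rewrite scaler_sumr; apply: eq_bigr => l _; rewrite /= mulrCA.
  exact: smooth_on_differentiable (sk i) (UV _ Uy).
- move=> _ [I [k [a [sk sa ->]]]] y Uy.
  have -> : (fun y => \sum_i k i (F y) * a i y) =
      \sum_(i <- index_enum I) ((k i \o F) \* a i).
    by apply/funext => z; rewrite fct_sumE.
  elim: (index_enum I) => [|i r IH]; first by rewrite big_nil; exact: differentiable_cst.
  rewrite big_cons; apply: differentiableD => //; apply: differentiableM; first exact: dhF.
  exact: smooth_on_differentiable (sa i) Uy.
Qed.

End SmoothFunctions.

(** * Smoothness at a point, mean values and symmetry of second derivatives *)

Section LocalSmoothness.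
Context {R : realType}.

Lemma smooth_atP n (f : 'rV[R]_n -> R) x : smooth_at f x <->
  exists U, [/\ open U, U x & smooth_on U f].
Proof.
split=> [sf|[U [oU Ux sf]]]; last first.
  by apply: filterS (open_nbhs_nbhs (conj oU Ux)) => y; exact: sf.
move: sf; rewrite /smooth_at -nbhs_nearE nbhsE => -[U [oU Ux] UP].
by exists U; split=> // y /UP.
Qed.

Lemma smooth_at_eq n (f g : 'rV[R]_n -> R) x : (\near x, f x = g x) ->
  smooth_at f x -> smooth_at g x.
Proof.
move=> fg /smooth_atP[U [oU Ux sf]].
move: fg; rewrite -nbhs_nearE nbhsE => -[V [oV Vx] VP].
apply/smooth_atP; exists (U `&` V); split=> //; first exact: openI.
apply: (@eq_smooth_on _ _ _ f); [exact: openI|by move=> y [_ /VP]|].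
by apply: smooth_on_sub sf => y [].
Qed.

Lemma smooth_atD n (f g : 'rV[R]_n -> R) x :
  smooth_at f x -> smooth_at g x -> smooth_at (f \+ g) x.
Proof.
move=> /smooth_atP[U [oU Ux sf]] /smooth_atP[V [oV Vx sg]].
apply/smooth_atP; exists (U `&` V); split=> //; first exact: openI.
apply: smooth_onD; first exact: openI.
  by apply: smooth_on_sub sf => y [].
by apply: smooth_on_sub sg => y [].
Qed.

Lemma smooth_atM n (f g : 'rV[R]_n -> R) x :
  smooth_at f x -> smooth_at g x -> smooth_at (f \* g) x.
Proof.
move=> /smooth_atP[U [oU Ux sf]] /smooth_atP[V [oV Vx sg]].
apply/smooth_atP; exists (U `&` V); split=> //; first exact: openI.
apply: smooth_onM; first exact: openI.
  by apply: smooth_on_sub sf => y [].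
by apply: smooth_on_sub sg => y [].
Qed.

Lemma smooth_at_cst n (c : R) (x : 'rV[R]_n) : smooth_at (fun=> c) x.
Proof.
by apply/smooth_atP; exists setT; split=> //; [exact: openT|apply/smooth_on_cst/openT].
Qed.

Lemma smooth_at_sum n (I : Type) (r : seq I) (F : I -> 'rV[R]_n -> R) x :
  (forall i, smooth_at (F i) x) -> smooth_at (fun y => \sum_(i <- r) F i y) x.
Proof.
move=> sF; elim: r => [|i r IH].
  rewrite (_ : (fun _ => _) = fun=> 0); first exact: smooth_at_cst.
  by apply/funext => y; rewrite big_nil.
rewrite (_ : (fun _ => _) = F i \+ (fun y => \sum_(i <- r) F i y)); first exact: smooth_atD.
by apply/funext => y; rewrite big_cons.
Qed.

Lemma smooth_at_differentiable n (f : 'rV[R]_n -> R) x :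
  smooth_at f x -> differentiable f x.
Proof. by move=> /nbhs_singleton /(_ [::]). Qed.

Lemma smooth_at_partial n (f : 'rV[R]_n -> R) x i :
  smooth_at f x -> smooth_at (partial i f) x.
Proof.
move=> /smooth_atP[U [oU Ux sf]]; apply/smooth_atP; exists U; split=> //.
exact: smooth_on_partial.
Qed.

Lemma smooth_at_near n (f : 'rV[R]_n -> R) x :
  smooth_at f x -> \forall y \near x, smooth_at f y.
Proof.
move=> /smooth_atP[U [oU Ux sf]].
by apply: filterS (open_nbhs_nbhs (conj oU Ux)) => y Uy; apply/smooth_atP; exists U.
Qed.

Definition smooth_map_at m n (F : 'rV[R]_m -> 'rV[R]_n) x :=
  forall i, smooth_at (fun y => F y 0 i) x.

Lemma smooth_map_at_smooth_on m n (F : 'rV[R]_m -> 'rV[R]_n) x :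
  smooth_map_at F x ->
  exists U, [/\ open U, U x & forall i, smooth_on U (fun y => F y 0 i)].
Proof.
move=> sF.
have nF : \forall y \near x, forall i (s : seq 'I_m),
    differentiable (iter_partial s (fun y => F y 0 i)) y.
  by apply: (@filter_forall _ _ _ (nbhs x)) => i; exact: sF.
move: nF; rewrite -nbhs_nearE nbhsE => -[U [oU Ux] UP].
by exists U; split=> // i y /UP.
Qed.

Lemma smooth_map_at_differentiable m n (F : 'rV[R]_m -> 'rV[R]_n) x :
  smooth_map_at F x -> differentiable F x.
Proof. by move=> sF; apply: differentiable_row => i; exact: smooth_at_differentiable. Qed.

Lemma smooth_map_at_near m n (F : 'rV[R]_m -> 'rV[R]_n) x :
  smooth_map_at F x -> \forall y \near x, smooth_map_at F y.
Proof. by move=> sF; apply: (@filter_forall _ _ _ (nbhs x)) => i; exact: smooth_at_near. Qed.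

Lemma smooth_at_comp m n (F : 'rV[R]_m -> 'rV[R]_n) (h : 'rV[R]_n -> R) x :
  smooth_map_at F x -> smooth_at h (F x) -> smooth_at (h \o F) x.
Proof.
move=> /[dup] /smooth_map_at_differentiable/differentiable_continuous cF.
move=> /smooth_map_at_smooth_on[U [oU Ux sF]] /smooth_atP[V [oV VFx sh]].
have : nbhs x (U `&` F @^-1` V).
  apply: filterI; first exact: open_nbhs_nbhs.
  by apply: cF; exact: open_nbhs_nbhs.
rewrite nbhsE => -[W [oW Wx] WP]; apply/smooth_atP; exists W; split=> //.
apply: (smooth_on_comp oW oV) => //; first by move=> y /WP[].
by move=> i; apply: smooth_on_sub (sF i) => y /WP[].
Qed.

Lemma derive_div_expr (V : normedModType R) (a g : V -> R) k (y v : V) :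
  g y != 0 -> derivable a y v -> derivable g y v ->
  'D_v (fun y => a y * (g y)^-1 ^+ k.+1) y
  = ('D_v a y * g y - k.+1%:R * a y * 'D_v g y) * (g y)^-1 ^+ k.+2.
Proof.
move=> gy da dg.
have dV : derivable (fun y => (g y)^-1) y v by exact: derivableV.
have -> : (fun y => a y * (g y)^-1 ^+ k.+1) = a * (fun y => (g y)^-1) ^+ k.+1.
  by apply/funext => z; rewrite exprfctE.
have daV := derivableX (n := k.+1) dV.
rewrite (deriveM da daV) (deriveX _ dV) (deriveV gy dg) exprfctE /GRing.scale /=.
rewrite !exprS expr0 mulr1 /=; field; exact: gy.
Qed.

Lemma differentiable_div_expr (V : normedModType R) (a g : V -> R) k (y : V) :
  g y != 0 -> differentiable a y -> differentiable g y ->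
  differentiable (fun y => a y * (g y)^-1 ^+ k.+1) y.
Proof.
move=> gy da dg.
have -> : (fun y => a y * (g y)^-1 ^+ k.+1) = a * (fun y => (g y)^-1) ^+ k.+1.
  by apply/funext => z; rewrite exprfctE.
by apply: differentiableM => //; apply: differentiableX; exact: differentiableV.
Qed.

(** By the quotient rule the functions a / g^(k+1), with a smooth, are stable under partial
    derivatives; k = 0 and a = 1 give the reciprocal itself. *)
Lemma smooth_onV n (U : set 'rV[R]_n) (g : 'rV[R]_n -> R) : open U ->
  (forall y, U y -> g y != 0) -> smooth_on U g -> smooth_on U (fun y => (g y)^-1).
Proof.
move=> oU g0 sg.
pose P f := exists (a : 'rV[R]_n -> R) k, smooth_on U a /\ f = fun y => a y * (g y)^-1 ^+ k.+1.
have dg y : U y -> differentiable g y := smooth_on_differentiable sg.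
apply: (@smooth_on_coind _ _ _ P) => //.
- move=> _ [a [k [sa ->]]] y Uy.
  apply: differentiable_div_expr; [exact: g0|exact: smooth_on_differentiable sa Uy|exact: dg].
- move=> _ [a [k [sa ->]]] i.
  exists (fun y => (partial i a y * g y - k.+1%:R * a y * partial i g y) * (g y)^-1 ^+ k.+2).
    exists (fun y => (partial i a y * g y - k.+1%:R * a y * partial i g y)), k.+1; split=> //.
    apply: smooth_onB => //.
      by apply: smooth_onM => //; exact: smooth_on_partial.
    apply: smooth_onM => //; last exact: smooth_on_partial.
    by apply: smooth_onM => //; exact: smooth_on_cst.
  move=> y Uy; rewrite /partial; apply: derive_div_expr; first exact: g0.
    by apply: diff_derivable; exact: smooth_on_differentiable sa Uy.
  by apply: diff_derivable; exact: dg.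
- by exists (fun=> 1), 0%N; split; [exact: smooth_on_cst|apply/funext => y; rewrite mul1r expr1].
Qed.

Lemma is_derive_line n (f : 'rV[R]_n -> R) (c v : 'rV[R]_n) (s : R) :
  differentiable f (c + s *: v) ->
  is_derive s 1 (fun s => f (c + s *: v)) ('D_v f (c + s *: v)).
Proof.
move=> df.
have dl : is_diff s (fun s : R => c + s *: v) (fun s : R => 0 + s *: v).
  exact: is_diffD.
have dlE : differentiable (fun s : R => c + s *: v) s by case: dl.
have dc : differentiable (f \o (fun s : R => c + s *: v)) s.
  exact: differentiable_comp.
apply: DeriveDef; first exact: diff_derivable.
rewrite deriveE// -[LHS]/('d (f \o (fun s : R => c + s *: v)) s 1) diff_comp//=.
by rewrite diff_val add0r scale1r deriveE.
Qed.

Lemma mean_value n (f : 'rV[R]_n -> R) (y z : 'rV[R]_n) :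
  (forall t : R, 0 <= t <= 1 -> differentiable f (y + t *: (z - y))) ->
  exists2 t : R, 0 <= t <= 1 &
    f z - f y = \sum_i (z - y) 0 i * partial i f (y + t *: (z - y)).
Proof.
move=> df.
have D (t : R) : 0 <= t <= 1 -> is_derive t 1 (fun s => f (y + s *: (z - y)))
    (\sum_i (z - y) 0 i * partial i f (y + t *: (z - y))).
  by move=> /df d; rewrite -deriveE_partial//; exact: is_derive_line.
have [||t] := @MVT_segment R (fun s => f (y + s *: (z - y)))
  (fun t => \sum_i (z - y) 0 i * partial i f (y + t *: (z - y))) 0 1 ler01.
- by move=> t; rewrite in_itv /= => /andP[t0 t1]; apply: D; rewrite !ltW.
- apply: derivable_within_continuous => t; rewrite in_itv /= => /D[+ _].
  by [].
- rewrite in_itv /= => t01; rewrite scale1r scale0r addr0 subr0 mulr1 [y + (z - y)]addrC subrK => E.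
  by exists t.
Qed.

Lemma ler_coord_norm n (v : 'rV[R]_n) i : `|v 0 i| <= `|v|.
Proof.
rewrite {2}/Num.Def.normr /= mx_normrE; exact: (le_bigmax _ (fun ij : 'I_1 * 'I_n => `|v ij.1 ij.2|) (0, i)).
Qed.

Lemma ler_norm_row n (v : 'rV[R]_n) (e : R) : 0 <= e ->
  (forall i, `|v 0 i| <= e) -> `|v| <= e.
Proof.
move=> e0 ve; rewrite {1}/Num.Def.normr /= mx_normrE; apply: bigmax_le => //= -[i j] _ /=.
by rewrite ord1.
Qed.

Lemma ltr_norm_row n (v : 'rV[R]_n) (e : R) : 0 < e ->
  (forall i, `|v 0 i| < e) -> `|v| < e.
Proof.
move=> e0 ve; rewrite {1}/Num.Def.normr /= mx_normrE; apply: bigmax_lt => //= -[i j] _ /=.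
by rewrite ord1.
Qed.

Lemma norm_delta n (i : 'I_n) : `|(delta_mx 0 i : 'rV[R]_n)| <= 1.
Proof.
apply: ler_norm_row => // j; rewrite mxE eqxx /=.
by case: (j == i); rewrite ?normr1 // normr0.
Qed.

Definition second_difference n (f : 'rV[R]_n -> R) (x : 'rV[R]_n) (i j : 'I_n)
    (t : R) : R :=
  f (x + t *: delta_mx 0 i + t *: delta_mx 0 j) - f (x + t *: delta_mx 0 i)
  - f (x + t *: delta_mx 0 j) + f x.

(** The mean value theorem in direction i, applied to the difference of f along two parallel
    segments, leaves t times a difference of two values of [partial i f]. Each of them is replaced
    by its linear approximation at x. *)
Lemma second_difference_approx n (f : 'rV[R]_n -> R) x i j :
  (\forall y \near x, differentiable f y) ->
  differentiable (partial i f) x -> forall e, 0 < e ->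
  \forall t \near 0^'+,
    `|second_difference f x i j t - t ^+ 2 * partial j (partial i f) x| <= e * t ^+ 2.
Proof.
move=> df dpf e e0.
(* Two values taken at distance at most 2 t from x, each with error e / 4 times 2 t, multiplied by
   t: this makes e t^2. *)
have e4 : 0 < e / 4 by rewrite divr_gt0.
have /nbhs_ballP[r /= r0 rP] := linear_approx dpf e4.
have /nbhs_ballP[r' /= r'0 r'P] := df.
near=> t.
have t0 : 0 < t by [].
have tr : 2 * t < r.
  by rewrite mulrC -ltr_pdivlMr//; near: t; apply: nbhs_right_lt; rewrite divr_gt0.
have tr' : 2 * t < r'.
  by rewrite mulrC -ltr_pdivlMr//; near: t; apply: nbhs_right_lt; rewrite divr_gt0.
have nrm (s s' : R) : 0 <= s <= t -> 0 <= s' <= t ->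
   `|s *: delta_mx 0 i + s' *: (delta_mx 0 j : 'rV[R]_n)| <= 2 * t.
  move=> /andP[s0 st] /andP[s'0 s't]; rewrite (le_trans (ler_normD _ _))// !normrZ.
  rewrite !ger0_norm// mulr_natl mulr2n; apply: lerD.
    by rewrite -[leRHS]mulr1; apply: ler_pM => //; exact: norm_delta.
  by rewrite -[leRHS]mulr1; apply: ler_pM => //; exact: norm_delta.
have dif (s s' : R) : 0 <= s <= t -> 0 <= s' <= t ->
   differentiable f (x + (s *: delta_mx 0 i + s' *: (delta_mx 0 j : 'rV[R]_n))).
  move=> hs hs'; apply: r'P; rewrite -ball_normE /= opprD addrA subrr add0r normrN.
  exact: le_lt_trans (nrm _ _ hs hs') tr'.
have app (s s' : R) : 0 <= s <= t -> 0 <= s' <= t ->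
   `|partial i f (x + (s *: delta_mx 0 i + s' *: (delta_mx 0 j : 'rV[R]_n))) - partial i f x
     - 'd (partial i f) x (s *: delta_mx 0 i + s' *: (delta_mx 0 j : 'rV[R]_n))| <= e / 4 * (2 * t).
  move=> hs hs'; have N := nrm _ _ hs hs'.
  rewrite [x + _]addrC; apply: (le_trans (rP _ _)).
    by rewrite -ball_normE /= sub0r normrN; exact: le_lt_trans N tr.
  by apply: ler_wpM2l => //; exact: ltW.
have t0t : 0 <= t <= t by rewrite lexx ltW.
have z0t : 0 <= (0 : R) <= t by rewrite lexx ltW.
have [||s] := @MVT_segment R
  (fun s => f ((x + t *: delta_mx 0 j) + s *: delta_mx 0 i) - f (x + s *: delta_mx 0 i))
  (fun s => partial i f ((x + t *: delta_mx 0 j) + s *: delta_mx 0 i) - partial i f (x + s *: delta_mx 0 i))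
  0 t (ltW t0).
- move=> s; rewrite in_itv /= => /andP[s0 st].
  have hs : 0 <= s <= t by rewrite !ltW.
  apply: is_deriveB; apply: is_derive_line.
    by rewrite -addrA [X in x + X]addrC; exact: dif.
  by have := dif s 0 hs z0t; rewrite scale0r addr0.
- apply: derivable_within_continuous => s; rewrite in_itv /= => hs.
  apply: derivableB.
    have [|+ _] := @is_derive_line n f (x + t *: delta_mx 0 j) (delta_mx 0 i) s.
      by rewrite -addrA [X in x + X]addrC; exact: dif.
    by [].
  have [|+ _] := @is_derive_line n f x (delta_mx 0 i) s.
    by have := dif s 0 hs z0t; rewrite scale0r addr0.
  by [].
rewrite in_itv /= => hs.
rewrite !scale0r !addr0 => E.
have -> : second_difference f x i j t =
  f (x + t *: delta_mx 0 j + t *: delta_mx 0 i) - f (x + t *: delta_mx 0 i) -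
    (f (x + t *: delta_mx 0 j) - f x).
  by rewrite /second_difference [x + t *: delta_mx 0 i + _]addrAC; ring.
rewrite E subr0.
have A1 := app s t hs t0t.
have A2 := app s 0 hs z0t.
rewrite [x + t *: delta_mx 0 j + s *: _]addrAC -addrA.
rewrite scale0r addr0 in A2.
set a := partial i f _ in A1 *; set b := partial i f (x + s *: _) in A2 *.
have -> : (a - b) * t - t ^+ 2 * partial j (partial i f) x =
   t * ((a - partial i f x - 'd (partial i f) x (s *: delta_mx 0 i + t *: delta_mx 0 j))
   - (b - partial i f x - 'd (partial i f) x (s *: delta_mx 0 i))).
  have -> : 'd (partial i f) x (s *: delta_mx 0 i + t *: delta_mx 0 j) =
      'd (partial i f) x (s *: delta_mx 0 i) + t * partial j (partial i f) x.
    by rewrite linearD /= [X in _ + X = _]linearZ /= -[partial j _ x]/('D_(delta_mx 0 j) (partial i f) x) deriveE.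
  by set A := 'd _ _ _; ring.
rewrite normrM gtr0_norm// (_ : e * t ^+ 2 = t * (e / 4 * (2 * t) + e / 4 * (2 * t))); last by field.
apply: ler_wpM2l; first exact: ltW.
by apply: le_trans (ler_normB _ _) _; exact: lerD.
Unshelve. all: by end_near. Qed.

(* Both mixed partial derivatives are the limit of the second difference
   divided by t ^ 2. *)
Lemma partialC n (f : 'rV[R]_n -> R) x i j : smooth_at f x ->
  partial i (partial j f) x = partial j (partial i f) x.
Proof.
move=> sf.
have df : \forall y \near x, differentiable f y.
  by apply: filterS (smooth_at_near sf) => y; exact: smooth_at_differentiable.
have dp k : differentiable (partial k f) x.
  by apply: smooth_at_differentiable; exact: smooth_at_partial.
apply/eqP; rewrite -subr_eq0 -normr_le0; apply/ler_addgt0Pr => e e0; rewrite add0r.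
have e2 : 0 < e / 2 by rewrite divr_gt0.
have nA := second_difference_approx j df (dp i) e2.
have nB := second_difference_approx i df (dp j) e2.
have [t [[t0 A] B]] := filter_ex (filterI (filterI (nbhs_right_gt 0) nA) nB).
have S : second_difference f x j i t = second_difference f x i j t.
  by rewrite /second_difference [x + t *: delta_mx 0 j + _]addrAC; ring.
move: A B; rewrite S; set D := second_difference _ _ _ _ _.
set p := partial j _ x; set q := partial i _ x; move: D p q => D p q A B.
have t2 : 0 < t ^+ 2 by rewrite exprn_gt0.
rewrite -(ler_pM2r t2) -[X in _ * X <= _](gtr0_norm t2) -normrM.
have -> : (q - p) * t ^+ 2 = (D - t ^+ 2 * p) - (D - t ^+ 2 * q) by ring.
rewrite [leRHS](_ : _ = e / 2 * t ^+ 2 + e / 2 * t ^+ 2); last by field.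
by apply: le_trans (ler_normB _ _) _; exact: lerD.
Qed.

End LocalSmoothness.

(** * Ordinary differential equations *)

Section ODE.
Context {R : realType}.

Lemma exists_primitive (f : R -> R) : continuous f ->
  exists2 F : R -> R, F 0 = 0 & forall t : R, 0 <= t <= 1 -> is_derive t 1 F (f t).
Proof.
move=> cf.
pose mu := @lebesgue_measure R.
(* The integral starts at -1, and the fundamental theorem is applied inside [-1, 2], so that 0 and 1
   are interior points and the derivatives there are two-sided. *)
pose F0 (x : R) := (\int[mu]_(t in [set` `[(-1 : R), x]]) f t)%R.
have D (t : R) : 0 <= t <= 1 -> is_derive t 1 F0 (f t).
  move=> /andP[t0 t1].
  have [||||dF <-] := @continuous_FTC1_closed R f (-1) t 2.
  - by rewrite (le_lt_trans t1)// ltr1n.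
  - apply: continuous_compact_integrable; first exact: segment_compact.
    exact: continuous_subspaceT.
  - by rewrite (lt_le_trans _ t0)// ltrN10.
  - exact: cf.
  - by rewrite derive1E; exact: DeriveDef.
exists (fun t => F0 t - F0 0); first by rewrite subrr.
move=> t /D d; rewrite -[f t]subr0; apply: is_deriveB.
Qed.

Lemma derive_le (f df g dg : R -> R) (t : R) : 0 <= t <= 1 ->
  (forall s : R, 0 <= s <= 1 -> is_derive s 1 f (df s)) ->
  (forall s : R, 0 <= s <= 1 -> is_derive s 1 g (dg s)) ->
  (forall s : R, 0 <= s <= 1 -> df s <= dg s) ->
  f t - f 0 <= g t - g 0.
Proof.
move=> /andP[t0 t1] Df Dg fg.
have I (s : R) : s \in `[0, t]%R -> 0 <= s <= 1.
  by rewrite in_itv /= => /andP[-> st] /=; exact: le_trans t1.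
have [||c cI] := @MVT_segment R (fun s => g s - f s) (fun s => dg s - df s) 0 t t0.
- move=> s; rewrite in_itv /= => /andP[s0 st].
  by apply: is_deriveB; [apply: Dg|apply: Df]; rewrite !ltW //= (lt_le_trans st).
- apply: derivable_within_continuous => s /I sI.
  by apply: derivableB; [have [] := Dg _ sI|have [] := Df _ sI].
move=> E; rewrite -subr_ge0 [leRHS](_ : _ = g t - f t - (g 0 - f 0)); last by ring.
by rewrite E subr0 mulr_ge0// subr_ge0 fg// I.
Qed.

Lemma derive_norm_le (f df g dg : R -> R) (t : R) : 0 <= t <= 1 ->
  (forall s : R, 0 <= s <= 1 -> is_derive s 1 f (df s)) ->
  (forall s : R, 0 <= s <= 1 -> is_derive s 1 g (dg s)) ->
  (forall s : R, 0 <= s <= 1 -> `|df s| <= dg s) ->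
  `|f t - f 0| <= g t - g 0.
Proof.
move=> t01 Df Dg fg; rewrite ler_norml; apply/andP; split; last first.
  by apply: derive_le Df Dg _ => // s /fg; exact: le_trans (ler_norm _).
rewrite lerNl opprB.
have := @derive_le (\- f) (\- df) g dg t t01 _ Dg; rewrite /= opprK [- f t + _]addrC.
apply; first by move=> s /Df d; exact: is_deriveN.
by move=> s /fg; apply: le_trans; rewrite -normrN; exact: ler_norm.
Qed.

Lemma is_derive_sum (I : Type) (r : seq I) (f : I -> R -> R) (df : I -> R) (t : R) :
  (forall i, is_derive t 1 (f i) (df i)) ->
  is_derive t 1 (fun s => \sum_(i <- r) f i s) (\sum_(i <- r) df i).
Proof.
move=> D; elim: r => [|i r IH].
  rewrite big_nil (_ : (fun _ => _) = cst 0); first exact: is_derive_cst.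
  by apply/funext => s; rewrite big_nil.
rewrite big_cons (_ : (fun _ => _) = f i \+ fun s => \sum_(j <- r) f j s).
  exact: is_deriveD.
by apply/funext => s; rewrite big_cons.
Qed.

Lemma is_derive_scale (f : R -> R) (df c t : R) :
  is_derive (c * t) 1 f df -> is_derive t 1 (fun s => f (c * s)) (c * df).
Proof.
move=> [Df <-].
have [dc dcE] : is_derive t 1 (c \*: (id : R -> R)) (c *: 1) by exact: is_deriveZ.
have dfc : differentiable (f \o (c \*: (id : R -> R))) t.
  apply: (@differentiable_comp _ _ _ _ (c \*: (id : R -> R)) f).
    exact: (derivable1_diffP _ _).1 dc.
  exact: (derivable1_diffP _ _).1 Df.
have := @derive1_comp R (c \*: (id : R -> R)) f t dc Df.
rewrite !derive1E dcE => E.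
apply: DeriveDef; first exact: (derivable1_diffP _ _).2 dfc.
by rewrite [LHS]E mulrC /GRing.scale /= mulr1.
Qed.

Lemma is_derive_mul (f g : R -> R) (df dg t : R) :
  is_derive t 1 f df -> is_derive t 1 g dg ->
  is_derive t 1 (fun s => f s * g s) (df * g t + f t * dg).
Proof.
move=> Df Dg; have D := is_deriveM Df Dg.
by apply: (is_derive_eq D); rewrite /GRing.scale /=; ring.
Qed.

(** Passes from the sup norm, which is not differentiable, to a sum of squares, which is. *)
Lemma norm_row_sqr N (v : 'rV[R]_N) : `|v| ^+ 2 <= \sum_i (v 0 i) ^+ 2.
Proof.
have S0 : 0 <= \sum_i (v 0 i) ^+ 2 by apply: sumr_ge0 => i _; exact: sqr_ge0.
rewrite -[leRHS]sqr_sqrtr// ler_sqr ?nnegrE ?sqrtr_ge0//.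
apply: ler_norm_row; first exact: sqrtr_ge0.
move=> i; rewrite -ler_sqr ?nnegrE ?sqrtr_ge0// sqr_sqrtr// real_normK ?num_real//.
by rewrite (bigD1 i)//= lerDl sumr_ge0// => j _; exact: sqr_ge0.
Qed.

(** C is fixed before d and b: the bound is uniform over all pairs of solutions compared later. With
    E the sum of squares of d, the function (E + N b^2) exp(-c t) does not increase. *)
Lemma gronwall (N : nat) (a : R) : 0 <= a -> exists2 C : R, 0 <= C &
  forall (d dd : R -> 'rV[R]_N) (b : R), 0 <= b ->
  (forall (t : R) i, 0 <= t <= 1 -> is_derive t 1 (fun s => d s 0 i) (dd t 0 i)) ->
  (forall (t : R) i, 0 <= t <= 1 -> `|dd t 0 i| <= a * `|d t| + b) ->
  forall t : R, 0 <= t <= 1 -> `|d t| <= C * (`|d 0| + b).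
Proof.
move=> a0.
(* Per coordinate, 2 |d| (a |d| + b) is at most (2 a + 1) |d|^2 + b^2; summing gives the first term.
   The last 1 ensures c >= 1, so that c times N b^2 absorbs N b^2. *)
pose c := N%:R * (2 * a + 1) + 1.
have c1 : 1 <= c by rewrite /c lerDr mulr_ge0// addr_ge0// mulr_ge0.
exists (Num.sqrt (N%:R * expR c)); first exact: sqrtr_ge0.
move=> d dd b b0 D Db t t01.
pose E (s : R) := \sum_i (d s 0 i) ^+ 2.
pose dE (s : R) := \sum_i 2 * (d s 0 i * dd s 0 i).
have DE (s : R) : 0 <= s <= 1 -> is_derive s 1 E (dE s).
  move=> s01; apply: is_derive_sum => i.
  have Di := D s i s01.
  rewrite (_ : (fun _ => _) = (fun s => d s 0 i * d s 0 i)); last first.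
    by apply/funext => z; rewrite expr2.
  by apply: (is_derive_eq (is_derive_mul Di Di)); ring.
have dEle (s : R) : 0 <= s <= 1 -> dE s <= c * E s + N%:R * b ^+ 2.
  move=> s01; have nE := norm_row_sqr (d s).
  have : dE s <= \sum_(i < N) ((2 * a + 1) * `|d s| ^+ 2 + b ^+ 2).
    apply: ler_sum => i _.
    apply: (@le_trans _ _ (2 * (`|d s| * (a * `|d s| + b)))).
      rewrite ler_pM2l//; apply: le_trans (ler_norm _) _; rewrite normrM.
      by apply: ler_pM => //; [exact: ler_coord_norm|exact: Db].
    rewrite -subr_ge0 [leRHS](_ : _ = (`|d s| - b) ^+ 2); last by ring.
    exact: sqr_ge0.
  rewrite sumr_const card_ord -[_ *+ N]mulr_natl mulrDr mulrA.
  move=> /le_trans; apply; rewrite lerD2r /c.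
  have E0 : 0 <= E s by apply: sumr_ge0 => i _; exact: sqr_ge0.
  apply: le_trans (_ : N%:R * (2 * a + 1) * E s <= _); last by rewrite [leRHS]mulrDl mul1r lerDl.
  by rewrite ler_wpM2l// mulr_ge0// addr_ge0// mulr_ge0.
pose H (s : R) := (E s + N%:R * b ^+ 2) * expR (- c * s).
pose dH (s : R) := (dE s) * expR (- c * s) + (E s + N%:R * b ^+ 2) * (- c * expR (- c * s)).
have DH (s : R) : 0 <= s <= 1 -> is_derive s 1 H (dH s).
  move=> s01; have DEs := DE s s01.
  have Dexp : is_derive s 1 (fun s => expR (- c * s)) (- c * expR (- c * s)).
    exact: is_derive_scale.
  have D1 : is_derive s 1 (fun s => E s + N%:R * b ^+ 2) (dE s).
    rewrite -[dE s]addr0; apply: is_deriveD.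
  exact: is_derive_mul.
have HH : H t - H 0 <= 0.
  have := @derive_le H dH (fun=> (0 : R)) (fun=> (0 : R)) t t01 DH
    (fun s _ => is_derive_cst (0 : R) s 1); rewrite subrr; apply.
  move=> s s01; rewrite /dH mulrA [X in _ + X](_ : _ = - (c * (E s + N%:R * b ^+ 2)) * expR (- c * s)); last by ring.
  rewrite -mulrDl; apply: mulr_le0_ge0; last exact: expR_ge0.
  rewrite subr_le0 (le_trans (dEle s s01))// mulrDr lerD2l.
  by rewrite -[leLHS]mul1r ler_wpM2r// mulr_ge0// sqr_ge0.
have E0 : E 0 <= N%:R * `|d 0| ^+ 2.
  rewrite /E; apply: le_trans (_ : \sum_(i < N) `|d 0| ^+ 2 <= _).
    apply: ler_sum => i _; rewrite -[leLHS]real_normK ?num_real//.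
    by rewrite ler_sqr ?nnegrE// ler_coord_norm.
  by rewrite sumr_const card_ord mulr_natl.
have F : `|d t| ^+ 2 <= N%:R * expR c * (`|d 0| + b) ^+ 2.
  apply: le_trans (norm_row_sqr _) _.
  have ht : H t * expR (c * t) = E t + N%:R * b ^+ 2.
    by rewrite /H -mulrA -expRD mulNr addNr expR0 mulr1.
  apply: (@le_trans _ _ (E t + N%:R * b ^+ 2)); first by rewrite lerDl mulr_ge0// sqr_ge0.
  rewrite -ht; apply: (@le_trans _ _ (H 0 * expR (c * t))).
    by rewrite ler_wpM2r ?expR_ge0// -subr_le0.
  rewrite /H mulr0 expR0 mulr1.
  apply: (@le_trans _ _ (N%:R * (`|d 0| ^+ 2 + b ^+ 2) * expR c)).
    apply: ler_pM; rewrite ?expR_ge0//.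
    - by apply: addr_ge0; [apply: sumr_ge0 => i _; exact: sqr_ge0|rewrite mulr_ge0// sqr_ge0].
    - by rewrite mulrDr lerD2r.
    - rewrite ler_expR; case/andP: t01 => t0 t1.
      by rewrite -[leRHS]mulr1 ler_wpM2l// (le_trans _ c1).
  rewrite -mulrA [X in _ * X]mulrC mulrA; apply: ler_wpM2l; first by rewrite mulr_ge0// expR_ge0.
  rewrite sqrrD -addrA lerD2l lerDr.
  by rewrite mulrn_wge0// mulr_ge0.
rewrite -ler_sqr ?nnegrE//; last by rewrite mulr_ge0 ?sqrtr_ge0// addr_ge0.
by rewrite exprMn sqr_sqrtr// mulr_ge0// expR_ge0.
Qed.

End ODE.

(** * Existence of solutions by Picard iteration *)

Section Picard.
Context {R : realType}.

(** The intervals around a k of radius 2 K / 2^k, the tail of the geometric series, are nested; the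
    supremum of their left ends lies in all of them. *)
Lemma geometric_cauchy_limit (a : nat -> R) (K : R) : 0 <= K ->
  (forall k, `|a k.+1 - a k| <= K * 2^-1 ^+ k) ->
  exists l, forall k, `|l - a k| <= K * 2 * 2^-1 ^+ k.
Proof.
move=> K0 aK.
pose g k : R := K * 2 * 2^-1 ^+ k.
have gS k : g k = g k.+1 + K * 2^-1 ^+ k by rewrite /g exprS; field.
have g0 k : 0 <= g k by rewrite /g !mulr_ge0// exprn_ge0// invr_ge0.
have lo k j : (k <= j)%N -> a k - g k <= a j - g j.
  elim: j => [|j IH]; first by rewrite leqn0 => /eqP ->.
  rewrite leq_eqVlt => /orP[/eqP -> //|/IH /le_trans]; apply.
  have := aK j; rewrite ler_norml => /andP[+ _]; rewrite (gS j); lra.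
have hi k j : (k <= j)%N -> a j + g j <= a k + g k.
  elim: j => [|j IH]; first by rewrite leqn0 => /eqP ->.
  rewrite leq_eqVlt => /orP[/eqP -> //|/IH]; apply: le_trans.
  have := aK j; rewrite ler_norml => /andP[_ +]; rewrite (gS j); lra.
have lohi k j : a k - g k <= a j + g j.
  have := lo k (maxn k j) (leq_maxl _ _); have := hi j (maxn k j) (leq_maxr _ _).
  have := g0 (maxn k j); lra.
pose S := range (fun k => a k - g k).
have hS : has_sup S.
  split; first by exists (a 0%N - g 0%N); exists 0%N.
  by exists (a 0%N + g 0%N) => _ [k _ <-].
exists (sup S) => k; rewrite -/(g k) ler_distl; apply/andP; split.
  by apply: (sup_upper_bound hS); exists k.
by apply: sup_le_ub; [case: hS|move=> _ [j _ <-]].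
Qed.

(** Applied to norms: a bound valid for every iterate k becomes an equation in the limit. *)
Lemma ler_geometric0 (x K : R) : (forall k, x <= K * 2^-1 ^+ k) -> x <= 0.
Proof.
move=> xK; rewrite leNgt; apply/negP => x0.
have h : (fun k => K * 2^-1 ^+ k) @ \oo --> K * 0.
  apply: cvgM; [exact: cvg_cst|apply: cvg_expr].
  by rewrite ger0_norm ?invr_ge0// invf_lt1// ltr1n.
have := @cvgr_lt R nat \oo _ (fun k => K * 2^-1 ^+ k) (K * 0) h x.
rewrite mulr0 => /(_ _ x0)[k _ /(_ k (leqnn k))] /=.
by rewrite ltNge xK.
Qed.

(** Composition with it extends data controlled on an interval to continuous or Lipschitz data
    everywhere. *)
Definition clamp (a b t : R) : R := Num.max a (Num.min b t).

Lemma clamp_in a b t : a <= b -> a <= clamp a b t <= b.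
Proof. by move=> ab; rewrite /clamp le_max lexx /= ge_max ab ge_min lexx. Qed.

Lemma clamp_id a b t : a <= t <= b -> clamp a b t = t.
Proof. by move=> /andP[t0 t1]; rewrite /clamp min_r// max_r. Qed.

Lemma clamp_lipschitz a b s t : a <= b -> `|clamp a b s - clamp a b t| <= `|s - t|.
Proof.
move=> ab; wlog st : s t / s <= t.
  by move=> H; have [/H|/ltW/H] := leP s t; rewrite // distrC [in leRHS]distrC.
rewrite distrC [leRHS]distrC [leRHS]ger0_norm ?subr_ge0//.
rewrite /clamp /Num.max /Num.min.
have ab' := ab; have st' := st; move: ab st.
case: (ltP b s) => ?; case: (ltP b t) => ?; case: ltP => ?; case: ltP => ? => // _ _;
  rewrite ler_norml; lra.
Qed.

Definition clamp01 := clamp 0 1.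

Lemma clamp01_in t : 0 <= clamp01 t <= 1.
Proof. exact: clamp_in. Qed.

Lemma clamp01_id t : 0 <= t <= 1 -> clamp01 t = t.
Proof. exact: clamp_id. Qed.

Lemma clamp01_continuous : continuous clamp01.
Proof.
move=> t; apply/cvgrPdist_le => e e0.
apply: filterS ((cvgrPdist_le _ _).1 (@cvg_id _ (nbhs t)) e e0) => s.
by apply: le_trans; exact: clamp_lipschitz.
Qed.

Lemma row_continuous (T : topologicalType) N (y : T -> 'rV[R]_N) t :
  (forall i, {for t, continuous (fun s => y s 0 i)}) -> {for t, continuous y}.
Proof.
move=> cy; apply/cvgrPdist_lt => e e0.
have : \forall s \near t, forall i, `|y t 0 i - y s 0 i| < e.
  apply: (@filter_forall _ _ _ (nbhs t)) => i.
  exact: (cvgrPdist_lt _ _).1 (cy i) e e0.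
apply: filterS => s H; apply: ltr_norm_row => // i.
by rewrite !mxE.
Qed.

(** Continuity is asked along continuous curves, the form in which primitives use it. As F is
    globally Lipschitz in y, the solution exists up to time 1. *)
Lemma picard N (F : R -> 'rV[R]_N -> 'rV[R]_N) (L : R) (y0 : 'rV[R]_N) :
  0 <= L ->
  (forall (t : R) y z i, 0 <= t <= 1 -> `|(F t y - F t z) 0 i| <= L * `|y - z|) ->
  (forall y : R -> 'rV[R]_N, continuous y ->
     forall i, continuous (fun t => F t (y t) 0 i)) ->
  exists2 y : R -> 'rV[R]_N, y 0 = y0 &
    forall (t : R) i, 0 <= t <= 1 -> is_derive t 1 (fun s => y s 0 i) (F t (y t) 0 i).
Proof.
move=> L0 FL Fc.
(* A primitive is attached to every function, with a dummy for discontinuous ones, so that the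
   integral operator G is total. *)
have pr f : exists P : R -> R, continuous f -> P 0 = 0 /\
    forall t : R, 0 <= t <= 1 -> is_derive t 1 P (f t).
  have [cf|ncf] := pselect (continuous f); last by exists f.
  by have [P P0 PD] := exists_primitive cf; exists P.
have [P Pprop] := choice pr.
pose G (y : R -> 'rV[R]_N) (t : R) : 'rV[R]_N :=
  y0 + \row_i P (fun s => F s (y s) 0 i) t.
(* G y is controlled on [0, 1] only; the clamped time makes T y continuous on all of R, ready for
   the next iteration. *)
pose T y t := G y (clamp01 t).
have GD y i (t : R) : continuous y -> 0 <= t <= 1 ->
    is_derive t 1 (fun s => G y s 0 i) (F t (y t) 0 i).
  move=> cy t01; have [_ /(_ t t01) D] := Pprop _ (Fc _ cy i).
  rewrite (_ : (fun s => _) = (fun s => y0 0 i + P (fun s => F s (y s) 0 i) s)); last first.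
    by apply/funext => s; rewrite !mxE.
  by rewrite -[X in is_derive _ _ _ X]add0r; apply: is_deriveD.
have G0 y : continuous y -> G y 0 = y0.
  move=> cy; apply/rowP => i; rewrite !mxE.
  by have [-> _] := Pprop _ (Fc _ cy i); rewrite addr0.
have Tc y : continuous y -> continuous (T y).
  move=> cy t; apply: row_continuous => i.
  apply: (@continuous_comp _ _ _ clamp01 (fun s => G y s 0 i)); first exact: clamp01_continuous.
  have [D _] := GD y i _ cy (clamp01_in t).
  by apply: differentiable_continuous; exact/derivable1_diffP.
pose u k := iter k T (fun=> y0).
have uc k : continuous (u k).
  by elim: k => [|k IH]; [move=> t; exact: cvg_cst|exact: Tc].
have T01 y (t : R) : 0 <= t <= 1 -> T y t = G y t by move=> h; rewrite /T clamp01_id.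
(* The weight [expR (2 * L * t)] makes the Picard operator a contraction on the
   whole of [0, 1], whatever [L]. *)
have Gdiff y z (B : R) t : continuous y -> continuous z -> 0 <= B ->
    (forall s : R, 0 <= s <= 1 -> `|y s - z s| <= B * expR (2 * L * s)) ->
    0 <= t <= 1 -> `|G y t - G z t| <= B / 2 * expR (2 * L * t).
  move=> cy cz B0 yz t01; apply: ler_norm_row.
    by rewrite !mulr_ge0// ?invr_ge0// expR_ge0.
  move=> i.
  have De (s : R) : is_derive s 1 (fun s => B / 2 * expR (2 * L * s)) (L * (B * expR (2 * L * s))).
    have D : is_derive s 1 (fun s => expR (2 * L * s)) (2 * L * expR (2 * L * s)).
      exact: is_derive_scale.
    have D2 := is_deriveZ (B / 2) D.
    by apply: (is_derive_eq D2); rewrite /GRing.scale /=; field.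
  have := @derive_norm_le R (fun s => G y s 0 i - G z s 0 i)
    (fun s => F s (y s) 0 i - F s (z s) 0 i) _ _ t t01 _ (fun s _ => De s).
  rewrite !G0// subrr subr0 mulr0 expR0 mulr1 => H.
  have : `|G y t 0 i - G z t 0 i| <= B / 2 * expR (2 * L * t) - B / 2.
    apply: H; first by move=> s s01; apply: is_deriveB; exact: GD.
    move=> s s01; have := FL s (y s) (z s) i s01; rewrite !mxE => /le_trans; apply.
    by apply: ler_wpM2l => //; exact: yz.
  rewrite !mxE => /le_trans; apply; rewrite lerBlDr lerDl.
  by rewrite mulr_ge0// invr_ge0.
have [B B0 uB] : exists2 B : R, 0 <= B & forall t : R, 0 <= t <= 1 -> `|u 1%N t - u 0%N t| <= B.
  have cN : continuous (fun t => `|u 1%N t - u 0%N t|).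
    move=> t; apply: (@continuous_comp _ _ _ (fun t => u 1%N t - u 0%N t) Num.norm).
      by apply: cvgB; exact: uc.
    exact: norm_continuous.
  have [c c01 cmax] := @EVT_max R _ 0 1 ler01 (continuous_subspaceT cN).
  exists `|u 1%N c - u 0%N c| => // t t01; apply: cmax.
have exp1 (t : R) : 0 <= t -> 1 <= expR (2 * L * t).
  by move=> t0; rewrite -expR0 ler_expR !mulr_ge0.
have step k (t : R) : 0 <= t <= 1 -> `|u k.+1 t - u k t| <= B * 2^-1 ^+ k * expR (2 * L * t).
  elim: k t => [|k IH] t t01.
    rewrite expr0 mulr1 (le_trans (uB t t01))// -[leLHS]mulr1 ler_wpM2l// exp1//.
    by case/andP: t01.
  rewrite -[u k.+2 t]/(T (u k.+1) t) -[u k.+1 t]/(T (u k) t) !T01//.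
  rewrite (_ : B * 2^-1 ^+ k.+1 = B * 2^-1 ^+ k / 2); last by rewrite exprS; ring.
  by apply: Gdiff => //; rewrite mulr_ge0// exprn_ge0// invr_ge0.
pose K := B * expR (2 * L).
have K0 : 0 <= K by rewrite mulr_ge0// expR_ge0.
have uclamp k t : u k t = u k (clamp01 t).
  by case: k => // k; rewrite /u /= /T (clamp01_id (clamp01_in t)).
have stepK k t : `|u k.+1 t - u k t| <= K * 2^-1 ^+ k.
  rewrite uclamp (uclamp k); have t01 := clamp01_in t.
  apply: le_trans (step k _ t01) _.
  rewrite /K mulrAC; apply: ler_wpM2r; first by rewrite exprn_ge0// invr_ge0.
  apply: ler_wpM2l => //; rewrite ler_expR -[leRHS]mulr1; apply: ler_wpM2l.
    by rewrite mulr_ge0.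
  by case/andP: t01.
have lim t i : exists l, forall k, `|l - u k t 0 i| <= K * 2 * 2^-1 ^+ k.
  apply: geometric_cauchy_limit => // k.
  by apply: le_trans (stepK k t); rewrite (le_trans _ (ler_coord_norm _ i))// !mxE.
have [w wlim] : exists w : R -> 'rV[R]_N, forall t i k, `|w t 0 i - u k t 0 i| <= K * 2 * 2^-1 ^+ k.
  have [W HW] := choice (fun ti : R * 'I_N => lim ti.1 ti.2).
  by exists (fun t => \row_i W (t, i)) => t i k; rewrite mxE; exact: HW (t, i) k.
have wu t k : `|w t - u k t| <= K * 2 * 2^-1 ^+ k.
  apply: ler_norm_row; first by rewrite !mulr_ge0// exprn_ge0// invr_ge0.
  by move=> i; rewrite !mxE.
have wc : continuous w.
  move=> t; apply/cvgrPdist_le => e e0.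
  have [k ke] : exists k, K * 2 * 2^-1 ^+ k <= e / 3.
    apply: contrapT => nk; have : e / 3 <= 0; last by rewrite leNgt divr_gt0.
    apply: (@ler_geometric0 _ (K * 2)) => k; rewrite leNgt; apply/negP => /ltW h.
    by apply: nk; exists k.
  have e3 : 0 < e / 3 by rewrite divr_gt0.
  apply: filterS ((cvgrPdist_le _ _).1 (uc k t) _ e3) => s us.
  rewrite (_ : w t - w s = (w t - u k t) + (u k t - u k s) - (w s - u k s)); last first.
    by apply/rowP => i; rewrite !mxE; ring.
  apply: le_trans (ler_normB _ _) _; apply: (@le_trans _ _ (e / 3 + e / 3 + e / 3)); last by lra.
  apply: lerD; last exact: le_trans ke.
  apply: le_trans (ler_normD _ _) _; apply: lerD => //.
  exact: le_trans ke.
(* The limit w of the clamped iterates is frozen outside [0, 1]; the solution is G w, which agrees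
   with w on [0, 1] and has two-sided derivatives at the endpoints. *)
exists (G w); first exact: G0.
have Gw (t : R) : 0 <= t <= 1 -> G w t = w t.
  move=> t01; apply/eqP; rewrite -subr_eq0 -normr_le0.
  apply: (@ler_geometric0 _ (K * 2 * expR (2 * L) + K * 2)) => k.
  rewrite (_ : G w t - w t = (G w t - u k.+1 t) - (w t - u k.+1 t)); last first.
    by apply/rowP => i; rewrite !mxE; ring.
  apply: le_trans (ler_normB _ _) _; rewrite mulrDl; apply: lerD; last first.
    apply: le_trans (wu t k.+1) _; rewrite exprS mulrCA mulrA.
    apply: ler_wpM2r; first by rewrite exprn_ge0// invr_ge0.
    by rewrite -[leRHS]mul1r; apply: ler_wpM2r; [rewrite mulr_ge0|rewrite invf_le1// ler1n].
  rewrite -[u k.+1 t]/(T (u k) t) T01//.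
  have B'0 : 0 <= K * 2 * 2^-1 ^+ k by rewrite !mulr_ge0// exprn_ge0// invr_ge0.
  apply: le_trans (Gdiff w (u k) _ t wc (uc k) B'0 _ t01) _.
    move=> s /andP[s0 _]; apply: le_trans (wu s k) _.
    by rewrite -[leLHS]mulr1; apply: ler_wpM2l => //; exact: exp1.
  rewrite [leRHS]mulrAC; apply: ler_pM; rewrite ?expR_ge0//.
  - by rewrite mulr_ge0// invr_ge0.
  - by rewrite -[leRHS]mulr1; apply: ler_wpM2l => //; rewrite invf_le1// ler1n.
  - rewrite ler_expR -[leRHS]mulr1; apply: ler_wpM2l; first by rewrite mulr_ge0.
    by case/andP: t01.
by move=> t i t01; rewrite Gw//; exact: GD.
Qed.

End Picard.

(** * Differentiability of solutions in a parameter *)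

Section FlowFamily.
Context {R : realType}.

Lemma near_sub (V : normedModType R) (x : V) (P : V -> Prop) :
  (\forall h \near (0 : V), P h) -> \forall y \near x, P (y - x).
Proof.
move=> P0; have c : (y - x) @[y --> x] --> (0 : V).
  by rewrite -(subrr x); apply: cvgB; [exact: cvg_id|exact: cvg_cst].
exact: c P0.
Qed.

Lemma near_add (V : normedModType R) (x : V) (P : V -> Prop) :
  (\forall y \near x, P y) -> \forall h \near (0 : V), P (h + x).
Proof.
move=> P0; have c : (h + x) @[h --> (0 : V)] --> x.
  by rewrite -{2}(add0r x); apply: cvgD; [exact: cvg_id|exact: cvg_cst].
exact: c P0.
Qed.

Lemma differentiable_locally_lipschitz (V W : normedModType R) (G : V -> W) x :
  differentiable G x ->
  exists2 C, 0 <= C & \forall y \near x, `|G y - G x| <= C * `|y - x|.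
Proof.
move=> dG; have [k k0 kP] := linear_lipschitz (diff_continuous dG).
exists (1 + k); first by rewrite addr_ge0// ltW.
have := near_sub x (linear_approx dG ltr01).
apply: filterS => y; rewrite subrK mul1r => H.
rewrite -(subrK ('d G x (y - x)) (G y - G x)).
by apply: le_trans (ler_normD _ _) _; rewrite mulrDl mul1r; apply: lerD.
Qed.

Lemma continuous_bigsum (T : topologicalType) (I : Type) (r : seq I) (F : I -> T -> R) t :
  (forall i, {for t, continuous (F i)}) ->
  {for t, continuous (fun s => \sum_(i <- r) F i s)}.
Proof.
move=> cF; elim: r => [|i r IH].
  rewrite (_ : (fun _ => _) = fun=> 0); first exact: cvg_cst.
  by apply/funext => s; rewrite big_nil.
rewrite (_ : (fun _ => _) = fun s => F i s + \sum_(j <- r) F j s).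
  by apply: cvgD; [exact: cF|exact: IH].
by apply/funext => s; rewrite big_cons.
Qed.

(** Compactness of [0, 1] turns a radius found around each time into one that serves all times. *)
Lemma tube N (V : set 'rV[R]_N) (y : R -> 'rV[R]_N) (g : 'rV[R]_N -> R) (e : R) :
  open V -> (forall t : R, 0 <= t <= 1 -> {for t, continuous y}) ->
  (forall t : R, 0 <= t <= 1 -> V (y t)) ->
  (forall w, V w -> {for w, continuous g}) -> 0 < e ->
  \forall d \near (0 : R)^'+, forall t : R, 0 <= t <= 1 ->
    forall w, `|w - y t| < d -> V w /\ `|g w - g (y t)| < e.
Proof.
move=> oV cy yV cg e0.
have := (compact_near_coveringP _).1 (@segment_compact R 0 1) R (0 : R)^'+
  (fun d t => forall w, `|w - y t| < d -> V w /\ `|g w - g (y t)| < e) _ _.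
move=> H; have {}H := H _ _.
suff : \forall d \near (0 : R)^'+, `[0, 1]%classic `<=`
    (fun t => forall w, `|w - y t| < d -> V w /\ `|g w - g (y t)| < e).
  by apply: filterS => d Hd t t01; apply: Hd; rewrite /= in_itv.
apply: H => t0; rewrite /= in_itv /= => t01.
have e2 : 0 < e / 2 by rewrite divr_gt0.
have : nbhs (y t0) (V `&` [set w | `|g (y t0) - g w| < e / 2]).
  apply: filterI; first by apply: open_nbhs_nbhs; split=> //; exact: yV.
  exact: (cvgrPdist_lt _ _).1 (cg _ (yV _ t01)) _ e2.
move=> /nbhs_ballP[r /= r0 rP].
have r2 : 0 < r / 2 by rewrite divr_gt0.
exists ([set t | `|y t0 - y t| < r / 2], [set d | d < r / 2]).
  split; first exact: (cvgrPdist_lt _ _).1 (cy _ t01) _ r2.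
  exact: nbhs_right_lt.
move=> [t d] /= [yt dr] w wd.
have wB : ball (y t0) r w.
  rewrite -ball_normE /= -(subrK (y t) (y t0)) -addrA (le_lt_trans (ler_normD _ _))//.
  by rewrite (splitr r) ltrD// distrC (lt_trans wd).
have tB : ball (y t0) r (y t).
  by rewrite -ball_normE /= (lt_le_trans yt)// ler_pdivrMr// ler_peMr// ?ler1n// ltW.
have [Vw gw] := rP _ wB; have [_ gt] := rP _ tB; split=> //.
rewrite -(subrK (g (y t0)) (g w)) -addrA (le_lt_trans (ler_normD _ _))//.
by rewrite (splitr e) ltrD// distrC.
Qed.

Lemma bounded01 (h : R -> R) : (forall t : R, 0 <= t <= 1 -> {for t, continuous h}) ->
  exists2 B, 0 <= B & forall t : R, 0 <= t <= 1 -> `|h t| <= B.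
Proof.
move=> ch.
have cN : {within `[0, 1], continuous (fun t => `|h t|)}.
  apply: continuous_in_subspaceT => t; rewrite inE /= in_itv /= => t01.
  apply: (@continuous_comp _ _ _ h Num.norm); first exact: ch.
  exact: norm_continuous.
have [c c01 cmax] := EVT_max (@ler01 R) cN.
by exists `|h c| => // t t01; apply: cmax; rewrite in_itv.
Qed.

Section Family.
Context {n N : nat}.

Definition dcoef (f : 'rV[R]_N -> 'rV[R]_N) i l y := partial l (fun w => f w 0 i) y.

(** Solutions on [0, 1] depending on a parameter x through an arbitrary smooth initial value. The
    parameter is not the initial point, so that adjoining a derivative in x gives a family of the
    same kind. Continuity in x, uniform in time, is a field because all later estimates start from
    it. *)
Record flow_family (V : set 'rV[R]_N) (f : 'rV[R]_N -> 'rV[R]_N)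
    (O : set 'rV[R]_n) (Y : R -> 'rV[R]_n -> 'rV[R]_N) : Prop := FlowFamily {
  ff_open : open V;
  ff_smooth : forall i, smooth_on V (fun w => f w 0 i);
  ff_in : forall (t : R) x, 0 <= t <= 1 -> O x -> V (Y t x);
  ff_ode : forall (t : R) x i, 0 <= t <= 1 -> O x ->
    is_derive t 1 (fun s => Y s x 0 i) (f (Y t x) 0 i);
  ff_init : forall i, smooth_on O (fun x => Y 0 x 0 i);
  ff_cont : forall x e, O x -> 0 < e ->
    \forall y \near x, forall t : R, 0 <= t <= 1 -> `|Y t y - Y t x| < e }.

Variables (V : set 'rV[R]_N) (f : 'rV[R]_N -> 'rV[R]_N).
Variables (O : set 'rV[R]_n) (Y : R -> 'rV[R]_n -> 'rV[R]_N).
Hypotheses (oO : open O) (HY : flow_family V f O Y).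

Let D := dcoef f.

Lemma ff_time_continuous x (t : R) : O x -> 0 <= t <= 1 -> {for t, continuous (Y ^~ x)}.
Proof.
move=> Ox t01; apply: row_continuous => i.
have [d _] := ff_ode HY i t01 Ox.
by apply: differentiable_continuous; exact/derivable1_diffP.
Qed.

Lemma dcoef_continuous i l w : V w -> {for w, continuous (D i l)}.
Proof.
move=> Vw; apply: differentiable_continuous.
by apply: (smooth_on_differentiable _ Vw); apply: smooth_on_partial; exact: (ff_smooth HY).
Qed.

Lemma dcoef_time_continuous i l x (t : R) : O x -> 0 <= t <= 1 ->
  {for t, continuous (fun t => D i l (Y t x))}.
Proof.
move=> Ox t01; apply: (@continuous_comp _ _ _ (Y ^~ x) (D i l)).
  exact: ff_time_continuous.
by apply: dcoef_continuous; exact: ff_in HY _ _ t01 Ox.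
Qed.

Lemma dcoef_bound x : O x -> exists2 a, 0 <= a &
  forall (t : R) i w, 0 <= t <= 1 ->
    `|\sum_l (w : 'rV[R]_N) 0 l * D i l (Y t x)| <= a * `|w|.
Proof.
move=> Ox.
have ex (il : 'I_N * 'I_N) : exists B, 0 <= B /\ forall t : R, 0 <= t <= 1 -> `|D il.1 il.2 (Y t x)| <= B.
  have [|B B0 BP] := @bounded01 (fun t => D il.1 il.2 (Y t x)); last by exists B.
  by move=> t t01; exact: dcoef_time_continuous.
have [B HB] := choice ex.
exists (\sum_il B il); first by apply: sumr_ge0 => il _; case: (HB il).
move=> t i w t01; apply: le_trans (ler_norm_sum _ _ _) _.
have -> : \sum_il B il = \sum_i \sum_l B (i, l).
  by rewrite pair_bigA; apply: eq_bigr => -[].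
rewrite [X in _ <= X * _](bigD1 i)//= mulrDl mulr_suml.
apply: (@le_trans _ _ (\sum_l B (i, l) * `|w|)).
  apply: ler_sum => l _; rewrite normrM mulrC; apply: ler_pM => //.
    by have [_] := HB (i, l); apply.
  exact: ler_coord_norm.
rewrite lerDl mulr_ge0//; apply: sumr_ge0 => j _; apply: sumr_ge0 => l _.
by case: (HB (j, l)).
Qed.

(** In a tube around the orbit of x the Jacobian varies by less than e, and [ff_cont] keeps the
    orbit of y inside it. The second bound is the mean value theorem on the segment joining the two
    orbits. *)
Lemma dcoef_near x e : O x -> 0 < e -> \forall y \near x, O y /\
  forall t : R, 0 <= t <= 1 ->
   (forall i l, `|D i l (Y t y) - D i l (Y t x)| <= e) /\
   forall i, `|f (Y t y) 0 i - f (Y t x) 0 i - \sum_l (Y t y - Y t x) 0 l * D i l (Y t x)|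
       <= N%:R * e * `|Y t y - Y t x|.
Proof.
move=> Ox e0.
have T : \forall d \near (0 : R)^'+, forall il : 'I_N * 'I_N, forall t : R, 0 <= t <= 1 ->
    forall w, `|w - Y t x| < d -> V w /\ `|D il.1 il.2 w - D il.1 il.2 (Y t x)| < e.
  apply: filter_forall => il; apply: tube (e0).
  - exact: ff_open HY.
  - by move=> t t01; exact: ff_time_continuous.
  - by move=> t t01; exact: ff_in HY _ _ t01 Ox.
  - by move=> w Vw; exact: dcoef_continuous.
have [d [d0 dP]] := filter_ex (filterI (nbhs_right_gt 0) T).
have nO : \forall y \near x, O y by apply: open_nbhs_nbhs; split.
apply: filterS2 nO (ff_cont HY Ox d0) => y Oy Hy; split=> // t t01.
split; first by move=> i l; have [_ /ltW] := dP (i, l) t t01 _ (Hy t t01).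
move=> i.
have seg (s : R) : 0 <= s <= 1 -> `|Y t x + s *: (Y t y - Y t x) - Y t x| < d.
  move=> /andP[s0 s1]; rewrite addrAC subrr add0r normrZ ger0_norm//.
  by apply: le_lt_trans (Hy t t01); rewrite -[leRHS]mul1r ler_wpM2r.
have [|s s01 ->] := @mean_value R N (fun w => f w 0 i) (Y t x) (Y t y).
  move=> s s01; apply: (smooth_on_differentiable (ff_smooth HY i)).
  by have [] := dP (i, i) t t01 _ (seg s s01).
rewrite -sumrB (_ : _ * `|_| = \sum_(l < N) e * `|Y t y - Y t x|); last first.
  by rewrite sumr_const card_ord -mulrA mulr_natl.
apply: le_trans (ler_norm_sum _ _ _) _; apply: ler_sum => l _.
rewrite -mulrBr normrM mulrC; apply: ler_pM => //; last exact: ler_coord_norm.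
by have [_ /ltW] := dP (i, l) t t01 _ (seg s s01).
Qed.

(** Gronwall with b = 0 for the difference of two solutions; [dcoef_near] at e = 1 makes its rate of
    growth a + N. *)
Lemma ff_lipschitz x : O x -> exists2 C, 0 <= C &
  \forall y \near x, forall t : R, 0 <= t <= 1 -> `|Y t y - Y t x| <= C * `|y - x|.
Proof.
move=> Ox; have [a a0 aP] := dcoef_bound Ox.
have d0 : differentiable (Y 0) x.
  by apply: differentiable_row => i; exact: smooth_on_differentiable (ff_init HY i) Ox.
have [C0 C00 C0P] := differentiable_locally_lipschitz d0.
have aN : 0 <= a + N%:R by rewrite addr_ge0.
have [C1 C10 C1P] := @gronwall R N _ aN.
exists (C1 * C0); first by rewrite mulr_ge0.
apply: filterS2 C0P (dcoef_near Ox ltr01) => y H0 [Oy H1] t t01.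
have := C1P (fun t => Y t y - Y t x) (fun t => f (Y t y) - f (Y t x)) 0 (lexx _) _ _ t t01.
rewrite addr0 => H; apply: le_trans (H _ _) _; last by rewrite -mulrA ler_wpM2l.
  move=> s i s01; rewrite (_ : (fun _ => _) = fun s => Y s y 0 i - Y s x 0 i); last first.
    by apply/funext => u; rewrite !mxE.
  by rewrite !mxE; apply: is_deriveB; exact: (ff_ode HY).
move=> s i s01; rewrite addr0 !mxE.
have [_ /(_ i)] := H1 s s01; rewrite mulr1 => H2.
rewrite -[_ - _](subrK (\sum_l (Y s y - Y s x) 0 l * D i l (Y s x))) mulrDl.
by apply: le_trans (ler_normD _ _) _; rewrite [leLHS]addrC; apply: lerD => //; exact: aP.
Qed.

(** The linearized equation along an orbit has bounded coefficients, hence a global Lipschitz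
    constant. Time is clamped because these coefficients are controlled on [0, 1] only. *)
Lemma variational x (z0 : 'rV[R]_N) : O x -> exists2 z : R -> 'rV[R]_N, z 0 = z0 &
  forall (t : R) i, 0 <= t <= 1 ->
    is_derive t 1 (fun s => z s 0 i) (\sum_l (z t) 0 l * D i l (Y t x)).
Proof.
move=> Ox; have [a a0 aP] := dcoef_bound Ox.
have [||z zE zD] := @picard R N
  (fun t w => \row_i \sum_l w 0 l * D i l (Y (clamp01 t) x)) a z0 a0.
- move=> t y z i t01; rewrite !mxE -sumrB clamp01_id//.
  rewrite (eq_bigr (fun l => (y - z) 0 l * D i l (Y t x))); first exact: aP.
  by move=> l _; rewrite !mxE mulrBl.
- move=> y cy i t.
  rewrite (_ : (fun t => _) = fun t => \sum_l y t 0 l * D i l (Y (clamp01 t) x)); last first.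
    by apply/funext => s; rewrite mxE.
  apply: continuous_bigsum => l; apply: cvgM.
    apply: (@continuous_comp _ _ _ y (fun v : 'rV[R]_N => v 0 l)); first exact: cy.
    exact: coord_continuous.
  apply: (@continuous_comp _ _ _ clamp01 (fun t => D i l (Y t x))); first exact: clamp01_continuous.
  by apply: dcoef_time_continuous => //; exact: clamp01_in.
exists z => // t i t01; have := zD t i t01.
by rewrite mxE clamp01_id.
Qed.

(** The first order remainder [q] solves the linearized equation up to an error of order e1 |y - x|,
    and it starts at most as large as e1 |y - x|; Gronwall carries this to time t. *)
Lemma ff_differentiable x (z : 'I_n -> R -> 'rV[R]_N) : O x ->
  (forall j i, z j 0 0 i = partial j (fun x => Y 0 x 0 i) x) ->
  (forall j (t : R) i, 0 <= t <= 1 ->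
     is_derive t 1 (fun s => z j s 0 i) (\sum_l (z j t) 0 l * D i l (Y t x))) ->
  forall (t : R) i, 0 <= t <= 1 -> differentiable (fun x => Y t x 0 i) x /\
    forall j, partial j (fun x => Y t x 0 i) x = z j t 0 i.
Proof.
move=> Ox z0 zD t i t01; apply: differentiable_eps => e e0.
have [a a0 aP] := dcoef_bound Ox.
have [C C0 CP] := ff_lipschitz Ox.
have [C1 C10 C1P] := @gronwall R N _ a0.
(* Gronwall will yield C1 (e1 + N e1 C) |y - x|; the extra 1 makes K positive, so that e can be
   divided by it. *)
pose K := C1 * (1 + N%:R * C) + 1.
have K0 : 0 < K by rewrite ltr_wpDl// mulr_ge0// addr_ge0// mulr_ge0.
pose e1 := e / K.
have e10 : 0 < e1 by rewrite divr_gt0.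
have I0 : \forall y \near x, forall i,
   `|Y 0 y 0 i - Y 0 x 0 i - \sum_j (y - x) 0 j * z j 0 0 i| <= e1 * `|y - x|.
  apply: (@filter_forall _ _ _ (nbhs x)) => k.
  have dk : differentiable (fun x => Y 0 x 0 k) x.
    exact: smooth_on_differentiable (ff_init HY k) Ox.
  have := near_sub x (linear_approx dk e10).
  apply: filterS => y; rewrite subrK diffE_partial//.
  by under eq_bigr do rewrite -z0.
suff : \forall y \near x, `|Y t y 0 i - Y t x 0 i - \sum_j (y - x) 0 j * z j t 0 i| <= e * `|y - x|.
  by move=> /near_add; apply: filterS => h; rewrite addrK.
apply: filterS3 I0 CP (dcoef_near Ox e10) => y H0 HC [Oy H1].
pose q (t : R) : 'rV[R]_N := Y t y - Y t x - \sum_j (y - x) 0 j *: z j t.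
have qE s k : q s 0 k = Y s y 0 k - Y s x 0 k - \sum_j (y - x) 0 j * z j s 0 k.
  by rewrite !mxE summxE; congr (_ - _); apply: eq_bigr => j _; rewrite !mxE.
pose dq (t : R) : 'rV[R]_N := \row_k (f (Y t y) 0 k - f (Y t x) 0 k -
  \sum_j (y - x) 0 j * (\sum_l (z j t) 0 l * D k l (Y t x))).
rewrite -qE; apply: le_trans (ler_coord_norm _ _) _.
pose b := N%:R * e1 * (C * `|y - x|).
have b0 : 0 <= b by apply: mulr_ge0; apply: mulr_ge0 => //; exact: ltW.
apply: le_trans (C1P q dq b b0 _ _ t t01) _.
- move=> s k s01; rewrite (_ : (fun s => _) = fun s =>
    Y s y 0 k - Y s x 0 k - \sum_j (y - x) 0 j * z j s 0 k); last first.
    by apply/funext => u; rewrite qE.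
  rewrite mxE; apply: is_deriveB; first by apply: is_deriveB; exact: (ff_ode HY).
  apply: is_derive_sum => j; have := is_deriveZ ((y - x) 0 j) (zD j s k s01).
  by [].
- move=> s k s01; rewrite mxE.
  have -> : f (Y s y) 0 k - f (Y s x) 0 k -
      \sum_j (y - x) 0 j * (\sum_l (z j s) 0 l * D k l (Y s x)) =
     (\sum_l (q s) 0 l * D k l (Y s x)) +
     (f (Y s y) 0 k - f (Y s x) 0 k - \sum_l (Y s y - Y s x) 0 l * D k l (Y s x)).
    have -> : \sum_l (q s) 0 l * D k l (Y s x) = \sum_l (Y s y - Y s x) 0 l * D k l (Y s x)
        - \sum_j (y - x) 0 j * (\sum_l (z j s) 0 l * D k l (Y s x)).
      under eq_bigr do rewrite qE mulrBl mulr_suml.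
      rewrite sumrB exchange_big /=; congr (_ - _).
        by apply: eq_bigr => l _; rewrite !mxE.
      by apply: eq_bigr => j _; rewrite mulr_sumr; apply: eq_bigr => l _; rewrite mulrA.
    by ring.
  apply: le_trans (ler_normD _ _) _; apply: lerD; first exact: aP.
  have [_ /(_ k)] := H1 s s01 => /le_trans; apply.
  by apply: ler_wpM2l; [rewrite mulr_ge0// ltW|exact: HC].
have q0 : `|q 0| <= e1 * `|y - x|.
  apply: ler_norm_row; first by rewrite mulr_ge0// ltW.
  by move=> k; rewrite qE; exact: H0.
apply: (@le_trans _ _ (C1 * (e1 * `|y - x| + b))); first by rewrite ler_wpM2l// lerD2r.
rewrite (_ : C1 * _ = C1 * (1 + N%:R * C) * (e1 * `|y - x|)); last by rewrite /b; ring.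
rewrite (_ : e * _ = K * (e1 * `|y - x|)); last by rewrite /e1; field; rewrite gt_eqF.
by apply: ler_wpM2r; [rewrite mulr_ge0// ltW|rewrite lerDl].
Qed.

End Family.
End FlowFamily.

(** * Smoothness of solutions through the tangent system *)

Section FlowSmooth.
Context {R : realType}.

(** The tangent system: a point together with a vector evolving by the derivative of f at that
    point. *)
Definition tangent_fun N (f : 'rV[R]_N -> 'rV[R]_N) (w : 'rV[R]_(N + N)) : 'rV[R]_(N + N) :=
  row_mx (f (lsubmx w))
    (\row_i \sum_l (rsubmx w) 0 l * dcoef f i l (lsubmx w)).

Lemma lsubmx_continuous m n : continuous (lsubmx : 'rV[R]_(m + n) -> 'rV[R]_m).
Proof. by move=> w; apply: differentiable_continuous; exact: differentiable_lsubmx. Qed.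

Lemma smooth_on_lsubmx m n (V : set 'rV[R]_m) (h : 'rV[R]_m -> R) :
  open V -> smooth_on V h ->
  smooth_on [set w : 'rV[R]_(m + n) | V (lsubmx w)] (fun w => h (lsubmx w)).
Proof.
move=> oV sh.
have oV' : open [set w : 'rV[R]_(m + n) | V (lsubmx w)].
  by apply: open_comp => // w _; exact: lsubmx_continuous.
apply: (smooth_on_comp oV' oV) => // i.
apply: (@eq_smooth_on _ _ _ (fun w : 'rV[R]_(m + n) => w 0 (lshift n i))) => //.
  by move=> w _; rewrite mxE.
exact: smooth_on_coord.
Qed.

(** The field that takes work is continuity in x of the derivative Z: one compares two solutions of
    linearized equations whose coefficients are e1-close for y near x. *)
Lemma flow_family_tangent n N (V : set 'rV[R]_N) f (O : set 'rV[R]_n)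
    (Y : R -> 'rV[R]_n -> 'rV[R]_N) (j : 'I_n) :
  open O -> flow_family V f O Y ->
  exists Z : R -> 'rV[R]_n -> 'rV[R]_N,
    (forall (t : R) x i, 0 <= t <= 1 -> O x ->
      differentiable (fun x => Y t x 0 i) x /\ partial j (fun x => Y t x 0 i) x = Z t x 0 i) /\
    flow_family [set w : 'rV[R]_(N + N) | V (lsubmx w)] (tangent_fun f) O
      (fun t x => row_mx (Y t x) (Z t x)).
Proof.
move=> oO HY.
have ex (xj : 'rV[R]_n * 'I_n) : exists z : R -> 'rV[R]_N, O xj.1 ->
    (forall i, z 0 0 i = partial xj.2 (fun x => Y 0 x 0 i) xj.1) /\
    forall (t : R) i, 0 <= t <= 1 ->
    is_derive t 1 (fun s => z s 0 i) (\sum_l (z t) 0 l * dcoef f i l (Y t xj.1)).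
  have [Ox|nO] := pselect (O xj.1); last by exists (fun=> 0).
  have [z z0 zD] := variational HY (\row_i partial xj.2 (fun x => Y 0 x 0 i) xj.1) Ox.
  by exists z => _; split=> // i; rewrite z0 mxE.
have [W HW] := choice ex.
have dif (t : R) x i : 0 <= t <= 1 -> O x ->
  differentiable (fun x => Y t x 0 i) x /\
    forall k, partial k (fun x => Y t x 0 i) x = W (x, k) t 0 i.
  move=> t01 Ox; apply: (ff_differentiable oO HY Ox (z := fun j => W (x, j))) => //.
    by move=> k i'; have [/(_ i')] := HW (x, k) Ox.
  by move=> k s i' s01; have [_] := HW (x, k) Ox; apply.
pose Z t x := W (x, j) t; exists Z; split.
  by move=> t x i t01 Ox; have [d E] := dif t x i t01 Ox.
have oV := ff_open HY.
have oV' : open [set w : 'rV[R]_(N + N) | V (lsubmx w)].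
  by apply: open_comp => // w _; exact: lsubmx_continuous.
have Z0 i : smooth_on O (fun x => Z 0 x 0 i).
  apply: (eq_smooth_on oO) (smooth_on_partial j (ff_init HY i)) => x Ox.
  by have [->] := HW (x, j) Ox.
split=> //.
- move=> k; have [i ->|i ->] := split_ordP k.
    apply: (@eq_smooth_on _ _ _ (fun w => f (lsubmx w) 0 i)) => //.
      by move=> w _; rewrite /tangent_fun row_mxEl.
    exact: (smooth_on_lsubmx _ (ff_smooth HY i)).
  apply: (@eq_smooth_on _ _ _ (fun w => \sum_l w 0 (rshift N l) * dcoef f i l (lsubmx w))) => //.
    by move=> w _; rewrite /tangent_fun row_mxEr mxE; apply: eq_bigr => l _; rewrite mxE.
  apply: smooth_on_sum => // l; apply: smooth_onM => //; first exact: smooth_on_coord.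
  by apply: smooth_on_lsubmx => //; apply: smooth_on_partial; exact: (ff_smooth HY).
- by move=> t x t01 Ox /=; rewrite row_mxKl; exact: (ff_in HY).
- move=> t x k t01 Ox; have [i ->|i ->] := split_ordP k; rewrite /tangent_fun row_mxKl row_mxKr.
    rewrite row_mxEl (_ : (fun _ => _) = fun s => Y s x 0 i); first exact: (ff_ode HY).
    by apply/funext => s; rewrite row_mxEl.
  rewrite row_mxEr mxE (_ : (fun _ => _) = fun s => Z s x 0 i).
    by have [_] := HW (x, j) Ox; apply.
  by apply/funext => s; rewrite row_mxEr.
- move=> k; have [i ->|i ->] := split_ordP k.
    apply: (eq_smooth_on oO) (ff_init HY i) => x _; by rewrite row_mxEl.
  by apply: (eq_smooth_on oO) (Z0 i) => x _; rewrite row_mxEr.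
- move=> x e Ox e0.
  have [a a0 aP] := dcoef_bound HY Ox.
  have [B B0 BP] : exists2 B, 0 <= B & forall t : R, 0 <= t <= 1 -> `|Z t x| <= B.
    have [|B B0 BP] := @bounded01 _ (fun t => `|Z t x|); last first.
      by exists B => // t /BP; rewrite normr_id.
    move=> t t01; apply: (@continuous_comp _ _ _ (fun t => Z t x) Num.norm); last exact: norm_continuous.
    apply: row_continuous => i; have [_ /(_ t i t01)[d _]] := HW (x, j) Ox.
    by apply: differentiable_continuous; exact/derivable1_diffP.
  (* The change of coefficients contributes N e1 |Z t y - Z t x|, absorbed in the rate a + N because
     e1 <= 1, and N e1 |Z t x|, at most N e1 B. Taking e1 below e / (2 K) makes the final inequality
     strict. *)
  have aN : 0 <= a + N%:R by rewrite addr_ge0.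
  have [C C0 CP] := @gronwall R N _ aN.
  pose K := C * (1 + N%:R * B) + 1.
  have K0 : 0 < K by rewrite ltr_wpDl// mulr_ge0// addr_ge0// mulr_ge0.
  pose e1 := Num.min 1 (e / (K + K)).
  have e10 : 0 < e1 by rewrite lt_min ltr01 divr_gt0// addr_gt0.
  have e11 : e1 <= 1 by rewrite ge_min lexx.
  have e1K : K * e1 < e.
    rewrite mulrC -ltr_pdivlMr//; apply: (@le_lt_trans _ _ (e / (K + K))).
      by rewrite ge_min lexx orbT.
    have eK : 0 < e / K by rewrite divr_gt0.
    by rewrite -mulr2n -mulr_natr invfM mulrA; lra.
  have nZ0 : \forall y \near x, forall i, `|Z 0 y 0 i - Z 0 x 0 i| <= e1.
    apply: (@filter_forall _ _ _ (nbhs x)) => i.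
    have c : {for x, continuous (fun x => Z 0 x 0 i)}.
      by apply: differentiable_continuous; exact: smooth_on_differentiable (Z0 i) Ox.
    by apply: filterS ((cvgrPdist_le _ _).1 c _ e10) => y; rewrite distrC.
  apply: filterS3 (ff_cont HY Ox e0) nZ0 (dcoef_near oO HY Ox e10) => y HYy HZ [Oy Hd] t t01.
  apply: ltr_norm_row => // k; have [i ->|i ->] := split_ordP k.
    rewrite opp_row_mx add_row_mx row_mxEl; apply: le_lt_trans (HYy t t01).
    exact: ler_coord_norm.
  rewrite opp_row_mx add_row_mx row_mxEr; apply: le_lt_trans (ler_coord_norm _ _) _.
  pose dd (t : R) : 'rV[R]_N := \row_i (\sum_l (Z t y) 0 l * dcoef f i l (Y t y) -
    \sum_l (Z t x) 0 l * dcoef f i l (Y t x)).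
  pose b := N%:R * e1 * B.
  have b0 : 0 <= b by rewrite mulr_ge0// mulr_ge0// ltW.
  apply: le_lt_trans (CP (fun t => Z t y - Z t x) dd b b0 _ _ t t01) _.
  + move=> s k' s01; rewrite mxE.
    rewrite (_ : (fun _ => _) = fun s => Z s y 0 k' - Z s x 0 k'); last first.
      by apply/funext => u; rewrite !mxE.
    by apply: is_deriveB; [have [_] := HW (y, j) Oy|have [_] := HW (x, j) Ox]; apply.
  + move=> s k' s01; rewrite mxE.
    have [Hds _] := Hd s s01.
    pose E l := dcoef f k' l (Y s y) - dcoef f k' l (Y s x).
    have -> : \sum_l (Z s y) 0 l * dcoef f k' l (Y s y) - \sum_l (Z s x) 0 l * dcoef f k' l (Y s x)
      = \sum_l (Z s y - Z s x) 0 l * dcoef f k' l (Y s x) +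
        (\sum_l (Z s y - Z s x) 0 l * E l + \sum_l (Z s x) 0 l * E l).
      by rewrite -!big_split -sumrB /=; apply: eq_bigr => l _; rewrite /E !mxE; ring.
    have sE v : `|\sum_l (v : 'rV[R]_N) 0 l * E l| <= N%:R * e1 * `|v|.
      apply: le_trans (ler_norm_sum _ _ _) _.
      apply: (@le_trans _ _ (\sum_(l < N) e1 * `|v|)).
        apply: ler_sum => l _; rewrite normrM mulrC; apply: ler_pM => //; last exact: ler_coord_norm.
        exact: Hds.
      by rewrite sumr_const card_ord -mulrA mulr_natl.
    apply: le_trans (ler_normD _ _) _; rewrite mulrDl -addrA; apply: lerD; first exact: aP.
    apply: le_trans (ler_normD _ _) _; apply: lerD.
      apply: le_trans (sE _) _; rewrite -[leRHS]mul1r [1 * _]mulrA mul1r; apply: ler_wpM2r => //.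
      by rewrite -[leRHS]mulr1; apply: ler_wpM2l.
    apply: le_trans (sE _) _; rewrite /b; apply: ler_wpM2l; first by rewrite mulr_ge0// ltW.
    exact: BP.
  + apply: le_lt_trans e1K.
    apply: (@le_trans _ _ (C * (e1 + b))).
      rewrite ler_wpM2l// lerD2r; apply: ler_norm_row; first exact: ltW.
      by move=> l; rewrite !mxE; exact: HZ.
    rewrite (_ : C * _ = C * (1 + N%:R * B) * e1); last by rewrite /b; ring.
    by rewrite ler_wpM2r ?lerDl// ltW.
Qed.

(* The derivative of a solution in the parameter x_j is the second half of a
   solution of the tangent system, which satisfies the same hypotheses. *)
Lemma flow_smooth n N (V : set 'rV[R]_N) f (O : set 'rV[R]_n)
    (Y : R -> 'rV[R]_n -> 'rV[R]_N) i :
  open O -> flow_family V f O Y -> smooth_on O (fun x => Y 1 x 0 i).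
Proof.
move=> oO HY.
(* The dimension of the state is quantified inside P, since each derivative doubles it; h is the
   quantity read off at time 1. *)
pose P g := exists N (V : set 'rV[R]_N) f (Y : R -> 'rV[R]_n -> 'rV[R]_N) h,
  [/\ flow_family V f O Y, smooth_on V h & g = fun x => h (Y 1 x)].
have l11 : 0 <= (1 : R) <= 1 by rewrite ler01 lexx.
have dY M (V' : set 'rV[R]_M) f' Y' x (k : 'I_n) : flow_family V' f' O Y' -> O x ->
    differentiable (Y' 1) x.
  move=> HY' Ox; apply: differentiable_row => l.
  have [Z [HZ _]] := flow_family_tangent k oO HY'.
  by have [] := HZ 1 x l l11 Ox.
apply: (@smooth_on_coind _ _ _ P) => //.
- move=> _ [M [V' [f' [Y' [h [HY' sh ->]]]]]] x Ox.
  apply: (@differentiable_comp _ _ _ _ (Y' 1) h).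
    (* Without parameters there is no direction in which to form a tangent system; the parameter
       space is then a single point and every map on it is constant. *)
    case: n O Y oO HY P dY Y' HY' x Ox => [|n'] O' Y0 oO' HY0 P dY Y' HY' x Ox; last exact: (dY _ _ _ _ _ ord0 HY').
    have -> : Y' 1 = cst (Y' 1 x).
      by apply/funext => y /=; congr (Y' 1 _); apply/rowP => -[].
    exact: differentiable_cst.
  exact: smooth_on_differentiable sh (ff_in HY' l11 Ox).
- move=> _ [M [V' [f' [Y' [h [HY' sh ->]]]]]] j.
  have [Z [HZ HYZ]] := flow_family_tangent j oO HY'.
  exists (fun x => \sum_l (row_mx (Y' 1 x) (Z 1 x)) 0 (rshift M l) *
      partial l h (lsubmx (row_mx (Y' 1 x) (Z 1 x)))).
    exists (M + M)%N, [set w : 'rV[R]_(M + M) | V' (lsubmx w)], (tangent_fun f'), (fun t x => row_mx (Y' t x) (Z t x)), (fun w : 'rV[R]_(M + M) => \sum_l w 0 (rshift M l) * partial l h (lsubmx w)).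
    split; [exact: HYZ| |by []].
    have oW := ff_open HYZ.
    apply: smooth_on_sum => // l; apply: smooth_onM => //; first exact: smooth_on_coord.
    by apply: smooth_on_lsubmx; [exact: ff_open HY'|exact: smooth_on_partial].
  move=> x Ox; rewrite (partial_comp (F := Y' 1) (h := h)); last first.
  + exact: smooth_on_differentiable sh (ff_in HY' l11 Ox).
  + exact: dY j HY' Ox.
  apply: eq_bigr => l _; rewrite row_mxKl row_mxEr mulrC; congr (_ * _).
  by have [_ ->] := HZ 1 x l l11 Ox.
- exists N, V, f, Y, (fun y => y 0 i); split=> //.
  by apply: smooth_on_coord; exact: ff_open HY.
Qed.

End FlowSmooth.

(** * Inverse functions and straightening of vector fields *)

Section InverseFunction.
Context {R : realType}.

(** The factor 1/2 is the ratio of [geometric_cauchy_limit]: the iterates of the centre move by at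
    most r / 2^k, and their limit stays in the closed ball, where T still contracts. *)
Lemma contraction_fixed_point n (T : 'rV[R]_n -> 'rV[R]_n) a r : 0 <= r ->
  (forall u, `|u - a| <= r -> `|T u - a| <= r) ->
  (forall u v, `|u - a| <= r -> `|v - a| <= r -> `|T u - T v| <= 2^-1 * `|u - v|) ->
  exists2 u, `|u - a| <= r & T u = u.
Proof.
move=> r0 Tr TL.
pose u k := iter k T a.
have ur k : `|u k - a| <= r.
  by elim: k => [|k IH]; [rewrite subrr normr0|exact: Tr].
have step k : `|u k.+1 - u k| <= r * 2^-1 ^+ k.
  elim: k => [|k IH]; first by rewrite mulr1; exact: (ur 1%N).
  apply: le_trans (TL _ _ (ur k.+1) (ur k)) _.
  by rewrite exprS mulrCA ler_pM2l// invr_gt0.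
have lim i : exists l, forall k, `|l - u k 0 i| <= r * 2 * 2^-1 ^+ k.
  apply: geometric_cauchy_limit => // k.
  by apply: le_trans (step k); apply: le_trans (ler_coord_norm _ i); rewrite !mxE.
have [W HW] := choice lim; pose w := \row_i W i.
have wu k : `|w - u k| <= r * 2 * 2^-1 ^+ k.
  apply: ler_norm_row; first by rewrite !mulr_ge0// exprn_ge0// invr_ge0.
  by move=> i; rewrite !mxE.
have wr : `|w - a| <= r.
  rewrite -subr_le0; apply: (@ler_geometric0 _ _ (r * 2)) => k.
  rewrite lerBlDr -(subrK (u k) w) -addrA; apply: le_trans (ler_normD _ _) _.
  by apply: lerD.
exists w => //; apply/eqP; rewrite -subr_eq0 -normr_le0.
apply: (@ler_geometric0 _ _ (r * 2)) => k.
rewrite -(subrK (u k.+1) (T w)) -addrA; apply: le_trans (ler_normD _ _) _.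
rewrite [leRHS](_ : _ = 2^-1 * (r * 2 * 2^-1 ^+ k) + r * 2 * 2^-1 ^+ k.+1); last first.
  by rewrite exprS; field.
apply: lerD; last by rewrite distrC.
by apply: le_trans (TL _ _ wr (ur k)) _; rewrite ler_pM2l// invr_gt0.
Qed.

Lemma ler_norm_mulmx n p (M : 'M[R]_(n, p)) : exists2 K, 0 <= K &
  forall v : 'rV[R]_n, `|v *m M| <= K * `|v|.
Proof.
exists (\sum_i \sum_j `|M i j|).
  by apply: sumr_ge0 => i _; exact: sumr_ge0.
move=> v; apply: ler_norm_row.
  by rewrite mulr_ge0//; apply: sumr_ge0 => i _; exact: sumr_ge0.
move=> j; rewrite mxE mulr_suml; apply: le_trans (ler_norm_sum _ _ _) _.
apply: ler_sum => i _; rewrite normrM mulrC; apply: ler_pM => //; last exact: ler_coord_norm.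
by rewrite (bigD1 j)//= lerDl sumr_ge0.
Qed.

Lemma mulmx_continuous n p (M : 'M[R]_(n, p)) : continuous (fun v : 'rV[R]_n => v *m M).
Proof.
move=> v; apply: row_continuous => i.
rewrite (_ : (fun _ => _) = fun w : 'rV[R]_n => \sum_j w 0 j * M j i); last first.
  by apply/funext => w; rewrite mxE.
apply: continuous_bigsum => j.
have c : {for v, continuous (fun w : 'rV[R]_n => w 0 j : R)}.
  by apply: differentiable_continuous; exact: differentiable_coord.
exact: cvgM c (cvg_cst _).
Qed.

Lemma smooth_on_mulmx n p q (U : set 'rV[R]_q) (F : 'rV[R]_q -> 'rV[R]_n) (M : 'M[R]_(n, p)) i :
  open U -> (forall j, smooth_on U (fun u => F u 0 j)) ->
  smooth_on U (fun u => (F u *m M) 0 i).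
Proof.
move=> oU sF; apply: (@eq_smooth_on _ _ _ (fun u => \sum_j F u 0 j * M j i)) => //.
  by move=> u _; rewrite mxE.
apply: smooth_on_sum => // j; apply: smooth_onM => //; exact: smooth_on_cst.
Qed.

(** Rows are indexed by directions, because vectors are rows: the differential is v |-> v *m jac F
    u. *)
Definition jac n (F : 'rV[R]_n -> 'rV[R]_n) (u : 'rV[R]_n) : 'M[R]_n :=
  \matrix_(i, j) partial i (fun u => F u 0 j) u.

Lemma smooth_on_det n (U : set 'rV[R]_n) p (A : 'rV[R]_n -> 'M[R]_p) : open U ->
  (forall i j, smooth_on U (fun u => A u i j)) -> smooth_on U (fun u => \det (A u)).
Proof.
move=> oU sA; apply: smooth_on_sum => // s; apply: smooth_onM => //.
  exact: smooth_on_cst.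
by apply: smooth_on_prod => // i.
Qed.

(** Cramer's formula: the entries of the inverse are polynomials in those of A divided by the
    determinant. *)
Lemma smooth_on_invmx n (U : set 'rV[R]_n) p (A : 'rV[R]_n -> 'M[R]_p) i j : open U ->
  (forall i j, smooth_on U (fun u => A u i j)) -> (forall u, U u -> A u \in unitmx) ->
  smooth_on U (fun u => invmx (A u) i j).
Proof.
move=> oU sA uA.
apply: (@eq_smooth_on _ _ _ (fun u => (\det (A u))^-1 * cofactor (A u) j i)) => //.
  by move=> u Uu; rewrite /invmx uA// !mxE.
apply: smooth_onM => //.
  apply: smooth_onV => //; last exact: smooth_on_det.
  by move=> u /uA; rewrite unitmxE unitfE.
apply: smooth_onM => //; first exact: smooth_on_cst.
apply: smooth_on_det => // k l.
apply: (@eq_smooth_on _ _ _ (fun u => A u (lift j k) (lift i l))) => // u _.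
by rewrite !mxE.
Qed.

Lemma rowB n (u v : 'rV[R]_n) i : (u - v) 0 i = u 0 i - v 0 i.
Proof. by rewrite !mxE. Qed.

Lemma lipschitz_at_continuous (V W : normedModType R) (G : V -> W) y K : 0 <= K ->
  (\forall z \near y, `|G z - G y| <= K * `|z - y|) -> {for y, continuous G}.
Proof.
move=> K0 GK; apply/cvgrPdist_le => d d0.
have K1 : 0 < K + 1 by rewrite ltr_wpDl.
have d1 : 0 < d / (K + 1) by rewrite divr_gt0.
apply: filterS2 GK ((cvgrPdist_le _ _).1 (@cvg_id _ (nbhs y)) _ d1) => z + yz.
rewrite distrC => /le_trans; apply.
apply: (@le_trans _ _ ((K + 1) * (d / (K + 1)))); last by rewrite mulrC divfK// gt_eqF.
by apply: ler_pM => //; [rewrite lerDl|rewrite distrC].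
Qed.

(** With B the Jacobian at a, the map g u = u - F u B^-1 has zero derivative at a, so it is
    1/2-Lipschitz on a small ball, and F u = y says that u is a fixed point of u |-> y B^-1 + g u.
    The inverse is shown to be Lipschitz, then differentiable, then smooth. *)
Lemma inverse_function n (F : 'rV[R]_n -> 'rV[R]_n) a W :
  smooth_map_at F a -> jac F a \in unitmx -> nbhs a W ->
  exists U V G, [/\ open U, open V, U a, U `<=` W &
    [/\ (forall u, U u -> V (F u) /\ G (F u) = u),
        (forall y, V y -> U (G y) /\ F (G y) = y),
        (forall i, smooth_on U (fun u => F u 0 i)) &
        (forall i, smooth_on V (fun y => G y 0 i))]].
Proof.
move=> sF; set B := jac F a => uB nW.
have [Q [oO Oa sFO]] := smooth_map_at_smooth_on sF.
pose g u := u - F u *m invmx B.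
have sg i : smooth_on Q (fun u => g u 0 i).
  apply: (@eq_smooth_on _ _ _ (fun u => u 0 i - (F u *m invmx B) 0 i)) => //.
    by move=> u _; rewrite /g !mxE.
  apply: smooth_onB => //; first exact: smooth_on_coord.
  exact: smooth_on_mulmx.
have dFu u : Q u -> differentiable F u.
  by move=> Ou; apply: differentiable_row => i; exact: smooth_on_differentiable (sFO i) Ou.
have dpg i j u : Q u -> partial i (fun u => g u 0 j) u = (1%:M - jac F u *m invmx B) i j.
  move=> Ou; rewrite (_ : (fun u => g u 0 j) = fun u : 'rV[R]_n => u 0 j - \sum_k F u 0 k * invmx B k j); last first.
    by apply/funext => v; rewrite /g !mxE.
  have d k : differentiable (fun u => F u 0 k) u by exact: smooth_on_differentiable (sFO k) Ou.
  have dk k : differentiable (fun u => F u 0 k * invmx B k j) u by exact: differentiableM.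
  have -> : (fun u : 'rV[R]_n => u 0 j - \sum_k F u 0 k * invmx B k j) =
    (fun u : 'rV[R]_n => u 0 j) - \sum_k (fun u => F u 0 k * invmx B k j).
    by apply/funext => v; rewrite !fctE fct_sumE.
  rewrite /partial deriveB; last 2 first.
  - by apply: diff_derivable; exact: differentiable_coord.
  - by apply: diff_derivable; apply: differentiable_sum.
  rewrite derive_sum; last by move=> k; exact: diff_derivable.
  rewrite !mxE; congr (_ - _).
    rewrite -[LHS]/(partial i (fun u : 'rV[R]_n => u 0 j) u) partial_coord.
    by rewrite mxE eqxx eq_sym.
  apply: eq_bigr => k _; rewrite !mxE mulrC.
  have -> : (fun u => F u 0 k * invmx B k j) = invmx B k j \*: (fun u => F u 0 k).
    by apply/funext => v; rewrite /GRing.scale /= mulrC.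
  by rewrite deriveZ//; exact: diff_derivable.
(* A bound e on each partial derivative of g gives the Lipschitz constant n e <= 1/2 in the sup
   norm; n + 1 keeps the denominator positive when n = 0. *)
pose e : R := (2 * (n%:R + 1))^-1.
have e0 : 0 < e by rewrite invr_gt0 mulr_gt0// ltr_wpDl.
have ne : n%:R * e <= 2^-1.
  rewrite /e invfM mulrCA -[leRHS]mulr1 ler_pM2l ?invr_gt0//.
  by rewrite ler_pdivrMr ?ltr_wpDl// mul1r lerDl.
have nQW : \forall u \near a, Q u /\ W u.
  by exact: filterI (open_nbhs_nbhs (conj oO Oa)) nW.
have nD : \forall u \near a, forall ij : 'I_n * 'I_n,
    `|partial ij.1 (fun u => g u 0 ij.2) u| <= e.
  apply: (@filter_forall _ _ _ (nbhs a)) => ij.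
  have c : {for a, continuous (partial ij.1 (fun u => g u 0 ij.2))}.
    apply: differentiable_continuous.
    exact: smooth_on_differentiable (smooth_on_partial ij.1 (sg ij.2)) Oa.
  apply: filterS ((cvgrPdist_le _ _).1 c e e0) => u.
  by rewrite (dpg _ _ a)// mulmxV// subrr mxE sub0r normrN.
have nP : \forall u \near a, (Q u /\ W u) /\ forall ij : 'I_n * 'I_n,
    `|partial ij.1 (fun u => g u 0 ij.2) u| <= e.
  by exact: filterI nQW nD.
have [r2 /= r20 r2P] := (nbhs_ballP _ _).1 nP.
pose r := r2 / 2.
have r0 : 0 < r by rewrite divr_gt0.
have rP u : `|u - a| <= r -> (Q u /\ W u) /\ forall i j,
    `|partial i (fun u => g u 0 j) u| <= e.
  move=> ua; have [|OW H] := r2P u.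
    rewrite -ball_normE /= distrC (le_lt_trans ua)// /r ltr_pdivrMr//.
    by rewrite ltr_pMr// ltr1n.
  by split=> // i j; exact: (H (i, j)).
have gL u v : `|u - a| <= r -> `|v - a| <= r -> `|g u - g v| <= 2^-1 * `|u - v|.
  move=> ua va; apply: ler_norm_row; first by rewrite mulr_ge0// invr_ge0.
  move=> j; have seg (t : R) : 0 <= t <= 1 -> `|v + t *: (u - v) - a| <= r.
    move=> /andP[t0 t1]; rewrite (_ : _ - a = t *: (u - a) + (1 - t) *: (v - a)); last first.
      by apply/rowP => i; rewrite !mxE; ring.
    apply: le_trans (ler_normD _ _) _; rewrite !normrZ (ger0_norm t0) ger0_norm ?subr_ge0//.
    rewrite [leRHS](_ : r = t * r + (1 - t) * r); last by ring.
    by apply: lerD; apply: ler_wpM2l; rewrite ?subr_ge0.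
  have -> : (g u - g v) 0 j = g u 0 j - g v 0 j by rewrite mxE [(- g v) 0 j]mxE.
  have [|t t01 ->] := @mean_value R n (fun w => g w 0 j) v u.
    move=> t /seg /rP[[Ot _] _]; exact: smooth_on_differentiable (sg j) Ot.
  apply: le_trans (ler_norm_sum _ _ _) _.
  apply: (@le_trans _ _ (\sum_(i < n) e * `|u - v|)).
    apply: ler_sum => i _; rewrite normrM mulrC; apply: ler_pM => //; last exact: ler_coord_norm.
    by have [_] := rP _ (seg _ t01); apply.
  rewrite sumr_const card_ord -[_ *+ n]mulr_natl mulrA.
  exact: ler_wpM2r.
(* A displacement below r / 2 of the centre, plus r / 2 from the contraction, keeps the fixed point
   map in the closed ball and puts its fixed point in the open one. *)
pose V := [set y : 'rV[R]_n | `|(y - F a) *m invmx B| < r / 2].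
have oV : open V.
  rewrite (_ : V = (fun y => `|y *m invmx B - F a *m invmx B|) @^-1` [set x | x < r / 2]); last first.
    by apply/seteqP; split=> y /=; rewrite /V /= mulmxBl.
  have cV : continuous (fun y : 'rV[R]_n => `|y *m invmx B - F a *m invmx B|).
    move=> y; have c1 : {for y, continuous (fun y : 'rV[R]_n => y *m invmx B - F a *m invmx B)}.
      have h := @mulmx_continuous n n (invmx B) y.
      have k : {for y, continuous (fun y : 'rV[R]_n => F a *m invmx B)} by exact: cst_continuous.
      by exact: cvgB h k.
    exact: cvg_norm c1.
  by apply: open_comp; [move=> y _; exact: cV|exact: open_lt].
have ball_in u : ball a r u <-> `|u - a| < r by rewrite -ball_normE /= distrC.
have surj y : V y -> exists2 u, `|u - a| < r & F u = y.
  move=> Vy; pose T u := y *m invmx B + g u.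
  have TL u v : `|u - a| <= r -> `|v - a| <= r -> `|T u - T v| <= 2^-1 * `|u - v|.
    move=> ua va; rewrite (_ : T u - T v = g u - g v); first exact: gL.
    by apply/rowP => i; rewrite !mxE; ring.
  have aa : `|a - a| <= r by rewrite subrr normr0 ltW.
  have Ta : `|T a - a| < r / 2.
    by rewrite (_ : T a - a = (y - F a) *m invmx B)// mulmxBl /T /g addrAC addrCA addrC -!addrA; apply/rowP => i; rewrite !mxE; ring.
  have Tr u : `|u - a| <= r -> `|T u - a| < r / 2 + 2^-1 * `|u - a|.
    move=> ua; rewrite -(subrK (T a) (T u)) -addrA; apply: le_lt_trans (ler_normD _ _) _.
    by rewrite [ltLHS]addrC; apply: ltr_leD => //; exact: TL.
  have [|u ua Tu] := contraction_fixed_point (ltW r0) _ TL.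
    move=> u ua; apply: ltW; apply: lt_le_trans (Tr u ua) _.
    have : 2^-1 * `|u - a| <= 2^-1 * r by rewrite ler_pM2l// invr_gt0.
    lra.
  exists u.
    by have := Tr u ua; rewrite Tu; lra.
  have : (y - F u) *m invmx B = 0.
    rewrite (_ : _ *m _ = T u - u); first by rewrite Tu subrr.
    by rewrite mulmxBl /T /g; apply/rowP => i; rewrite !mxE; ring.
  move=> /(congr1 (mulmx^~ B)); rewrite mulmxKV// mul0mx => /eqP.
  by rewrite subr_eq0 => /eqP.
have inj u v : `|u - a| <= r -> `|v - a| <= r ->
    `|u - v| <= 2 * `|(F u - F v) *m invmx B|.
  move=> ua va; have := gL u v ua va.
  have : `|u - v| <= `|g u - g v| + `|(F u - F v) *m invmx B|.
    rewrite -[u - v](subrK ((F u - F v) *m invmx B)).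
    apply: le_trans (ler_normD _ _) _; rewrite lerD2r mulmxBl.
    by rewrite (_ : u - v - _ = g u - g v)//; apply/rowP => i; rewrite !mxE; ring.
  lra.
have ex y : exists u, V y -> `|u - a| < r /\ F u = y.
  have [Vy|nV] := pselect (V y); last by exists a.
  by have [u ua Fu] := surj y Vy; exists u.
have [G HG] := choice ex.
pose U := [set u | `|u - a| < r /\ V (F u)].
have UO u : U u -> Q u by move=> [/ltW /rP[[]]].
have oU : open U.
  rewrite openE => u Uu; have [ua VFu] := Uu; apply: filterI.
    have : nbhs u (ball a r) by apply: open_nbhs_nbhs; split; [exact: ball_open|exact/ball_in].
    by apply: filterS => v /ball_in.
  apply: (differentiable_continuous (dFu u (UO u Uu))).
  by apply: open_nbhs_nbhs; split.
have FG y : V y -> F (G y) = y by move=> /HG[].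
have UG y : V y -> U (G y) by move=> Vy; split; [case: (HG y Vy)|rewrite FG].
have GF u : U u -> G (F u) = u.
  move=> [ua VFu]; have [ga gE] := HG _ VFu.
  apply/eqP; rewrite -subr_eq0 -normr_le0.
  by apply: le_trans (inj _ _ (ltW ga) (ltW ua)) _; rewrite gE subrr mul0mx normr0 mulr0.
have [K K0 KP] := ler_norm_mulmx (invmx B).
have GL y z : V y -> V z -> `|G y - G z| <= 2 * K * `|y - z|.
  move=> Vy Vz; apply: le_trans (inj _ _ (ltW (HG y Vy).1) (ltW (HG z Vz).1)) _.
  by rewrite !FG// -mulrA ler_pM2l.
(* A row v killed by the Jacobian satisfies v = v (1 - jac F u B^-1), whose norm is at most |v| /
   2. *)
have uJ u : U u -> jac F u \in unitmx.
  move=> Uu; have [ua _] := Uu.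
  have key (v : 'rV[R]_n) : v *m jac F u = 0 -> v = 0.
    move=> vJ; apply/eqP; rewrite -normr_le0.
    suff : `|v| <= 2^-1 * `|v| by lra.
    apply: ler_norm_row; first by rewrite mulr_ge0// invr_ge0.
    move=> j; have -> : v 0 j = \sum_i v 0 i * partial i (fun u => g u 0 j) u.
      rewrite -{1}[v]mulmx1 -[1%:M](subrK (jac F u *m invmx B)) mulmxDr mulmxA vJ mul0mx addr0 mxE.
      by apply: eq_bigr => i _; rewrite dpg//; exact: UO.
    apply: le_trans (ler_norm_sum _ _ _) _.
    apply: (@le_trans _ _ (\sum_(i < n) e * `|v|)).
      apply: ler_sum => i _; rewrite normrM mulrC; apply: ler_pM => //; last exact: ler_coord_norm.
      by have [_] := rP _ (ltW ua); apply.
    by rewrite sumr_const card_ord -[_ *+ n]mulr_natl mulrA ler_wpM2r.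
  rewrite -row_free_unit -kermx_eq0; apply/eqP/row_matrixP => i; rewrite row0.
  by apply: key; rewrite -row_mul mulmx_ker row0.
have dG y i : V y -> differentiable (fun y => G y 0 i) y /\
    forall j, partial j (fun y => G y 0 i) y = invmx (jac F (G y)) j i.
  move=> Vy; apply: differentiable_eps => e' e'0.
  have Uy := UG y Vy.
  pose J := jac F (G y).
  have [K2 K20 K2P] := ler_norm_mulmx (invmx J).
  pose c := K2 * (2 * K) + 1.
  have c0 : 0 < c by rewrite ltr_wpDl// mulr_ge0// mulr_ge0.
  have e10 : 0 < e' / c by rewrite divr_gt0.
  have nV : \forall z \near y, V z by apply: open_nbhs_nbhs; split.
  have lF := near_sub (G y) (linear_approx (dFu _ (UO _ Uy)) e10).
  have cG : {for y, continuous G}.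
    apply: (@lipschitz_at_continuous _ _ G y (2 * K)); first by rewrite mulr_ge0.
    by apply: filterS nV => z Vz; exact: GL.
  suff : \forall z \near y, `|G z 0 i - G y 0 i - \sum_j (z - y) 0 j * invmx J j i| <= e' * `|z - y|.
    by move=> /near_add; apply: filterS => h; rewrite addrK.
  apply: filterS2 nV (cG _ lF) => z Vz /=; rewrite subrK => H.
  have -> : G z 0 i - G y 0 i - \sum_j (z - y) 0 j * invmx J j i
      = (- ((F (G z) - F (G y) - 'd F (G y) (G z - G y)) *m invmx J)) 0 i.
    have -> : 'd F (G y) (G z - G y) = (G z - G y) *m J.
      apply/rowP => k; rewrite diff_row ?mxE; last exact: dFu (UO _ Uy).
      by apply: eq_bigr => l _; rewrite !mxE.
    rewrite mulmxBl mulmxK; last exact: uJ.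
    by rewrite !FG// opprB !rowB mxE.
  apply: le_trans (ler_coord_norm _ _) _; rewrite normrN.
  apply: le_trans (K2P _) _; apply: le_trans (ler_wpM2l K20 H) _.
  apply: (@le_trans _ _ (K2 * (e' / c * (2 * K * `|z - y|)))).
    by apply: ler_wpM2l => //; apply: ler_wpM2l; [exact: ltW|exact: GL].
  rewrite [leRHS](_ : _ = c * (e' / c * `|z - y|)); last by rewrite mulrA [c * _]mulrC (divfK (lt0r_neq0 c0)).
  rewrite [leLHS](_ : _ = K2 * (2 * K) * (e' / c * `|z - y|)); last by ring.
  by apply: ler_wpM2r; [rewrite mulr_ge0// ltW|rewrite lerDl].
have sG i : smooth_on V (fun y => G y 0 i).
  (* The Jacobian of G is the inverse matrix evaluated at G y, so a partial derivative of h composed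
     with G is again a smooth function of G y. *)
  pose P f := exists2 h, smooth_on U h & f = fun y => h (G y).
  have dGy y : V y -> differentiable G y.
    by move=> Vy; apply: differentiable_row => k; case: (dG y k Vy).
  apply: (@smooth_on_coind _ _ _ P) => //.
  - move=> _ [h sh ->] y Vy; apply: (@differentiable_comp _ _ _ _ G h); first exact: dGy.
    by apply: smooth_on_differentiable sh _; exact: UG.
  - move=> _ [h sh ->] j.
    exists (fun y => \sum_l partial l h (G y) * invmx (jac F (G y)) j l).
      exists (fun u => \sum_l partial l h u * invmx (jac F u) j l) => //.
      apply: smooth_on_sum => // l; apply: smooth_onM => //; first exact: smooth_on_partial.
      apply: smooth_on_invmx => // p q.
      apply: (@eq_smooth_on _ _ _ (partial p (fun u => F u 0 q))) => //.
        by move=> u _; rewrite mxE.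
      by apply: smooth_on_partial; apply: smooth_on_sub (sFO q).
    move=> y Vy; rewrite (partial_comp (F := G) (h := h)); [|exact: dGy|].
      by apply: eq_bigr => l _; have [_ ->] := dG y l Vy.
    by apply: smooth_on_differentiable sh _; exact: UG.
  - by exists (fun u : 'rV[R]_n => u 0 i) => //; exact: smooth_on_coord.
exists U, V, G; split=> //.
- by split; [rewrite subrr normr0|rewrite /V /= subrr mul0mx normr0 divr_gt0].
- by move=> u [/ltW /rP[[]]].
- split=> //; first by move=> u Uu; split; [case: Uu|exact: GF].
    by move=> y Vy; split; [exact: UG|exact: FG].
  by move=> i; apply: smooth_on_sub (sFO i).
Qed.

End InverseFunction.

(** * Flow boxes *)

Section Straightening.
Context {R : realType}.

Lemma bounded_near_partials m n (F : 'rV[R]_m -> 'rV[R]_n) x : smooth_map_at F x ->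
  exists2 L, 0 <= L & \forall y \near x, forall i j, `|partial i (fun y => F y 0 j) y| <= L.
Proof.
move=> sF; pose c (ij : 'I_m * 'I_n) := partial ij.1 (fun y => F y 0 ij.2).
exists (\sum_ij (`|c ij x| + 1)).
  by apply: sumr_ge0 => ij _; rewrite addr_ge0.
have nP : \forall y \near x, forall ij, `|c ij y| <= `|c ij x| + 1.
  apply: (@filter_forall _ _ _ (nbhs x)) => ij.
  have cc : {for x, continuous (c ij)}.
    by apply: differentiable_continuous; apply: smooth_at_differentiable; exact: smooth_at_partial.
  apply: filterS ((cvgrPdist_le _ _).1 cc 1 ltr01) => y H.
  rewrite -(subrK (c ij x) (c ij y)) addrC [leRHS]addrC.
  by apply: le_trans (ler_normD _ _) _; rewrite addrC; apply: lerD => //; rewrite distrC.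
apply: filterS nP => y H i j; apply: le_trans (H (i, j)) _.
rewrite [leRHS](bigD1 (i, j))//= lerDl; apply: sumr_ge0 => ij _.
by rewrite addr_ge0.
Qed.

(** The other rows of B will span the hyperplane from which the flow starts, transversal to v. *)
Lemma exists_frame n (v : 'rV[R]_n) (t : 'I_n) : v != 0 ->
  exists2 B : 'M[R]_n, B \in unitmx & forall j, B t j = v 0 j.
Proof.
move=> v0.
have dg : (delta_mx 0 t : 'rV[R]_n) *m (\matrix_(i, j) v 0 j) = v.
  by rewrite -rowE; apply/rowP => j; rewrite !mxE.
have [|B uB BE] := @complete_unitmx _ _ _ (delta_mx 0 t : 'rV[R]_n) (\matrix_(i, j) v 0 j).
  by rewrite dg rank_rV v0 mxrank_delta.
by exists B => // j; rewrite -dg BE -rowE mxE.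
Qed.

Lemma lipschitz_continuous (V W : normedModType R) (G : V -> W) K : 0 <= K ->
  (forall y z, `|G y - G z| <= K * `|y - z|) -> continuous G.
Proof. by move=> K0 GK y; apply: (lipschitz_at_continuous K0); exact: nearW. Qed.

Section Local.
Context {k : nat}.
Local Notation n := k.+1.
Variables (v : 'rV[R]_n -> 'rV[R]_n) (x0 : 'rV[R]_n).
Local Notation tau := (@ord_max k).

Definition set_time (u : 'rV[R]_n) (s : R) : 'rV[R]_n :=
  \row_i if i == tau then s else u 0 i.

(** The Jacobian of Phi at 0 is B: its row tau is v x0 by the differential equation, the others come
    from the affine parametrization of the initial hyperplane. *)
Lemma straightening_map : smooth_map_at v x0 -> v x0 != 0 ->
  exists (Om : set 'rV[R]_n) (Phi : 'rV[R]_n -> 'rV[R]_n),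
    [/\ open Om, Om 0, Phi 0 = x0, jac Phi 0 \in unitmx &
      (forall i, smooth_on Om (fun u : 'rV[R]_n => Phi u 0 i)) /\
      forall u, Om u -> forall i, partial tau (fun u : 'rV[R]_n => Phi u 0 i) u = v (Phi u) 0 i].
Proof.
move=> sv vx0.
have [B uB Bv] := exists_frame tau vx0.
have [Q [oQ Qx0 sQ]] := smooth_map_at_smooth_on sv.
have [L L0 LP] := bounded_near_partials sv.
have nP : \forall y \near x0, Q y /\ forall i j, `|partial i (fun y => v y 0 j) y| <= L.
  by exact: filterI (open_nbhs_nbhs (conj oQ Qx0)) LP.
have [r2 /= r20 r2P] := (nbhs_ballP _ _).1 nP.
pose r := r2 / 2.
have r0 : 0 < r by rewrite divr_gt0.
have rP y : `|y - x0| <= r -> Q y /\ forall i j, `|partial i (fun y => v y 0 j) y| <= L.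
  move=> yx; apply: r2P; rewrite -ball_normE /= distrC (le_lt_trans yx)// /r.
  by rewrite ltr_pdivrMr// ltr_pMr// ltr1n.
pose L' := n%:R * L.
have L'0 : 0 <= L' by rewrite mulr_ge0.
have vL y z : `|y - x0| <= r -> `|z - x0| <= r -> `|v y - v z| <= L' * `|y - z|.
  move=> yx zx; apply: ler_norm_row; first by rewrite mulr_ge0.
  move=> j; have seg (t : R) : 0 <= t <= 1 -> `|z + t *: (y - z) - x0| <= r.
    move=> /andP[t0 t1]; rewrite (_ : _ - x0 = t *: (y - x0) + (1 - t) *: (z - x0)); last first.
      by apply/rowP => i; rewrite !mxE; ring.
    apply: le_trans (ler_normD _ _) _; rewrite !normrZ (ger0_norm t0) ger0_norm ?subr_ge0//.
    rewrite [leRHS](_ : r = t * r + (1 - t) * r); last by ring.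
    by apply: lerD; apply: ler_wpM2l; rewrite ?subr_ge0.
  rewrite rowB; have [|t t01 ->] := @mean_value R n (fun w => v w 0 j) z y.
    by move=> t /seg /rP[Qt _]; exact: smooth_on_differentiable (sQ j) Qt.
  apply: le_trans (ler_norm_sum _ _ _) _.
  apply: (@le_trans _ _ (\sum_(i < n) L * `|y - z|)).
    apply: ler_sum => i _; rewrite normrM mulrC; apply: ler_pM => //; last exact: ler_coord_norm.
    by have [_] := rP _ (seg _ t01); apply.
  by rewrite sumr_const card_ord -[_ *+ n]mulr_natl mulrA.
(* The cut-off w of v is globally Lipschitz, so that solutions exist on [0, 1]. *)
pose rho (y : 'rV[R]_n) : 'rV[R]_n := \row_i clamp (x0 0 i - r) (x0 0 i + r) (y 0 i).
have bds i : x0 0 i - r <= x0 0 i + r by rewrite lerD2l ge0_cp// ltW.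
have rhox y : `|rho y - x0| <= r.
  apply: ler_norm_row; first exact: ltW.
  move=> i; rewrite rowB mxE ler_distl.
  exact: clamp_in.
have rhoL y z : `|rho y - rho z| <= `|y - z|.
  apply: ler_norm_row => // i; rewrite rowB !mxE; apply: le_trans (clamp_lipschitz _ _ (bds i)) _.
  by rewrite -rowB ler_coord_norm.
have rho_id y : `|y - x0| <= r -> rho y = y.
  move=> yx; apply/rowP => i; rewrite mxE clamp_id//.
  have := le_trans (ler_coord_norm (y - x0) i) yx; rewrite rowB ler_distl.
  by [].
pose w y := v (rho y).
have wL y z : `|w y - w z| <= L' * `|y - z|.
  by apply: le_trans (vL _ _ (rhox y) (rhox z)) _; rewrite ler_wpM2l.
pose M := `|v x0| + L' * r.
have M0 : 0 <= M by rewrite addr_ge0// mulr_ge0// ltW.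
have wM y : `|w y| <= M.
  have rx0 : rho x0 = x0 by rewrite rho_id// subrr normr0 ltW.
  have h : `|w y - v x0| <= L' * r.
    rewrite -[x0 in v x0]rx0; apply: le_trans (vL _ _ (rhox y) (rhox x0)) _.
    by rewrite rx0; apply: ler_wpM2l.
  rewrite -(subrK (v x0) (w y)); apply: le_trans (ler_normD _ _) _.
  by rewrite [leLHS]addrC lerD2l.
have wc : continuous w.
  by apply: (@lipschitz_continuous _ _ w L').
(* Phi u is reached in time u_n from a point of the hyperplane u_n = 0; time is
   rescaled to [0, 1], which multiplies the field by the parameter u_n. *)
pose init u := x0 + set_time u 0 *m B.
have ex u : exists y : R -> 'rV[R]_n, y 0 = init u /\
    forall (t : R) i, 0 <= t <= 1 -> is_derive t 1 (fun s => y s 0 i) (u 0 tau * w (y t) 0 i).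
  have [|||y y0 yD] := @picard R n (fun t y => u 0 tau *: w y) (`|u 0 tau| * L') (init u).
  - by rewrite mulr_ge0.
  - move=> t y z i _; rewrite -scalerBr; apply: le_trans (ler_coord_norm _ _) _.
    by rewrite normrZ -mulrA ler_wpM2l.
  - move=> y cy i t; rewrite (_ : (fun t => _) = fun t => u 0 tau * w (y t) 0 i); last first.
      by apply/funext => s; rewrite mxE.
    apply: cvgM; first exact: cvg_cst.
    apply: (@continuous_comp _ _ _ (fun t => w (y t)) (fun z : 'rV[R]_n => z 0 i)).
      by apply: (@continuous_comp _ _ _ y w); [exact: cy|exact: wc].
    exact: coord_continuous.
  exists y; split=> // t i t01; have := yD t i t01; by rewrite mxE.
have [Y HY] := choice ex.
(* Uniqueness serves the scaling law [scale] below: following u_n w up to time th is the same as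
   following th u_n w up to time 1. *)
have uniq (a : R) (y z : R -> 'rV[R]_n) : y 0 = z 0 ->
    (forall (t : R) i, 0 <= t <= 1 -> is_derive t 1 (fun s => y s 0 i) (a * w (y t) 0 i)) ->
    (forall (t : R) i, 0 <= t <= 1 -> is_derive t 1 (fun s => z s 0 i) (a * w (z t) 0 i)) ->
    forall t : R, 0 <= t <= 1 -> y t = z t.
  move=> yz0 yD zD t t01.
  have aL : 0 <= `|a| * L' by rewrite mulr_ge0.
  have [C C0 CP] := @gronwall R n _ aL.
  apply/eqP; rewrite -subr_eq0 -normr_le0.
  have := CP (fun t => y t - z t) (fun t => a *: (w (y t) - w (z t))) 0 (lexx _) _ _ t t01.
  rewrite yz0 subrr normr0 addr0 mulr0; apply.
  - move=> s i s01; rewrite (_ : (fun s => _) = fun s => y s 0 i - z s 0 i); last first.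
      by apply/funext => b; rewrite rowB.
    by rewrite scalerBr rowB 2!mxE; apply: is_deriveB; [exact: yD|exact: zD].
  - move=> s i s01; rewrite addr0; apply: le_trans (ler_coord_norm _ _) _.
    by rewrite normrZ -mulrA ler_wpM2l.
have Yinit u (t : R) : 0 <= t <= 1 -> `|Y u t - init u| <= `|u 0 tau| * M.
  move=> t01; have [Y0 YD] := HY u; apply: ler_norm_row; first by rewrite mulr_ge0.
  move=> i; rewrite -Y0 rowB.
  have lin (s : R) : is_derive s 1 (fun s => (`|u 0 tau| * M) * s) (`|u 0 tau| * M).
    have D := is_deriveZ (`|u 0 tau| * M) (is_derive_id s (1 : R)).
    by apply: (is_derive_eq D); rewrite /GRing.scale /= mulr1.
  have := @derive_norm_le R (fun s => Y u s 0 i) _ _ _ t t01 (fun s s01 => YD s i s01) (fun s _ => lin s).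
  rewrite mulr0 subr0 => H; apply: le_trans (H _) _.
    move=> s _; rewrite normrM ler_wpM2l//.
    by apply: le_trans (ler_coord_norm _ _) _.
  case/andP: t01 => t0 t1; rewrite -[leRHS]mulr1 ler_wpM2l// mulr_ge0//.
have [K K0 KP] := ler_norm_mulmx B.
have set_timeB u u' : `|set_time u 0 - set_time u' 0| <= `|u - u'|.
  apply: ler_norm_row => // i; rewrite rowB !mxE; case: eqP => _; first by rewrite subrr normr0.
  by rewrite -rowB ler_coord_norm.
have set_time0 : set_time 0 0 = 0 by apply/rowP => i; rewrite !mxE; case: eqP.
have initB u u' : `|init u - init u'| <= K * `|u - u'|.
  rewrite /init (_ : _ - _ = (set_time u 0 - set_time u' 0) *m B).
    by apply: le_trans (KP _) _; rewrite ler_wpM2l.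
  by rewrite mulmxBl; apply/rowP => i; rewrite !mxE; ring.
have init0 : init 0 = x0 by rewrite /init set_time0 mul0mx addr0.
(* For |u| < d the initial point is within K d of x0 and the orbit moves by at most M d, so it stays
   in the ball where w = v. The bound d <= 1 controls the factor u_n in the Gronwall estimate. *)
pose d := Num.min 1 (r / (M + K + 1)).
have MK : 0 < M + K + 1 by rewrite ltr_wpDl// addr_ge0.
have d0 : 0 < d by rewrite lt_min ltr01 divr_gt0.
have d1 : d <= 1 by rewrite ge_min lexx.
have dr : d * (M + K) < r.
  apply: (@le_lt_trans _ _ (r / (M + K + 1) * (M + K))).
    by apply: ler_wpM2r; [exact: addr_ge0|rewrite ge_min lexx orbT].
  by rewrite mulrAC ltr_pdivrMr// ltr_pM2l// ltrDl.
pose Om := [set u : 'rV[R]_n | `|u| < d].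
have oO : open Om.
  rewrite (_ : Om = ball 0 d); first exact: ball_open.
  by apply/seteqP; split=> u; rewrite -ball_normE /= sub0r normrN.
have Yx u (t : R) : Om u -> 0 <= t <= 1 -> `|Y u t - x0| < r.
  move=> Ou t01; rewrite -(subrK (init u) (Y u t)) -addrA.
  apply: le_lt_trans (ler_normD _ _) _; apply: le_lt_trans dr.
  rewrite mulrDr; apply: lerD.
    apply: le_trans (Yinit u t t01) _; apply: ler_wpM2r => //.
    by apply: le_trans (ltW Ou); exact: ler_coord_norm.
  rewrite -init0; apply: le_trans (initB _ _) _; rewrite subr0 mulrC.
  by apply: ler_wpM2r => //; exact: ltW.
have wY u (t : R) : Om u -> 0 <= t <= 1 -> w (Y u t) = v (Y u t).
  by move=> Ou t01; rewrite /w rho_id// ltW// Yx.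
pose V0 := [set y : 'rV[R]_n | `|y - x0| < r].
have oV0 : open V0.
  rewrite (_ : V0 = ball x0 r); first exact: ball_open.
  by apply/seteqP; split=> u; rewrite -ball_normE /= distrC.
have sV0 i : smooth_on V0 (fun y => v y 0 i).
  by apply: smooth_on_sub (sQ i) => y /ltW /rP[].
pose V := [set z : 'rV[R]_(n + 1) | V0 (lsubmx z)].
have oV : open V by apply: open_comp => // z _; exact: lsubmx_continuous.
(* The parameter u_n is made a constant component of the state. *)
pose f (z : 'rV[R]_(n + 1)) : 'rV[R]_(n + 1) := row_mx (z 0 (rshift n 0) *: v (lsubmx z)) 0.
pose Z t u : 'rV[R]_(n + 1) := row_mx (Y u t) (const_mx (u 0 tau)).
have ZE t u : Z t u 0 (rshift n 0) = u 0 tau by rewrite row_mxEr mxE.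
have HZ : flow_family V f Om Z.
  split=> //.
  - move=> i; have [j ->|j ->] := split_ordP i.
      apply: (@eq_smooth_on _ _ _ (fun z : 'rV[R]_(n + 1) => z 0 (rshift n 0) * v (lsubmx z) 0 j)) => //.
        by move=> z _; rewrite /f row_mxEl mxE.
      apply: smooth_onM => //; first exact: smooth_on_coord.
      exact: (@smooth_on_lsubmx _ n 1 V0 (fun y => v y 0 j) oV0 (sV0 j)).
    apply: (@eq_smooth_on _ _ _ (fun=> 0)) => //; last exact: smooth_on_cst.
    by move=> z _; rewrite /f row_mxEr mxE.
  - by move=> t u t01 Ou; rewrite /V /= row_mxKl; exact: Yx.
  - move=> t u i t01 Ou; have [j ->|j ->] := split_ordP i.
      rewrite (_ : (fun s => _) = fun s => Y u s 0 j); last by apply/funext => s; rewrite row_mxEl.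
      rewrite /f row_mxEl mxE ZE row_mxKl -wY//; by have [_] := HY u; apply.
    rewrite (_ : (fun s => _) = cst (u 0 tau)); last by apply/funext => s; rewrite row_mxEr mxE.
    by rewrite /f row_mxEr mxE; exact: is_derive_cst.
  - move=> i; have [j ->|j ->] := split_ordP i.
      apply: (@eq_smooth_on _ _ _ (fun u => x0 0 j + (set_time u 0 *m B) 0 j)) => //.
        by move=> u _; rewrite row_mxEl; have [-> _] := HY u; rewrite /init [RHS]mxE.
      apply: smooth_onD => //; first exact: smooth_on_cst.
      apply: smooth_on_mulmx => // l.
      have [lt|lt] := eqVneq l tau.
        apply: (@eq_smooth_on _ _ _ (fun=> 0)) => //; last exact: smooth_on_cst.
        by move=> u _; rewrite mxE lt eqxx.
      apply: (@eq_smooth_on _ _ _ (fun u : 'rV[R]_n => u 0 l)) => //; last exact: smooth_on_coord.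
      by move=> u _; rewrite mxE (negPf lt).
    apply: (@eq_smooth_on _ _ _ (fun u : 'rV[R]_n => u 0 tau)) => //; last exact: smooth_on_coord.
    by move=> u _; rewrite row_mxEr mxE.
  - move=> u e Ou e0.
    have [C C0 CP] := @gronwall R n _ L'0.
    have c0 : 0 < C * (K + M) + 1 + 1 by rewrite ltr_wpDl// addr_ge0// mulr_ge0// addr_ge0.
    have e10 : 0 < e / (C * (K + M) + 1 + 1) by rewrite divr_gt0.
    have nO : \forall u' \near u, Om u' by apply: open_nbhs_nbhs; split.
    apply: filterS2 nO ((cvgrPdist_lt _ _).1 (@cvg_id _ (nbhs u)) _ e10) => u' Ou' + t t01.
    rewrite distrC => uu'.
    have H1 : `|Y u' t - Y u t| <= C * (K + M) * `|u' - u|.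
      have b0 : 0 <= `|u' - u| * M by rewrite mulr_ge0.
      have := CP (fun t => Y u' t - Y u t)
        (fun t => u' 0 tau *: w (Y u' t) - u 0 tau *: w (Y u t)) _ b0 _ _ t t01.
      have -> : Y u' 0 = init u' by case: (HY u').
      have -> : Y u 0 = init u by case: (HY u).
      move=> H; apply: le_trans (H _ _) _.
      + move=> s i s01; rewrite (_ : (fun s => _) = fun s => Y u' s 0 i - Y u s 0 i); last first.
          by apply/funext => b; rewrite rowB.
        rewrite rowB 2!mxE; apply: is_deriveB; [have [_] := HY u'|have [_] := HY u]; exact.
      + move=> s i s01; apply: le_trans (ler_coord_norm _ _) _.
        rewrite (_ : _ - _ = u' 0 tau *: (w (Y u' s) - w (Y u s)) + (u' - u) 0 tau *: w (Y u s)); last first.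
          by rewrite rowB; apply/rowP => l; rewrite !mxE; ring.
        apply: le_trans (ler_normD _ _) _; rewrite !normrZ; apply: lerD.
          apply: (@le_trans _ _ (1 * (L' * `|Y u' s - Y u s|))); last by rewrite mul1r.
          apply: ler_pM => //; apply: le_trans (ler_coord_norm _ _) _.
          exact: le_trans (ltW Ou') d1.
        by apply: ler_pM => //; exact: ler_coord_norm.
      + rewrite -mulrA; apply: ler_wpM2l => //; rewrite mulrDl [M * _]mulrC lerD2r.
        exact: initB.
    have H2 : C * (K + M) * `|u' - u| < e.
      apply: (@le_lt_trans _ _ ((C * (K + M) + 1) * `|u' - u|)).
        by rewrite ler_wpM2r// lerDl.
      rewrite -(divfK (lt0r_neq0 c0) e) mulrC; apply: ltr_pM => //; first by rewrite addr_ge0// mulr_ge0// addr_ge0.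
      by rewrite ltrDl.
    have H3 : `|u' - u| < e.
      apply: lt_le_trans uu' _; rewrite ler_pdivrMr// -[leLHS]mulr1.
      apply: ler_wpM2l; first exact: ltW.
      by rewrite lerDr addr_ge0// mulr_ge0// addr_ge0.
    rewrite /Z opp_row_mx add_row_mx; apply: ltr_norm_row => // i.
    have [j ->|j ->] := split_ordP i; rewrite ?row_mxEl ?row_mxEr.
      by apply: le_lt_trans (ler_coord_norm _ _) _; exact: le_lt_trans H1 H2.
    by rewrite !mxE -rowB; apply: le_lt_trans (ler_coord_norm _ _) H3.
pose Phi (u : 'rV[R]_n) : 'rV[R]_n := Y u 1.
have l11 : 0 <= (1 : R) <= 1 by rewrite ler01 lexx.
have sPhi i : smooth_on Om (fun u : 'rV[R]_n => Phi u 0 i).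
  have := flow_smooth (lshift 1 i) oO HZ; apply: eq_smooth_on => // u _.
  by rewrite row_mxEl.
have Phi0 (u : 'rV[R]_n) : u 0 tau = 0 -> Phi u = init u.
  move=> u0; apply/eqP; rewrite -subr_eq0 -normr_le0.
  by apply: le_trans (Yinit u 1 l11) _; rewrite u0 normr0 mul0r.
have scale (u : 'rV[R]_n) (th : R) : 0 <= th <= 1 -> Phi (set_time u (th * u 0 tau)) = Y u th.
  move=> th01; set u' := set_time u _.
  have u't : u' 0 tau = th * u 0 tau by rewrite mxE eqxx.
  have := @uniq (u' 0 tau) (Y u') (fun t => Y u (th * t)) _ _ _ 1 l11.
  rewrite mulr1; apply.
  - rewrite mulr0; have [-> _] := HY u'; have [-> _] := HY u.
    by rewrite /init; congr (_ + _ *m _); apply/rowP => i; rewrite !mxE; case: eqP.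
  - by have [] := HY u'.
  - move=> t i /andP[t0 t1]; case/andP: th01 => th0 th1.
    have D : is_derive (th * t) 1 (fun s => Y u s 0 i) (u 0 tau * w (Y u (th * t)) 0 i).
      have [_] := HY u; apply; rewrite mulr_ge0//=.
      by rewrite -[leRHS]mulr1 ler_pM.
    by apply: (is_derive_eq (is_derive_scale D)); rewrite u't mulrA.
(* Where u_n <> 0 the rescaling can be undone; u_n = 0 follows by continuity. *)
have dPhi_neq (u : 'rV[R]_n) i : Om u -> u 0 tau != 0 -> partial tau (fun u : 'rV[R]_n => Phi u 0 i) u = v (Phi u) 0 i.
  move=> Ou ut.
  have line c (s : R) : set_time u c + s *: delta_mx 0 tau = set_time u (c + s).
    apply/rowP => j; rewrite !mxE eqxx /=; have [_|jt] := eqVneq j tau; first by rewrite mulr1.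
    by rewrite mulr0 addr0.
  have uE : set_time u (u 0 tau) = u by apply/rowP => j; rewrite mxE; have [->|] := eqVneq j tau.
  have Oline : \forall s \near (0 : R), Om (u + s *: delta_mx 0 tau).
    have c : {for (0 : R), continuous (fun s : R => u + s *: (delta_mx 0 tau : 'rV[R]_n))}.
      have [dl _] : is_diff (0 : R) (fun s : R => u + s *: (delta_mx 0 tau : 'rV[R]_n)) (fun s : R => 0 + s *: delta_mx 0 tau).
        exact: is_diffD.
      exact: differentiable_continuous dl.
    have : nbhs (u + 0 *: (delta_mx 0 tau : 'rV[R]_n)) Om.
      by apply: open_nbhs_nbhs; rewrite scale0r addr0.
    exact: c.
  have [eps /= eps0 epsP] := (nbhs_ballP _ _).1 Oline.
  have nu0 : 0 < `|u 0 tau| by rewrite normr_gt0.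
  pose eta := eps / 2 / `|u 0 tau|.
  have eta0 : 0 < eta by rewrite !divr_gt0.
  (* The scaling law covers times in [0, 1] only. Running a little further, to S = (1 + eta) u_n,
     makes Phi u the value at the interior time th = 1 / (1 + eta), where two-sided derivatives can
     be compared. *)
  pose S := u 0 tau + eta * u 0 tau.
  have OU : Om (set_time u S).
    rewrite -line uE; apply: epsP; rewrite -ball_normE /= sub0r normrN normrM gtr0_norm//.
    by rewrite /eta divfK ?gt_eqF// ltr_pdivrMr// ltr_pMr// ltr1n.
  set U := set_time u S in OU.
  have UtS : U 0 tau = S by rewrite mxE eqxx.
  have UU s : set_time U s = set_time u s by apply/rowP => j; rewrite !mxE; case: eqP.
  pose th := (1 + eta)^-1.
  have th0 : 0 < th by rewrite invr_gt0 addr_gt0.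
  have th1 : th < 1 by rewrite invf_lt1 ?ltrDl// addr_gt0.
  have thS : th * S = u 0 tau.
    by rewrite /S -[X in X + _]mul1r -mulrDl mulKf// gt_eqF// addr_gt0.
  have S0 : S != 0 by apply: contra_neq ut => S0; rewrite -thS S0 mulr0.
  have th01 : 0 <= th <= 1 by rewrite !ltW.
  have YUth : Y U th = Phi u by rewrite -scale// UtS thS UU uE.
  have D1 : is_derive th 1 (fun s => Y U s 0 i) (S * v (Phi u) 0 i).
    by rewrite -UtS -YUth -wY//; have [_] := HY U; apply.
  pose p := fun s : R => Phi (set_time u 0 + s *: (S *: delta_mx 0 tau)) 0 i.
  have cE (s : R) : set_time u 0 + s *: (S *: delta_mx 0 tau) = set_time u (s * S).
    by rewrite scalerA line add0r.
  have du : differentiable (fun u : 'rV[R]_n => Phi u 0 i) u by exact: smooth_on_differentiable (sPhi i) Ou.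
  have D2 : is_derive th 1 p ('D_(S *: delta_mx 0 tau) (fun u : 'rV[R]_n => Phi u 0 i) u).
    have := @is_derive_line R n (fun u : 'rV[R]_n => Phi u 0 i) (set_time u 0) (S *: delta_mx 0 tau) th.
    by rewrite cE thS uE; exact.
  have E : \near th, p th = Y U th 0 i.
    have := near_in_itvoo (_ : th \in `]0, 1[%R); rewrite in_itv /= th0 th1 => /(_ isT).
    apply: filterS => s; rewrite in_itv /= => /andP[s0 s1].
    by rewrite /p cE -scale ?UtS ?UU// !ltW.
  have [_ E1] := near_eq_is_derive E D2; have [_ E2] := D1.
  have : S * v (Phi u) 0 i = S * partial tau (fun u : 'rV[R]_n => Phi u 0 i) u.
    by rewrite -E2 E1 deriveE// linearZ /= /partial -deriveE.
  by move=> /(mulfI S0).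
have smv i (u : 'rV[R]_n) : Om u -> {for u, continuous (fun u : 'rV[R]_n => v (Phi u) 0 i)}.
  move=> Ou; apply: (@continuous_comp _ _ _ Phi (fun y => v y 0 i)).
    apply: differentiable_continuous; apply: differentiable_row => j.
    exact: smooth_on_differentiable (sPhi j) Ou.
  apply: differentiable_continuous; apply: smooth_on_differentiable (sV0 i) _.
  exact: Yx.
have dPhi (u : 'rV[R]_n) i : Om u -> partial tau (fun u : 'rV[R]_n => Phi u 0 i) u = v (Phi u) 0 i.
  move=> Ou; have [ut|] := eqVneq (u 0 tau) 0; last exact: dPhi_neq.
  pose g (u : 'rV[R]_n) := partial tau (fun u : 'rV[R]_n => Phi u 0 i) u - v (Phi u) 0 i.
  have cg : {for u, continuous g}.
    have c1 : {for u, continuous (partial tau (fun u : 'rV[R]_n => Phi u 0 i))}.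
      apply: differentiable_continuous.
      exact: smooth_on_differentiable (smooth_on_partial tau (sPhi i)) Ou.
    exact: cvgB c1 (smv i u Ou).
  apply/eqP; rewrite -subr_eq0 -normr_le0; apply/ler_addgt0Pr => e e0; rewrite add0r.
  have nO : \forall u' \near u, Om u' by apply: open_nbhs_nbhs; split.
  have nP' : \forall u' \near u, Om u' /\ `|g u - g u'| <= e.
    by exact: filterI nO ((cvgrPdist_le _ _).1 cg e e0).
  have [eps /= eps0 epsP] := (nbhs_ballP _ _).1 nP'.
  have [|Ou' ge] := epsP (u + (eps / 2) *: delta_mx 0 tau).
    rewrite -ball_normE /= opprD addrA subrr add0r normrN normrZ gtr0_norm ?divr_gt0//.
    apply: (@le_lt_trans _ _ (eps / 2 * 1)); first by apply: ler_wpM2l; [rewrite ltW// divr_gt0|exact: norm_delta].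
    by rewrite mulr1 ltr_pdivrMr// ltr_pMr// ltr1n.
  have gu' : g (u + (eps / 2) *: delta_mx 0 tau) = 0.
    rewrite /g dPhi_neq ?subrr// !mxE !eqxx /= ut add0r mulr1 gt_eqF// divr_gt0//.
  by move: ge; rewrite gu' subr0.
exists Om, Phi; split=> //.
- by rewrite /Om /= normr0.
- by rewrite Phi0 ?mxE.
- have O0 : Om 0 by rewrite /Om /= normr0.
  have -> // : jac Phi 0 = B.
  apply/matrixP => j i; rewrite mxE; have [->|jt] := eqVneq j tau.
    by rewrite dPhi// Phi0 ?mxE// init0 Bv.
  have du : differentiable (fun u : 'rV[R]_n => Phi u 0 i) (0 + (0 : R) *: delta_mx 0 j).
    by rewrite scale0r addr0; exact: smooth_on_differentiable (sPhi i) O0.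
  have [_] := is_derive_line du; rewrite scale0r addr0 /partial => <-.
  have -> : (fun s : R => Phi (0 + s *: delta_mx 0 j) 0 i) = (fun s => x0 0 i + s * B j i).
    apply/funext => s; rewrite Phi0; last by rewrite !mxE (eq_sym tau) (negPf jt) andbF mulr0 addr0.
    rewrite /init (_ : set_time _ 0 = s *: delta_mx 0 j); first by rewrite -scalemxAl -rowE !mxE.
    apply/rowP => l; rewrite !mxE; have [->|//] := eqVneq l tau; last by rewrite add0r.
    by rewrite (eq_sym tau) (negPf jt) andbF mulr0.
  have [_] : is_derive (0 : R) 1 (fun s => x0 0 i + s * B j i) (0 + B j i).
    apply: is_deriveD; have D := is_deriveZ (B j i) (is_derive_id (0 : R) 1).
    rewrite (_ : (fun s => s * B j i) = B j i \*: id).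
      by apply: (is_derive_eq D); rewrite /GRing.scale /= mulr1.
    by apply/funext => s; rewrite /GRing.scale /= mulrC.
  by rewrite add0r.
- by split=> // u Ou i; exact: dPhi.
Qed.

(** The flow box is inverted near 0; W lets its image be kept inside the image of a chart. *)
Lemma straightening W : smooth_map_at v x0 -> v x0 != 0 -> nbhs x0 W ->
  exists (U V : set 'rV[R]_n) (Phi G : 'rV[R]_n -> 'rV[R]_n),
    [/\ open U, open V, V x0, V `<=` W &
    [/\ (forall u, U u -> V (Phi u) /\ G (Phi u) = u),
        (forall y, V y -> U (G y) /\ Phi (G y) = y),
        (forall i, smooth_on U (fun u : 'rV[R]_n => Phi u 0 i)),
        (forall i, smooth_on V (fun y => G y 0 i)) &
        forall u, U u -> forall i, partial tau (fun u : 'rV[R]_n => Phi u 0 i) u = v (Phi u) 0 i]].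
Proof.
move=> sv v0 nW.
have [Om [Phi [oO O0 Phi0 uJ [sPhi dPhi]]]] := straightening_map sv v0.
have sP0 : smooth_map_at Phi 0.
  by move=> i; apply/smooth_atP; exists Om.
have cPhi : {for (0 : 'rV[R]_n), continuous Phi}.
  by apply: differentiable_continuous; exact: smooth_map_at_differentiable.
have nOW : nbhs (0 : 'rV[R]_n) (Om `&` Phi @^-1` W).
  apply: filterI; first exact: open_nbhs_nbhs.
  by apply: cPhi; rewrite Phi0.
have [U [V [G [oU oV U0 UO [UV VU sU sV]]]]] := inverse_function sP0 uJ nOW.
exists U, V, Phi, G; split=> //.
- by rewrite -Phi0; case: (UV 0 U0).
- move=> y /VU[/UO [_ Wy] <-]; exact: Wy.
- by split=> // u /UO[Ou _] i; exact: dPhi.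
Qed.

End Local.
End Straightening.

(** * Charts and vector fields *)

Section Charts.
Context {R : realType} {M : topologicalType} {n : nat}.
Variable A : smooth_manifold R M n.
Implicit Types (c d : chart R M n) (p q : M).

Lemma smooth_map_at_comp (F G : 'rV[R]_n -> 'rV[R]_n) x :
  smooth_map_at F x -> smooth_map_at G (F x) -> smooth_map_at (G \o F) x.
Proof. by move=> sF sG i; apply: (smooth_at_comp sF (sG i)). Qed.

Lemma smooth_map_at_eq (F G : 'rV[R]_n -> 'rV[R]_n) x : (\near x, F x = G x) ->
  smooth_map_at F x -> smooth_map_at G x.
Proof. by move=> FG sF i; apply: smooth_at_eq (sF i); apply: filterS FG => y ->. Qed.

Lemma near_eq_diff (V W : normedModType R) (F G : V -> W) x v :
  (\near x, F x = G x) -> differentiable F x -> 'd F x v = 'd G x v.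
Proof.
move=> FG dF; rewrite -!deriveE//; first exact: near_eq_derive.
exact: near_eq_differentiable dF.
Qed.

Lemma diff_near_comp (U V W : normedModType R) (F : U -> V) (G : V -> W) (H : U -> W) x y u :
  F x = y -> differentiable F x -> differentiable G y ->
  (\near x, G (F x) = H x) -> 'd G y ('d F x u) = 'd H x u.
Proof.
move=> Fx dF dG N; rewrite -Fx in dG *.
have dGF : differentiable (G \o F) x by exact: differentiable_comp.
have E := @near_eq_diff _ _ (G \o F) H x u N dGF.
by rewrite -E (diff_comp dF dG).
Qed.

Lemma diff_compE (U V W : normedModType R) (F : U -> V) (G : V -> W) x y u :
  F x = y -> differentiable F x -> differentiable G y ->
  'd G y ('d F x u) = 'd (G \o F) x u.
Proof. by move=> Fx dF dG; apply: diff_near_comp => //; exact: nearW. Qed.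

Lemma near_cinv c p (P : M -> Prop) : is_chart c -> cdom c p ->
  (\forall q \near p, P q) -> \forall y \near c p, P (cinv c y).
Proof.
move=> hc cp nP; have := @cinv_continuous _ _ _ c hc (c p); apply; first by exists p.
by rewrite cmapK.
Qed.

Lemma near_cmap c p (P : 'rV[R]_n -> Prop) : is_chart c -> cdom c p ->
  (\forall y \near c p, P y) -> \forall q \near p, P (c q).
Proof. by move=> hc cp nP; exact: (cmap_continuous hc cp). Qed.

Lemma near_cdom c p : is_chart c -> cdom c p -> \forall q \near p, cdom c q.
Proof. by move=> hc cp; apply: open_nbhs_nbhs; split=> //; exact: cdom_open. Qed.

Lemma near_cinvK c p : is_chart c -> cdom c p ->
  \forall y \near c p, cdom c (cinv c y) /\ c (cinv c y) = y.
Proof.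
move=> hc cp.
have : nbhs (c p) (c @` cdom c).
  by apply: open_nbhs_nbhs; split; [exact: cimage_open|exists p].
by apply: filterS => _ [q cq <-]; rewrite cmapK.
Qed.

Lemma atlas_max c : atlas A c -> max_atlas A c.
Proof.
move=> Ac; split; first exact: atlas_chart Ac.
by move=> d Ad; split; exact: (@atlas_compatible _ _ _ A).
Qed.

Lemma chart_at_max p : max_atlas A (chart_at A p).
Proof. exact/atlas_max/chart_at_atlas. Qed.

Lemma chart_at_dom p : cdom (chart_at A p) p.
Proof. exact: mem_chart_at. Qed.

Lemma max_chart c : max_atlas A c -> is_chart c.
Proof. by case. Qed.

Lemma transition_comp c d (e : chart R M n) p : is_chart c -> is_chart d -> cdom c p -> cdom d p ->
  \forall x \near c p, (e \o cinv d) ((d \o cinv c) x) = (e \o cinv c) x.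
Proof.
move=> hc hd cp dp.
apply: filterS (near_cinv hc cp (near_cdom hd dp)) => x /= dx.
by rewrite cmapK.
Qed.

(** Each chart of the maximal atlas is only compatible with [atlas] by definition, so the transition
    is factored through the preferred chart at p. *)
Lemma max_transition c d p : max_atlas A c -> max_atlas A d -> cdom c p -> cdom d p ->
  smooth_map_at (d \o cinv c) (c p).
Proof.
move=> [hc Hc] [hd Hd] cp dp.
have [sc _] := Hc _ (chart_at_atlas A p); have [_ sd] := Hd _ (chart_at_atlas A p).
have ha := atlas_chart (chart_at_atlas A p).
have ap := chart_at_dom p.
apply: (smooth_map_at_eq (transition_comp d hc ha cp ap)).
apply: smooth_map_at_comp; first exact: sc cp ap.
rewrite /= cmapK//; exact: sd ap dp.
Qed.

Lemma transition_differentiable c d p : max_atlas A c -> max_atlas A d ->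
  cdom c p -> cdom d p -> differentiable (d \o cinv c) (c p).
Proof. by move=> *; apply: smooth_map_at_differentiable; exact: max_transition. Qed.

Lemma diff_transition_comp c d (e : chart R M n) p u :
  max_atlas A c -> max_atlas A d -> max_atlas A e ->
  cdom c p -> cdom d p -> cdom e p ->
  'd (e \o cinv d) (d p) ('d (d \o cinv c) (c p) u) = 'd (e \o cinv c) (c p) u.
Proof.
move=> hc hd he cp dp ep.
have E : (d \o cinv c) (c p) = d p by rewrite /= cmapK//; exact: max_chart.
have d1 := transition_differentiable hc hd cp dp.
have d2 := transition_differentiable hd he dp ep.
have N := transition_comp e (max_chart hc) (max_chart hd) cp dp.
exact: (@diff_near_comp _ _ _ (d \o cinv c) (e \o cinv d) (e \o cinv c) (c p) (d p) u E d1 d2 N).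
Qed.

Lemma diff_transition_id c p u : is_chart c -> cdom c p -> 'd (c \o cinv c) (c p) u = u.
Proof.
move=> hc cp.
have [d1 d2] : is_diff (c p) id (id : 'rV[R]_n -> 'rV[R]_n) by exact: is_diff_id.
have N : \forall y \near c p, id y = (c \o cinv c) y.
  by apply: filterS (near_cinvK hc cp) => y [_ /= ->].
by have <- := @near_eq_diff _ _ id (c \o cinv c) (c p) u N d1; rewrite d2.
Qed.

Lemma diff_transitionK c d p u : max_atlas A c -> max_atlas A d ->
  cdom c p -> cdom d p -> 'd (c \o cinv d) (d p) ('d (d \o cinv c) (c p) u) = u.
Proof.
move=> hc hd cp dp.
rewrite (@diff_transition_comp c d c p u hc hd hc cp dp cp).
exact: diff_transition_id (max_chart hc) cp.
Qed.

Lemma tangent_coordK c p v : max_atlas A c -> cdom c p ->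
  tangent_of_coord A c p (tangent_coord A c p v) = v.
Proof.
by move=> hc cp; exact: (@diff_transitionK (chart_at A p) c p v (chart_at_max p) hc (chart_at_dom p) cp).
Qed.

Lemma tangent_of_coordK c p v : max_atlas A c -> cdom c p ->
  tangent_coord A c p (tangent_of_coord A c p v) = v.
Proof.
by move=> hc cp; exact: (@diff_transitionK c (chart_at A p) p v hc (chart_at_max p) cp (chart_at_dom p)).
Qed.

Lemma tangent_coordD c p u v :
  tangent_coord A c p (u + v) = tangent_coord A c p u + tangent_coord A c p v.
Proof. exact: linearD. Qed.

Lemma tangent_coordZ c p (a : R) v :
  tangent_coord A c p (a *: v) = a *: tangent_coord A c p v.
Proof. exact: linearZ. Qed.

Lemma tangent_coord_change c d p v : max_atlas A c -> max_atlas A d ->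
  cdom c p -> cdom d p ->
  tangent_coord A d p v = 'd (d \o cinv c) (c p) (tangent_coord A c p v).
Proof.
move=> hc hd cp dp; exact: esym (@diff_transition_comp (chart_at A p) c d p v (chart_at_max p) hc hd (chart_at_dom p) cp dp).
Qed.

Lemma tangent_coord_chart_at p v : tangent_coord A (chart_at A p) p v = v.
Proof. by apply: diff_transition_id; [exact: max_chart (chart_at_max p)|exact: chart_at_dom]. Qed.

Lemma smooth_fun_change c d p (f : M -> R) : max_atlas A c -> max_atlas A d ->
  cdom c p -> cdom d p -> smooth_at (f \o cinv c) (c p) -> smooth_at (f \o cinv d) (d p).
Proof.
move=> hc hd cp dp sf.
have E : (c \o cinv d) (d p) = c p by rewrite /= cmapK//; exact: max_chart.
apply: (@smooth_at_eq _ _ ((f \o cinv c) \o (c \o cinv d))).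
  apply: filterS (near_cinv (max_chart hd) dp (near_cdom (max_chart hc) cp)) => x /= dx.
  by rewrite cmapK//; exact: max_chart.
apply: smooth_at_comp; first exact: max_transition.
by rewrite E.
Qed.

Lemma smooth_funP c p (f : M -> R) : max_atlas A c -> cdom c p ->
  smooth_fun_at A p f <-> smooth_at (f \o cinv c) (c p).
Proof.
move=> hc cp; have ha := chart_at_max p; have ap := chart_at_dom p.
by split; apply: smooth_fun_change.
Qed.

Lemma vf_in_chart_change c d p X : max_atlas A c -> max_atlas A d ->
  cdom c p -> cdom d p ->
  \forall y \near d p, vf_in_chart A d X y =
    'd (d \o cinv c) (c (cinv d y)) (vf_in_chart A c X (c (cinv d y))).
Proof.
move=> hc hd cp dp.
apply: filterS2 (near_cinvK (max_chart hd) dp)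
  (near_cinv (max_chart hd) dp (near_cdom (max_chart hc) cp)) => y [dy _] cy.
by rewrite /vf_in_chart (cmapK (max_chart hc) cy) (tangent_coord_change _ hc hd cy dy).
Qed.

Lemma smooth_vf_change c d p X : max_atlas A c -> max_atlas A d ->
  cdom c p -> cdom d p -> smooth_map_at (vf_in_chart A c X) (c p) ->
  smooth_map_at (vf_in_chart A d X) (d p).
Proof.
move=> hc hd cp dp sX i.
have sT := max_transition hc hd cp dp.
have sS := max_transition hd hc dp cp.
have E : (c \o cinv d) (d p) = c p by rewrite /= cmapK//; exact: max_chart.
have cS : {for d p, continuous (c \o cinv d)}.
  by apply: differentiable_continuous; exact: smooth_map_at_differentiable.
have nT : \forall y \near d p, smooth_map_at (d \o cinv c) (c (cinv d y)).
  by apply: cS; rewrite E; exact: smooth_map_at_near.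
apply: (@smooth_at_eq _ _ ((fun x => \sum_j vf_in_chart A c X x 0 j *
    partial j (fun x => (d \o cinv c) x 0 i) x) \o (c \o cinv d))).
  apply: filterS2 nT (vf_in_chart_change X hc hd cp dp) => y sy ->.
  by rewrite diff_row//; exact: smooth_map_at_differentiable.
apply: smooth_at_comp => //; rewrite E.
apply: smooth_at_sum => j; apply: smooth_atM; first exact: sX.
by apply: smooth_at_partial; exact: sT.
Qed.

Lemma smooth_vfP c p X : max_atlas A c -> cdom c p ->
  smooth_vf_at A p X <-> smooth_map_at (vf_in_chart A c X) (c p).
Proof.
move=> hc cp; have ha := chart_at_max p; have ap := chart_at_dom p.
by split; apply: smooth_vf_change.
Qed.

Lemma smooth_fun_near p f : smooth_fun_at A p f -> \forall q \near p, smooth_fun_at A q f.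
Proof.
move=> sf; have ha := chart_at_max p; have ap := chart_at_dom p.
have hc := max_chart ha.
apply: filterS2 (near_cdom hc ap) (near_cmap hc ap (smooth_at_near sf)) => q aq sq.
by apply/(smooth_funP _ ha aq).
Qed.

Lemma smooth_vf_near p X : smooth_vf_at A p X -> \forall q \near p, smooth_vf_at A q X.
Proof.
move=> sf; have ha := chart_at_max p; have ap := chart_at_dom p.
have hc := max_chart ha.
apply: filterS2 (near_cdom hc ap) (near_cmap hc ap (smooth_map_at_near sf)) => q aq sq.
by apply/(smooth_vfP _ ha aq).
Qed.

Lemma smooth_fun_eq p (f g : M -> R) : (\forall q \near p, f q = g q) ->
  smooth_fun_at A p f -> smooth_fun_at A p g.
Proof.
move=> fg; apply: smooth_at_eq.
exact: near_cinv (max_chart (chart_at_max p)) (chart_at_dom p) fg.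
Qed.

Lemma smooth_vf_eq p (X Y : vfield R M n) : (\forall q \near p, X q = Y q) ->
  smooth_vf_at A p X -> smooth_vf_at A p Y.
Proof.
move=> XY; apply: smooth_map_at_eq.
apply: filterS (near_cinv (max_chart (chart_at_max p)) (chart_at_dom p) XY) => y E.
by rewrite /vf_in_chart E.
Qed.

Lemma smooth_funM p (f g : M -> R) : smooth_fun_at A p f -> smooth_fun_at A p g ->
  smooth_fun_at A p (fun q => f q * g q).
Proof. exact: smooth_atM. Qed.

Lemma smooth_fun_cst p (a : R) : smooth_fun_at A p (fun=> a).
Proof. exact: smooth_at_cst. Qed.

Lemma smooth_vfD p (X Y : vfield R M n) : smooth_vf_at A p X -> smooth_vf_at A p Y ->
  smooth_vf_at A p (fun q => X q + Y q).
Proof.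
move=> sX sY i; have := smooth_atD (sX i) (sY i).
rewrite (_ : (_ \+ _) = (fun y => vf_in_chart A (chart_at A p) (fun q => X q + Y q) y 0 i)) //.
by apply/funext => y; rewrite /vf_in_chart tangent_coordD mxE.
Qed.

Lemma smooth_vfZ p (f : M -> R) (X : vfield R M n) : smooth_fun_at A p f ->
  smooth_vf_at A p X -> smooth_vf_at A p (fun q => f q *: X q).
Proof.
move=> sf sX i; have := smooth_atM sf (sX i).
rewrite (_ : (_ \* _) = (fun y => vf_in_chart A (chart_at A p) (fun q => f q *: X q) y 0 i)) //.
by apply/funext => y; rewrite /vf_in_chart tangent_coordZ mxE.
Qed.

Lemma vf_derE c p X f : max_atlas A c -> cdom c p -> smooth_fun_at A p f ->
  vf_der A X f p =
  \sum_j tangent_coord A c p (X p) 0 j * partial j (f \o cinv c) (c p).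
Proof.
move=> hc cp sf; have ha := chart_at_max p; have ap := chart_at_dom p.
have E : (c \o cinv (chart_at A p)) (chart_at A p p) = c p.
  by rewrite /= cmapK//; exact: max_chart.
have df := smooth_at_differentiable ((smooth_funP f hc cp).1 sf).
have dT := transition_differentiable ha hc ap cp.
have N : \forall x \near chart_at A p p,
    (f \o cinv c) ((c \o cinv (chart_at A p)) x) = (f \o cinv (chart_at A p)) x.
  apply: filterS (near_cinv (max_chart ha) ap (near_cdom (max_chart hc) cp)) => x /= dx.
  by rewrite cmapK//; exact: max_chart.
rewrite /vf_der -(near_eq_derive _ N) deriveE; last first.
  by apply: differentiable_comp => //; rewrite E.
rewrite -[X in 'd X _ _]/((f \o cinv c) \o (c \o cinv (chart_at A p))).
by rewrite diff_comp ?E//= diffE_partial.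
Qed.

Lemma vf_der_near p X f : smooth_vf_at A p X -> smooth_fun_at A p f ->
  let c := chart_at A p in
  \forall y \near c p, (vf_der A X f \o cinv c) y =
    \sum_j vf_in_chart A c X y 0 j * partial j (f \o cinv c) y.
Proof.
move=> sX sf c; have ha := chart_at_max p; have ap := chart_at_dom p.
apply: filterS2 (near_cinvK (max_chart ha) ap)
  (near_cinv (max_chart ha) ap (smooth_fun_near sf)) => y [dy Ey] sy.
by rewrite /= (vf_derE _ ha dy sy) Ey.
Qed.

Lemma smooth_vf_der p X f : smooth_vf_at A p X -> smooth_fun_at A p f ->
  smooth_fun_at A p (vf_der A X f).
Proof.
move=> sX sf.
apply: (@smooth_at_eq _ _ (fun y => \sum_j vf_in_chart A (chart_at A p) X y 0 j *
    partial j (f \o cinv (chart_at A p)) y)).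
  by apply: filterS (vf_der_near sX sf) => y ->.
apply: smooth_at_sum => j; apply: smooth_atM; first exact: sX.
exact: smooth_at_partial.
Qed.

Lemma vf_in_chart_at p X : vf_in_chart A (chart_at A p) X (chart_at A p p) = X p.
Proof.
rewrite /vf_in_chart cmapK; [exact: tangent_coord_chart_at| |exact: chart_at_dom].
exact: max_chart (chart_at_max p).
Qed.

Lemma partial_sum_mul (I : Type) (r : seq I) (a b : I -> 'rV[R]_n -> R) j x :
  (forall i, differentiable (a i) x) -> (forall i, differentiable (b i) x) ->
  partial j (fun y => \sum_(i <- r) a i y * b i y) x
  = \sum_(i <- r) (partial j (a i) x * b i x + a i x * partial j (b i) x).
Proof.
move=> da db; have dab i : differentiable (a i \* b i) x by exact: differentiableM.
suff : differentiable (fun y => \sum_(i <- r) a i y * b i y) x /\ 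
  partial j (fun y => \sum_(i <- r) a i y * b i y) x
  = \sum_(i <- r) (partial j (a i) x * b i x + a i x * partial j (b i) x) by case.
elim: r => [|i r [IHd IH]].
  rewrite big_nil (_ : (fun y => _) = cst 0); last by apply/funext => y; rewrite big_nil.
  by split; [exact: differentiable_cst|exact: derive_cst].
rewrite big_cons (_ : (fun y => _) = (a i \* b i) \+ fun y => \sum_(i <- r) a i y * b i y); last first.
  by apply/funext => y; rewrite big_cons.
split; first exact: differentiableD.
rewrite -IH /partial deriveD ?deriveM; try exact: diff_derivable.
by rewrite /GRing.scale /=; ring.
Qed.

(** [lie] is defined by derivatives of components. In the commutator of derivations the second
    derivatives of f cancel by [partialC]. *)
Lemma vf_der_lie p X Y f : smooth_vf_at A p X -> smooth_vf_at A p Y -> smooth_fun_at A p f ->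
  vf_der A (lie A X Y) f p =
  vf_der A X (vf_der A Y f) p - vf_der A Y (vf_der A X f) p.
Proof.
move=> sX sY sf; set c := chart_at A p.
have ha := chart_at_max p; have ap := chart_at_dom p.
pose F := f \o cinv c.
have sF : smooth_at F (c p) by [].
have dv Z : smooth_vf_at A p Z -> forall j, differentiable (fun y => vf_in_chart A c Z y 0 j) (c p).
  by move=> sZ j; apply: smooth_at_differentiable; exact: sZ.
have dF j : differentiable (partial j F) (c p).
  by apply: smooth_at_differentiable; exact: smooth_at_partial.
have key Z W : smooth_vf_at A p Z -> smooth_vf_at A p W ->
    vf_der A Z (vf_der A W f) p = \sum_i Z p 0 i * \sum_j
      (partial i (fun y => vf_in_chart A c W y 0 j) (c p) * partial j F (c p)
       + W p 0 j * partial i (partial j F) (c p)).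
  move=> sZ sW; rewrite (vf_derE _ ha ap (smooth_vf_der sW sf)) tangent_coord_chart_at.
  apply: eq_bigr => i _; congr (_ * _).
  rewrite {1}/partial (near_eq_derive _ (vf_der_near sW sf)).
  rewrite -[LHS]/(partial i (fun y => \sum_j vf_in_chart A c W y 0 j * partial j F y) (c p)).
  rewrite partial_sum_mul//; last exact: dv.
  by apply: eq_bigr => j _; rewrite vf_in_chart_at.
rewrite (vf_derE _ ha ap sf) tangent_coord_chart_at !key// -/c -/F.
have lieE j : lie A X Y p 0 j = \sum_i (X p 0 i * partial i (fun y => vf_in_chart A c Y y 0 j) (c p)
    - Y p 0 i * partial i (fun y => vf_in_chart A c X y 0 j) (c p)).
  rewrite /lie rowB !deriveE; try exact: smooth_map_at_differentiable.
  by rewrite !diff_row ?sumrB//; exact: smooth_map_at_differentiable.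
have S : \sum_i \sum_j X p 0 i * (Y p 0 j * partial i (partial j F) (c p)) =
         \sum_i \sum_j Y p 0 i * (X p 0 j * partial i (partial j F) (c p)).
  rewrite exchange_big; apply: eq_bigr => i _; apply: eq_bigr => j _.
  by rewrite (partialC j i sF); ring.
have E (Z W : vfield R M n) : \sum_i Z p 0 i * \sum_j
      (partial i (fun y => vf_in_chart A c W y 0 j) (c p) * partial j F (c p)
       + W p 0 j * partial i (partial j F) (c p)) =
   \sum_j (\sum_i Z p 0 i * partial i (fun y => vf_in_chart A c W y 0 j) (c p)) * partial j F (c p)
   + \sum_i \sum_j Z p 0 i * (W p 0 j * partial i (partial j F) (c p)).
  under eq_bigr do rewrite mulr_sumr.
  under [X in X + _]eq_bigr do rewrite mulr_suml.
  rewrite [X in X + _]exchange_big -big_split; apply: eq_bigr => i _.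
  by rewrite -big_split; apply: eq_bigr => j _ /=; ring.
rewrite (E X Y) (E Y X) S opprD addrACA subrr addr0 -sumrB; apply: eq_bigr => j _.
by rewrite lieE sumrB mulrBl.
Qed.

Lemma vf_der_eq p X (f g : M -> R) : (\forall q \near p, f q = g q) ->
  vf_der A X f p = vf_der A X g p.
Proof.
move=> fg; apply: near_eq_derive.
exact: near_cinv (max_chart (chart_at_max p)) (chart_at_dom p) fg.
Qed.

Lemma vf_der_cst p X (a : R) : vf_der A X (fun=> a) p = 0.
Proof. exact: derive_cst. Qed.

Lemma vf_derD p X f g : smooth_fun_at A p f -> smooth_fun_at A p g ->
  vf_der A X (fun q => f q + g q) p = vf_der A X f p + vf_der A X g p.
Proof.
move=> /smooth_at_differentiable df /smooth_at_differentiable dg.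
by apply: deriveD; exact: diff_derivable.
Qed.

Lemma vf_derM p X f g : smooth_fun_at A p f -> smooth_fun_at A p g ->
  vf_der A X (fun q => f q * g q) p = vf_der A X f p * g p + f p * vf_der A X g p.
Proof.
move=> /smooth_at_differentiable df /smooth_at_differentiable dg.
have D1 := @diff_derivable _ _ _ _ _ (X p) df; have D2 := @diff_derivable _ _ _ _ _ (X p) dg.
have E := deriveM D1 D2.
rewrite /vf_der [LHS]E /GRing.scale /= cmapK; [|exact: max_chart (chart_at_max p)|exact: chart_at_dom].
by rewrite addrC mulrC.
Qed.

Lemma vf_derDl p (X Y : vfield R M n) f : smooth_fun_at A p f ->
  vf_der A (fun q => X q + Y q) f p = vf_der A X f p + vf_der A Y f p.
Proof. by move=> /smooth_at_differentiable df; rewrite /vf_der !deriveE// linearD. Qed.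

Lemma vf_derZl p (h : M -> R) X f : smooth_fun_at A p f ->
  vf_der A (fun q => h q *: X q) f p = h p * vf_der A X f p.
Proof. by move=> /smooth_at_differentiable df; rewrite /vf_der !deriveE// linearZ. Qed.

Lemma vf_der_coord p X i :
  smooth_fun_at A p (fun q => chart_at A p q 0 i) /\
  vf_der A X (fun q => chart_at A p q 0 i) p = X p 0 i.
Proof.
set c := chart_at A p; have ha := chart_at_max p; have ap := chart_at_dom p.
have N : \forall y \near c p, (y : 'rV[R]_n) 0 i = ((fun q => c q 0 i) \o cinv c) y.
  by apply: filterS (near_cinvK (max_chart ha) ap) => y [_ /= ->].
have s0 : smooth_at (fun y : 'rV[R]_n => y 0 i) (c p).
  by apply/smooth_atP; exists setT; split=> //; [exact: openT|apply/smooth_on_coord/openT].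
split; first exact: smooth_at_eq N s0.
rewrite /vf_der -(near_eq_derive _ N) deriveE_partial; last exact: differentiable_coord.
rewrite (bigD1 i)//= partial_coord mxE !eqxx mulr1 big1 ?addr0// => j ji.
by rewrite partial_coord mxE eq_sym (negPf ji) andbF mulr0.
Qed.

(** The coordinates of the preferred chart suffice as test functions; vector identities can thus be
    checked on derivations. *)
Lemma vec_ext p (X Y : vfield R M n) :
  (forall f, smooth_fun_at A p f -> vf_der A X f p = vf_der A Y f p) -> X p = Y p.
Proof.
move=> H; apply/rowP => i.
have [s EX] := vf_der_coord p X i; have [_ EY] := vf_der_coord p Y i.
by rewrite -EX -EY H.
Qed.

Definition cst_vf c (u : 'rV[R]_n) : vfield R M n := fun q => tangent_of_coord A c q u.

Lemma smooth_cst_vf c u p : max_atlas A c -> cdom c p -> smooth_vf_at A p (cst_vf c u).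
Proof.
move=> hc cp; apply/(smooth_vfP _ hc cp) => i.
apply: (smooth_at_eq _ (smooth_at_cst (u 0 i) (c p))).
apply: filterS (near_cinvK (max_chart hc) cp) => y [dy _].
by rewrite /vf_in_chart tangent_of_coordK.
Qed.

Lemma smooth_coord_vf c i p : max_atlas A c -> cdom c p -> smooth_vf_at A p (coord_vf A c i).
Proof. exact: smooth_cst_vf. Qed.

(** Transfers identities proved for fields smooth at p to arbitrary vectors of the tangent space. *)
Lemma exists_extension p v : exists2 X, smooth_vf_at A p X & X p = v.
Proof.
exists (cst_vf (chart_at A p) v).
  by apply: smooth_cst_vf; [exact: chart_at_max|exact: chart_at_dom].
by apply: diff_transition_id; [exact: max_chart (chart_at_max p)|exact: chart_at_dom].
Qed.

Definition vf_comp c X i : M -> R := fun q => vf_in_chart A c X (c q) 0 i.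

Lemma smooth_vf_comp c X i p : max_atlas A c -> cdom c p -> smooth_vf_at A p X ->
  smooth_fun_at A p (vf_comp c X i).
Proof.
move=> hc cp /(smooth_vfP _ hc cp) sX; apply/(smooth_funP _ hc cp).
apply: smooth_at_eq (sX i).
by apply: filterS (near_cinvK (max_chart hc) cp) => y [_ Ey]; rewrite /vf_comp /= Ey.
Qed.

Lemma vf_decomp c X q : max_atlas A c -> cdom c q ->
  X q = \sum_i vf_comp c X i q *: coord_vf A c i q.
Proof.
move=> hc cq; rewrite -[LHS](tangent_coordK _ hc cq).
rewrite /vf_comp /vf_in_chart cmapK//; last exact: max_chart.
set u := tangent_coord A c q (X q).
rewrite {1}(row_sum_delta u) /tangent_of_coord linear_sum /=.
by apply: eq_bigr => i _; rewrite linearZ.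
Qed.

End Charts.

(** * Charts adapted to a nowhere vanishing field *)

Section AdaptedCharts.
Context {R : realType} {M : topologicalType} {k : nat}.
Variable A : smooth_manifold R M k.+1.

(** The inverse G of the flow box of xi, written in the preferred chart a, is composed with a; in
    the resulting chart xi is the last coordinate field. *)
Lemma exists_adapted_chart (xi : vfield R M k.+1) p :
  (forall q, smooth_vf_at A q xi) -> xi p != 0 ->
  exists2 c, adapted_chart A xi c & cdom c p.
Proof.
move=> sxi xi0; set a := chart_at A p.
have ha := chart_at_max A p; have ap := chart_at_dom A p.
have hc := max_chart ha.
pose v := vf_in_chart A a xi.
have v0 : v (a p) != 0 by rewrite /v vf_in_chart_at.
(* The image of a is taken for W, so that the flow box stays where [cinv a] is meaningful. *)
have nW : nbhs (a p) (a @` cdom a).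
  by apply: open_nbhs_nbhs; split; [exact: cimage_open|exists p].
have [U [V [Phi [G [oU oV Vp VW [PU GV sP sG dP]]]]]] := straightening (sxi p) v0 nW.
pose dom := cdom a `&` a @^-1` V.
pose c : chart R M k.+1 := Chart dom (G \o a) (cinv a \o Phi).
have imc : c @` dom = U.
  apply/seteqP; split=> [_ [q [aq Vq] <-]|u Uu]; first by case: (GV _ Vq).
  have [VPu GPu] := PU u Uu; have [q aq qE] := VW _ VPu.
  by exists q; rewrite /= ?qE//; split; rewrite //= qE.
have dG y : V y -> smooth_map_at G y by move=> Vy i; apply/smooth_atP; exists V.
have dPhi u : U u -> smooth_map_at Phi u by move=> Uu i; apply/smooth_atP; exists U.
have hcc : is_chart c.
  split.
  - rewrite openE => q [aq Vq]; apply: filterI; first exact: near_cdom.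
    by apply: near_cmap => //; apply: open_nbhs_nbhs.
  - by rewrite imc.
  - by move=> q [aq Vq] /=; have [_ ->] := GV _ Vq; rewrite cmapK.
  - move=> q [aq Vq]; apply: continuous_comp; first exact: cmap_continuous.
    by apply: differentiable_continuous; apply: smooth_map_at_differentiable; exact: dG.
  - move=> u; rewrite imc => Uu; apply: continuous_comp.
      by apply: differentiable_continuous; apply: smooth_map_at_differentiable; exact: dPhi.
    by apply: cinv_continuous => //; apply: VW; case: (PU u Uu).
have mc : max_atlas A c.
  split=> // d Ad; have hd := atlas_max Ad; split=> q.
  - move=> [aq Vq] dq; have [UGq PGq] := GV _ Vq.
    apply: (smooth_map_at_comp (F := Phi) (G := d \o cinv a)); first exact: dPhi.
    have E : Phi (c q) = a q := PGq.
    rewrite E; exact: (@max_transition _ _ _ A a d q ha hd aq dq).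
  - move=> dq [aq Vq].
    apply: (smooth_map_at_comp (F := a \o cinv d) (G := G)).
      exact: (@max_transition _ _ _ A d a q hd ha dq aq).
    have E : (a \o cinv d) (d q) = a q by rewrite /= (cmapK (max_chart hd) dq).
    by rewrite E; exact: dG.
exists c; last by [].
split=> // q [aq Vq]; have [UGq PGq] := GV _ Vq.
have d2 := @transition_differentiable _ _ _ A a (chart_at A q) q ha (chart_at_max A q) aq (chart_at_dom A q).
have d1 : differentiable Phi (G (a q)).
  by apply: smooth_map_at_differentiable; exact: dPhi.
have Ev : 'd Phi (G (a q)) (delta_mx 0 ord_max) = tangent_coord A a q (xi q).
  apply/rowP => i; rewrite diff_row_coord// -deriveE; last exact: differentiable_row_coord.
  rewrite -[LHS]/(partial ord_max (fun u => Phi u 0 i) (G (a q))) dP//.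
  by rewrite PGq /v /vf_in_chart (cmapK hc aq).
have E := @diff_compE _ _ _ _ Phi (chart_at A q \o cinv a) (G (a q)) (a q) (delta_mx 0 ord_max) PGq d1 d2.
transitivity ('d (chart_at A q \o cinv a) (a q) ('d Phi (G (a q)) (delta_mx 0 ord_max))).
  exact: esym E.
exact: etrans (congr1 (fun w => tangent_of_coord A a q w) Ev) (tangent_coordK (xi q) ha aq).
Qed.

End AdaptedCharts.

(** * Connections and curvature *)

Section Connections.
Context {R : realType} {M : topologicalType} {n : nat}.
Variable A : smooth_manifold R M n.
Implicit Types (X Y Z W : vfield R M n) (f h : M -> R) (p q : M).

Local Notation sv := (smooth_vf_at A).
Local Notation sf := (smooth_fun_at A).

Definition vf_add X Y : vfield R M n := fun q => X q + Y q.
Definition vf_scale f X : vfield R M n := fun q => f q *: X q.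
Definition vf_zero : vfield R M n := fun=> 0.
Definition vf_opp X : vfield R M n := fun q => - X q.

Lemma smooth_vf_add p X Y : sv p X -> sv p Y -> sv p (vf_add X Y).
Proof. exact: smooth_vfD. Qed.

Lemma smooth_vf_scale p f X : sf p f -> sv p X -> sv p (vf_scale f X).
Proof. exact: smooth_vfZ. Qed.

Lemma vf_oppE X : vf_opp X = vf_scale (fun=> -1) X.
Proof. by apply/funext => q; rewrite /vf_opp /vf_scale scaleN1r. Qed.

Lemma smooth_vf_opp p X : sv p X -> sv p (vf_opp X).
Proof. by rewrite vf_oppE; apply: smooth_vf_scale; exact: smooth_fun_cst. Qed.

Lemma smooth_vf_zero p : sv p vf_zero.
Proof.
have [X sX _] := exists_extension A p 0.
rewrite (_ : vf_zero = vf_scale (fun=> 0) X); first by apply: smooth_vf_scale => //; exact: smooth_fun_cst.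
by apply/funext => q; rewrite /vf_scale scale0r.
Qed.

Lemma vf_der_vf_add p X Y f : sf p f ->
  vf_der A (vf_add X Y) f p = vf_der A X f p + vf_der A Y f p.
Proof. exact: vf_derDl. Qed.

Lemma vf_der_vf_scale p h X f : sf p f -> vf_der A (vf_scale h X) f p = h p * vf_der A X f p.
Proof. exact: vf_derZl. Qed.

Lemma vf_der_vf_zero p f : vf_der A vf_zero f p = 0.
Proof. exact: derive0. Qed.

(* Smoothness being required at p only, the indicator function of a
   neighbourhood of p plays the role of a bump function. *)
Lemma near_indicator p (P : M -> Prop) : (\forall q \near p, P q) ->
  exists f, [/\ sf p f, f p = 1, forall X, vf_der A X f p = 0 &
    forall q, f q != 0 -> P q].
Proof.
move=> nP; pose f q : R := if `[< P q >] then 1 else 0.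
have n1 : \forall q \near p, 1 = f q.
  by apply: filterS nP => q Pq; rewrite /f asboolT.
exists f; split.
- exact: smooth_fun_eq n1 (smooth_fun_cst A p 1).
- by rewrite -(nbhs_singleton n1).
- by move=> X; rewrite -(vf_der_eq A X n1) vf_der_cst.
- by move=> q; rewrite /f; case: asboolP => //; rewrite eqxx.
Qed.

Section OneConnection.
Variable D : connection_op R M n.
Hypothesis hD : is_connection A D.

Lemma connDl p X X' Y : sv p X -> sv p X' -> sv p Y ->
  D (vf_add X X') Y p = D X Y p + D X' Y p.
Proof. exact: (conn_addl hD). Qed.

Lemma connZl p f X Y : sf p f -> sv p X -> sv p Y ->
  D (vf_scale f X) Y p = f p *: D X Y p.
Proof. exact: (conn_scalel hD). Qed.

Lemma connDr p X Y Y' : sv p X -> sv p Y -> sv p Y' ->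
  D X (vf_add Y Y') p = D X Y p + D X Y' p.
Proof. exact: (conn_addr hD). Qed.

Lemma connZr p f X Y : sf p f -> sv p X -> sv p Y ->
  D X (vf_scale f Y) p = vf_der A X f p *: Y p + f p *: D X Y p.
Proof. exact: (conn_leibniz hD). Qed.

(** Multiplying by an indicator turns equality near p into equality of fields; linearity over
    functions then removes the indicator, whose value at p is 1. For [conn_localr] the Leibniz term
    drops because the indicator is constant near p. *)
Lemma conn_locall p X X' Y : sv p X -> sv p Y ->
  (\forall q \near p, X q = X' q) -> D X Y p = D X' Y p.
Proof.
move=> sX sY nX; have [f [s1 f1 _ fP]] := near_indicator nX.
have E : vf_scale f X = vf_scale f X'.
  apply/funext => q; rewrite /vf_scale; have [->|/fP -> //] := eqVneq (f q) 0.
  by rewrite !scale0r.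
have sX' : sv p X' := smooth_vf_eq nX sX.
by rewrite -[LHS]scale1r -[RHS]scale1r -f1 -!connZl// E.
Qed.

Lemma conn_localr p X Y Y' : sv p X -> sv p Y ->
  (\forall q \near p, Y q = Y' q) -> D X Y p = D X Y' p.
Proof.
move=> sX sY nY; have [f [s1 f1 df fP]] := near_indicator nY.
have E : vf_scale f Y = vf_scale f Y'.
  apply/funext => q; rewrite /vf_scale; have [->|/fP -> //] := eqVneq (f q) 0.
  by rewrite !scale0r.
have sY' : sv p Y' := smooth_vf_eq nY sY.
have := connZr s1 sX sY; have := connZr s1 sX sY'.
by rewrite E df scale0r add0r f1 scale1r => -> ; rewrite scale0r add0r scale1r.
Qed.

Lemma connNl p X Y : sv p X -> sv p Y -> D (vf_opp X) Y p = - D X Y p.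
Proof. by move=> sX sY; rewrite vf_oppE connZl ?scaleN1r//; exact: smooth_fun_cst. Qed.

Lemma connNr p X Y : sv p X -> sv p Y -> D X (vf_opp Y) p = - D X Y p.
Proof.
move=> sX sY; rewrite vf_oppE connZr//; last exact: smooth_fun_cst.
by rewrite vf_der_cst scale0r add0r scaleN1r.
Qed.

Lemma conn0r p X : sv p X -> D X vf_zero p = 0.
Proof.
move=> sX; have s0 := smooth_vf_zero p.
rewrite (_ : vf_zero = vf_scale (fun=> 0) vf_zero).
  by rewrite connZr ?vf_der_cst ?scale0r ?addr0//; exact: smooth_fun_cst.
by apply/funext => q; rewrite /vf_scale scale0r.
Qed.

Lemma conn_near0r p X Y : sv p X -> (\forall q \near p, Y q = 0) -> D X Y p = 0.
Proof.
move=> sX nY; rewrite -(@conn_localr p X vf_zero Y) ?conn0r//; first exact: smooth_vf_zero.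
by apply: filterS nY => q ->.
Qed.

Lemma smooth_conn p X Y : sv p X -> sv p Y -> sv p (D X Y).
Proof. exact: (conn_smooth hD). Qed.

End OneConnection.

(** * Rules for the bracket and tensoriality of curvature *)

Section LeviCivita.
Variables (g : bil_field R M n) (nabla : connection_op R M n).
Hypothesis hl : levi_civita A g nabla.

Let hn := lc_connection hl.

(** Smoothness and the algebraic rules of the bracket are deduced from torsion-freeness and the
    connection axioms, which avoids further computations in charts. *)
Lemma lieE p X Y : sv p X -> sv p Y -> lie A X Y p = nabla X Y p - nabla Y X p.
Proof. by move=> sX sY; rewrite (lc_torsion_free hl). Qed.

Lemma smooth_lie p X Y : sv p X -> sv p Y -> sv p (lie A X Y).
Proof.
move=> sX sY; apply: (@smooth_vf_eq _ _ _ A p (vf_add (nabla X Y) (vf_opp (nabla Y X)))).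
  by apply: filterS2 (smooth_vf_near sX) (smooth_vf_near sY) => q sX' sY'; rewrite lieE.
by apply: smooth_vf_add; [|apply: smooth_vf_opp]; exact: smooth_conn.
Qed.

Lemma lieC p X Y : lie A X Y p = - lie A Y X p.
Proof. by rewrite /lie opprB. Qed.

Lemma lie_self p X : lie A X X p = 0.
Proof. exact: subrr. Qed.

Lemma lieDr p X Y Z : sv p X -> sv p Y -> sv p Z ->
  lie A X (vf_add Y Z) p = lie A X Y p + lie A X Z p.
Proof.
move=> sX sY sZ; rewrite !lieE//; last exact: smooth_vf_add.
by rewrite (connDl hn)// (connDr hn)// opprD addrACA.
Qed.

Lemma lieZr p f X Y : sf p f -> sv p X -> sv p Y ->
  lie A X (vf_scale f Y) p = vf_der A X f p *: Y p + f p *: lie A X Y p.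
Proof.
move=> s1 sX sY; rewrite !lieE//; last exact: smooth_vf_scale.
by rewrite (connZl hn)// (connZr hn)// scalerBr addrA.
Qed.

Lemma lieDl p X Y Z : sv p X -> sv p Y -> sv p Z ->
  lie A (vf_add X Y) Z p = lie A X Z p + lie A Y Z p.
Proof.
move=> sX sY sZ; apply: etrans (lieC _ _ _) _; apply: etrans (congr1 _ (lieDr sZ sX sY)) _.
by rewrite opprD; congr (_ + _); exact: esym (lieC _ _ _).
Qed.

Lemma lieZl p f X Y : sf p f -> sv p X -> sv p Y ->
  lie A (vf_scale f X) Y p = f p *: lie A X Y p - vf_der A Y f p *: X p.
Proof.
move=> s1 sX sY; apply: etrans (lieC _ _ _) _; apply: etrans (congr1 _ (lieZr s1 sY sX)) _.
rewrite opprD addrC -scalerN; congr (_ *: _ - _); exact: esym (lieC _ _ _).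
Qed.

Lemma lie0r p X : sv p X -> lie A X vf_zero p = 0.
Proof.
move=> sX; rewrite lieE//; last exact: smooth_vf_zero.
rewrite (conn0r hn)// sub0r; apply/eqP; rewrite oppr_eq0; apply/eqP.
rewrite (_ : vf_zero = vf_scale (fun=> 0) vf_zero).
  by rewrite (connZl hn) ?scale0r//; [exact: smooth_fun_cst|exact: smooth_vf_zero].
by apply/funext => q; rewrite /vf_scale scale0r.
Qed.

Lemma lie0l p X : sv p X -> lie A vf_zero X p = 0.
Proof. by move=> sX; rewrite lieC lie0r// oppr0. Qed.

(** On a function f each double bracket is a signed sum of four of the six iterated derivatives, and
    these cancel. In [dl] the inner commutator formula is differentiated, for which it has to hold
    near p. *)
Lemma jacobi p X Y Z : sv p X -> sv p Y -> sv p Z ->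
  lie A X (lie A Y Z) p - lie A Y (lie A X Z) p + lie A Z (lie A X Y) p = 0.
Proof.
move=> sX sY sZ.
have sXY := smooth_lie sX sY; have sYZ := smooth_lie sY sZ; have sXZ := smooth_lie sX sZ.
pose V : vfield R M n := vf_add (vf_add (lie A X (lie A Y Z)) (vf_opp (lie A Y (lie A X Z))))
  (lie A Z (lie A X Y)).
rewrite -[LHS]/(V p) -[RHS]/(vf_zero p); apply: (@vec_ext _ _ _ A) => f s1.
have d1 W : sv p W -> sf p (vf_der A W f) by move=> sW; exact: (smooth_vf_der sW s1).
have dl U W : sv p U -> sv p W -> forall T, sv p T ->
    vf_der A T (vf_der A (lie A U W) f) p =
    vf_der A T (vf_der A U (vf_der A W f)) p - vf_der A T (vf_der A W (vf_der A U f)) p.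
  move=> sU sW T sT.
  have E : \forall q \near p, vf_der A (lie A U W) f q =
      vf_der A U (vf_der A W f) q + (-1) * vf_der A W (vf_der A U f) q.
    apply: filterS3 (smooth_vf_near sU) (smooth_vf_near sW) (smooth_fun_near s1) => q sU' sW' s1'.
    by rewrite mulN1r; exact: (vf_der_lie sU' sW' s1').
  have s2 : sf p (vf_der A U (vf_der A W f)) by apply: smooth_vf_der => //; exact: d1.
  have s3 : sf p (vf_der A W (vf_der A U f)) by apply: smooth_vf_der => //; exact: d1.
  rewrite (vf_der_eq _ _ E) vf_derD//; last first.
    by apply: smooth_funM => //; exact: smooth_fun_cst.
  rewrite vf_derM//; last exact: smooth_fun_cst.
  by rewrite vf_der_cst mul0r add0r mulN1r.
rewrite vf_der_vf_zero.
rewrite /V vf_der_vf_add// vf_der_vf_add// vf_oppE vf_der_vf_scale//.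
have key U W T : sv p U -> sv p W -> sv p T ->
    vf_der A (lie A T (lie A U W)) f p =
    vf_der A T (vf_der A U (vf_der A W f)) p - vf_der A T (vf_der A W (vf_der A U f)) p -
    (vf_der A U (vf_der A W (vf_der A T f)) p - vf_der A W (vf_der A U (vf_der A T f)) p).
  move=> sU sW sT; apply: etrans (vf_der_lie sT (smooth_lie sU sW) s1) _.
  by congr (_ - _); [exact: dl|exact: (vf_der_lie sU sW (d1 _ sT))].
(* Here and below identities are isolated over variables, because the ring
   tactics would compare brackets by unfolding them. *)
have alg (a b c xyz xzy yzx yxz zxy zyx : R) :
    a = xyz - xzy - (yzx - zyx) -> b = yxz - yzx - (xzy - zxy) ->
    c = zxy - zyx - (xyz - yxz) -> a + -1 * b + c = 0.
  by move=> -> -> ->; ring.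
exact: (alg _ _ _ _ _ _ _ _ _ (key _ _ _ sY sZ sX) (key _ _ _ sX sZ sY) (key _ _ _ sX sY sZ)).
Qed.

Section Curvature.
Variable D : connection_op R M n.
Hypothesis hD : is_connection A D.
Local Notation K := (curvature A D).

Lemma curvature_skew p X Y Z : sv p X -> sv p Y -> sv p Z -> K X Y Z p = - K Y X Z p.
Proof.
move=> sX sY sZ; rewrite /curvature.
have alg (a b c d : 'rV[R]_n) : c = - d -> a - b - c = - (b - a - d).
  by move=> ->; rewrite opprD opprB.
apply: alg; apply: etrans (connNl hD (smooth_lie sY sX) sZ).
by congr (D _ Z p); apply/funext => q; exact: lieC.
Qed.

Lemma curvatureDl p X X' Y Z : sv p X -> sv p X' -> sv p Y -> sv p Z ->
  K (vf_add X X') Y Z p = K X Y Z p + K X' Y Z p.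
Proof.
move=> sX sX' sY sZ; rewrite /curvature.
have sc := smooth_conn hD.
rewrite (connDl hD)//; last exact: sc.
have -> : D Y (D (vf_add X X') Z) p = D Y (D X Z) p + D Y (D X' Z) p.
  rewrite -(connDr hD)//; try exact: sc.
  apply: (conn_localr hD) => //; first by apply: sc => //; exact: smooth_vf_add.
  apply: filterS3 (smooth_vf_near sX) (smooth_vf_near sX') (smooth_vf_near sZ) => q *.
  exact: (connDl hD).
have E : D (lie A (vf_add X X') Y) Z p = D (lie A X Y) Z p + D (lie A X' Y) Z p.
  rewrite -(connDl hD)//; try exact: smooth_lie.
  apply: (conn_locall hD) => //; first by apply: smooth_lie => //; exact: smooth_vf_add.
  apply: filterS3 (smooth_vf_near sX) (smooth_vf_near sX') (smooth_vf_near sY) => q *.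
  exact: lieDl.
have alg (a1 a2 b1 b2 c c1 c2 : 'rV[R]_n) : c = c1 + c2 ->
    a1 + a2 - (b1 + b2) - c = a1 - b1 - c1 + (a2 - b2 - c2).
  by move=> ->; apply/rowP => i; rewrite !mxE; ring.
exact: alg.
Qed.

(** The Leibniz term (Y f) D_X Z of the second derivative cancels the one coming from [f X, Y]. *)
Lemma curvatureZl p f X Y Z : sf p f -> sv p X -> sv p Y -> sv p Z ->
  K (vf_scale f X) Y Z p = f p *: K X Y Z p.
Proof.
move=> s1 sX sY sZ; rewrite /curvature.
have sc := smooth_conn hD.
rewrite (connZl hD)//; last exact: sc.
have -> : D Y (D (vf_scale f X) Z) p = vf_der A Y f p *: D X Z p + f p *: D Y (D X Z) p.
  rewrite -(connZr hD)//; try exact: sc.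
  apply: (conn_localr hD) => //; first by apply: sc => //; exact: smooth_vf_scale.
  apply: filterS3 (smooth_vf_near sX) (smooth_fun_near s1) (smooth_vf_near sZ) => q *.
  exact: (connZl hD).
have sYf : sf p (vf_der A Y f) by exact: smooth_vf_der.
have -> : D (lie A (vf_scale f X) Y) Z p = f p *: D (lie A X Y) Z p - vf_der A Y f p *: D X Z p.
  rewrite -!(connZl hD)//; try exact: smooth_lie.
  have s2 : sv p (vf_scale (vf_der A Y f) X) by exact: smooth_vf_scale.
  have s3 : sv p (vf_scale f (lie A X Y)) by apply: smooth_vf_scale => //; exact: smooth_lie.
  rewrite -(connNl hD)// -(connDl hD)//; last exact: smooth_vf_opp.
  apply: (conn_locall hD) => //; first by apply: smooth_lie => //; exact: smooth_vf_scale.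
  apply: filterS3 (smooth_vf_near sX) (smooth_fun_near s1) (smooth_vf_near sY) => q *.
  exact: lieZl.
by apply/rowP => i; rewrite !mxE; ring.
Qed.

Lemma curvatureDr p X Y Z Z' : sv p X -> sv p Y -> sv p Z -> sv p Z' ->
  K X Y (vf_add Z Z') p = K X Y Z p + K X Y Z' p.
Proof.
move=> sX sY sZ sZ'; rewrite /curvature.
have sc := smooth_conn hD.
have key U V : sv p U -> sv p V -> D U (D V (vf_add Z Z')) p = D U (D V Z) p + D U (D V Z') p.
  move=> sU sV; rewrite -(connDr hD)//; try exact: sc.
  apply: (conn_localr hD) => //; first by apply: sc => //; exact: smooth_vf_add.
  apply: filterS3 (smooth_vf_near sV) (smooth_vf_near sZ) (smooth_vf_near sZ') => q *.
  exact: (connDr hD).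
rewrite !key// (connDr hD)//; last exact: smooth_lie.
by apply/rowP => i; rewrite !mxE; ring.
Qed.

(** The mixed first derivatives of f cancel in pairs, and the second ones combine into the
    derivative along [X, Y]. *)
Lemma curvatureZr p f X Y Z : sf p f -> sv p X -> sv p Y -> sv p Z ->
  K X Y (vf_scale f Z) p = f p *: K X Y Z p.
Proof.
move=> s1 sX sY sZ; rewrite /curvature.
have sc := smooth_conn hD.
have key U V : sv p U -> sv p V -> D U (D V (vf_scale f Z)) p =
    vf_der A U (vf_der A V f) p *: Z p + vf_der A V f p *: D U Z p +
    (vf_der A U f p *: D V Z p + f p *: D U (D V Z) p).
  move=> sU sV.
  have sVf : sf p (vf_der A V f) by exact: smooth_vf_der.
  have sDV : sv p (D V Z) by exact: sc.
  rewrite -!(connZr hD)// -(connDr hD)//; try exact: smooth_vf_scale.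
  apply: (conn_localr hD) => //; first by apply: sc => //; exact: smooth_vf_scale.
  apply: filterS3 (smooth_vf_near sV) (smooth_vf_near sZ) (smooth_fun_near s1) => q *.
  exact: (connZr hD).
rewrite !key// (connZr hD)//; last exact: smooth_lie.
have alg (a b c d e l : R) (z u v s t w : 'rV[R]_n) : l = a - b ->
    a *: z + d *: u + (c *: v + e *: s) - (b *: z + c *: v + (d *: u + e *: t)) -
    (l *: z + e *: w) = e *: (s - t - w).
  by move=> ->; apply/rowP => i; rewrite !mxE; ring.
exact: alg (vf_der_lie sX sY s1).
Qed.

Lemma curvatureDm p X Y Y' Z : sv p X -> sv p Y -> sv p Y' -> sv p Z ->
  K X (vf_add Y Y') Z p = K X Y Z p + K X Y' Z p.
Proof.
move=> sX sY sY' sZ; rewrite curvature_skew//; last exact: smooth_vf_add.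
rewrite curvatureDl// opprD.
by congr (_ + _); apply/esym; exact: curvature_skew.
Qed.

Lemma curvatureZm p f X Y Z : sf p f -> sv p X -> sv p Y -> sv p Z ->
  K X (vf_scale f Y) Z p = f p *: K X Y Z p.
Proof.
move=> s1 sX sY sZ; rewrite curvature_skew//; last exact: smooth_vf_scale.
rewrite curvatureZl// -scalerN.
by congr (_ *: _); apply/esym; exact: curvature_skew.
Qed.

End Curvature.
End LeviCivita.

Lemma tensor_local p (T : vfield R M n -> R) X Y :
  (forall f X, sf p f -> sv p X -> T (vf_scale f X) = f p * T X) ->
  sv p X -> (\forall q \near p, X q = Y q) -> T X = T Y.
Proof.
move=> TZ sX nX; have [f [s1 f1 _ fP]] := near_indicator nX.
have E : vf_scale f X = vf_scale f Y.
  apply/funext => q; rewrite /vf_scale; have [->|/fP -> //] := eqVneq (f q) 0.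
  by rewrite !scale0r.
have sY : sv p Y := smooth_vf_eq nX sX.
by rewrite -[LHS]mul1r -[RHS]mul1r -f1 -!TZ// E.
Qed.

(** The expansion of X in coordinate fields holds on the chart domain only, hence the appeal to
    [tensor_local]. *)
Lemma tensor_eq0 p c (T : vfield R M n -> R) X : max_atlas A c -> cdom c p ->
  (forall X Y, sv p X -> sv p Y -> T (vf_add X Y) = T X + T Y) ->
  (forall f X, sf p f -> sv p X -> T (vf_scale f X) = f p * T X) ->
  (forall i, T (coord_vf A c i) = 0) -> sv p X -> T X = 0.
Proof.
move=> hc cp TD TZ T0 sX.
have sc i : sv p (vf_scale (vf_comp A c X i) (coord_vf A c i)).
  by apply: smooth_vf_scale; [exact: smooth_vf_comp|exact: smooth_coord_vf].
have S r : sv p (fun q => \sum_(i <- r) vf_comp A c X i q *: coord_vf A c i q) /\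
    T (fun q => \sum_(i <- r) vf_comp A c X i q *: coord_vf A c i q) = 0.
  elim: r => [|i r [IHs IH]].
    rewrite (_ : (fun q => _) = vf_scale (fun=> 0) X); last first.
      by apply/funext => q; rewrite big_nil /vf_scale scale0r.
    split; first by apply: smooth_vf_scale => //; exact: smooth_fun_cst.
    by rewrite TZ ?mul0r//; exact: smooth_fun_cst.
  rewrite (_ : (fun q => _) = vf_add (vf_scale (vf_comp A c X i) (coord_vf A c i))
     (fun q => \sum_(i <- r) vf_comp A c X i q *: coord_vf A c i q)); last first.
    by apply/funext => q; rewrite big_cons.
  split; first exact: smooth_vf_add.
  rewrite TD// IH addr0 TZ ?T0 ?mulr0//; first exact: smooth_vf_comp.
  exact: smooth_coord_vf.
have [sS S0] := S (index_enum 'I_n); rewrite -S0; apply: (tensor_local TZ) => //.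
by apply: filterS (near_cdom (max_chart hc) cp) => q cq; exact: vf_decomp.
Qed.

End Connections.

(** * Almost quasi-Sasakian structures *)

Section QuasiSasakian.
Context {R : realType} {M : topologicalType} {n : nat}.
Variable A : smooth_manifold R M n.
Variables (xi : vfield R M n) (eta : form1 R M n).
Variables (phi : endo_field R M n) (g : bil_field R M n).
Variable nabla : connection_op R M n.
Variables C psi : endo_field R M n.
Implicit Types (X Y Z W : vfield R M n) (f h : M -> R) (p q : M) (u v w : 'rV[R]_n).

Local Notation sv := (smooth_vf_at A).
Local Notation sf := (smooth_fun_at A).

(** Taken on vectors rather than fields, so that the algebra in one tangent space carries no
    smoothness conditions. *)
Definition metric p u v : R := (u *m g p *m v^T) 0 0.
Definition contact p u : R := (u *m eta p) 0 0.

Lemma app_bilE p X Y : app_bil g X Y p = metric p (X p) (Y p). Proof. by []. Qed.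

Lemma app_formE p X : app_form eta X p = contact p (X p). Proof. by []. Qed.

Lemma app_endoE p (F : endo_field R M n) X : app_endo F X p = X p *m F p. Proof. by []. Qed.

Lemma metricDl p u v w : metric p (u + v) w = metric p u w + metric p v w.
Proof. by rewrite /metric !mulmxDl mxE. Qed.

Lemma metricZl p (a : R) u v : metric p (a *: u) v = a * metric p u v.
Proof. by rewrite /metric -!scalemxAl mxE. Qed.

Lemma metricDr p u v w : metric p u (v + w) = metric p u v + metric p u w.
Proof. by rewrite /metric linearD mulmxDr mxE. Qed.

Lemma metricZr p (a : R) u v : metric p u (a *: v) = a * metric p u v.
Proof. by rewrite /metric linearZ -scalemxAr mxE. Qed.

Lemma metricNl p u v : metric p (- u) v = - metric p u v.
Proof. by rewrite -scaleN1r metricZl mulN1r. Qed.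

Lemma metricNr p u v : metric p u (- v) = - metric p u v.
Proof. by rewrite -scaleN1r metricZr mulN1r. Qed.

Lemma metric0l p v : metric p 0 v = 0.
Proof. by rewrite -(scale0r 0) metricZl mul0r. Qed.

Lemma metric0r p u : metric p u 0 = 0.
Proof. by rewrite -(scale0r 0) metricZr mul0r. Qed.

Lemma contactD p u v : contact p (u + v) = contact p u + contact p v.
Proof. by rewrite /contact mulmxDl mxE. Qed.

Lemma contactZ p (a : R) u : contact p (a *: u) = a * contact p u.
Proof. by rewrite /contact -scalemxAl mxE. Qed.

Lemma contactN p u : contact p (- u) = - contact p u.
Proof. by rewrite -scaleN1r contactZ mulN1r. Qed.

Lemma contact0 p : contact p 0 = 0.
Proof. by rewrite -(scale0r 0) contactZ mul0r. Qed.

Hypothesis hq : almost_quasi_sasakian A xi eta phi g.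

Lemma metricC p u v : metric p u v = metric p v u.
Proof.
case: hq => -[[_ gT _] _ _ _ _] _ _ _.
by rewrite /metric -[in LHS](trmxK (u *m g p *m v^T)) [LHS]mxE !trmx_mul trmxK gT mulmxA.
Qed.

Lemma metric_inj p u : (forall v, metric p u v = 0) -> u = 0.
Proof.
case: hq => -[[_ _ gU] _ _ _ _] _ _ _ H.
rewrite -[u](mulmxK (gU p)); suff -> : u *m g p = 0 by rewrite mul0mx.
apply/rowP => i; have := H (delta_mx 0 i).
by rewrite /metric trmx_delta -colE !mxE.
Qed.

Lemma phi_phi p v : v *m phi p *m phi p = - v + contact p v *: xi p.
Proof. by case: hq => -[_ _ h _ _] _ _ _; exact: h. Qed.

Lemma contact_xi p : contact p (xi p) = 1.
Proof. by case: hq => -[_ _ _ h _] _ _ _; exact: h. Qed.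

Lemma metric_phi2 p u v :
  metric p (u *m phi p) (v *m phi p) = metric p u v - contact p u * contact p v.
Proof. by case: hq => -[_ _ _ _ h] _ _ _; exact: h. Qed.

(** phi^2 xi = 0, so phi^2 (phi xi) = 0 as well and the formula for phi^2 shows phi xi = a xi; then
    a^2 = 0. *)
Lemma xi_phi p : xi p *m phi p = 0.
Proof.
have E0 : xi p *m phi p *m phi p = 0.
  by rewrite phi_phi contact_xi scale1r addNr.
have [a E] : exists a, xi p *m phi p = a *: xi p.
  exists (contact p (xi p *m phi p)).
  by apply/eqP; rewrite eq_sym -subr_eq0 addrC -phi_phi E0 mul0mx.
have : contact p (xi p *m phi p *m phi p) = 0 by rewrite E0 contact0.
rewrite E -scalemxAl E scalerA contactZ contact_xi mulr1 => /eqP.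
by rewrite mulf_eq0 orbb => /eqP ->; rewrite scale0r.
Qed.

(** phi^3 v is computed in two ways, as phi^2 of phi v and as phi of phi^2 v; they differ by eta(phi
    v) xi. *)
Lemma contact_phi p v : contact p (v *m phi p) = 0.
Proof.
have := phi_phi p (v *m phi p).
rewrite (phi_phi p v) mulmxDl mulNmx -scalemxAl xi_phi scaler0 addr0.
move=> /eqP; rewrite -subr_eq0 opprD addrA opprK addNr sub0r oppr_eq0 => /eqP H.
by have := congr1 (contact p) H; rewrite contactZ contact_xi mulr1 contact0.
Qed.

Lemma metric_xi p u : metric p u (xi p) = contact p u.
Proof.
have := metric_phi2 p u (xi p); rewrite xi_phi metric0r contact_xi mulr1.
by move/eqP; rewrite eq_sym subr_eq0 => /eqP.
Qed.

Lemma metric_phi p u v : metric p (u *m phi p) v = - metric p u (v *m phi p).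
Proof.
have := metric_phi2 p u (v *m phi p).
rewrite phi_phi contact_phi mulr0 subr0 metricDr metricZr metric_xi contact_phi mulr0 addr0.
by rewrite metricNr => <-; rewrite opprK.
Qed.

Lemma smooth_xi p : sv p xi.
Proof. by case: hq => -[_ [h _] _ _ _] _ _ _; exact: h. Qed.

Lemma smooth_contact p X : sv p X -> sf p (app_form eta X).
Proof. by case: hq => -[_ [_ [h _]] _ _ _] _ _ _; exact: h. Qed.

Lemma smooth_phi p X : sv p X -> sv p (app_endo phi X).
Proof. by case: hq => -[_ [_ [_ h]] _ _ _] _ _ _; exact: h. Qed.

Lemma smooth_metric p X Y : sv p X -> sv p Y -> sf p (app_bil g X Y).
Proof. by case: hq => -[[h _ _] _ _ _ _] _ _ _; exact: h. Qed.

Local Opaque lie vf_der.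

Hypothesis hl : levi_civita A g nabla.
Let hn := lc_connection hl.

Lemma lie_xi_contact p Y : sv p Y ->
  vf_der A xi (app_form eta Y) p = contact p (lie A xi Y p).
Proof.
move=> sY; case: hq => _ _ _ /(_ p Y sY).
rewrite /dform1 (_ : app_form eta xi = fun=> 1); last first.
  by apply/funext => q; exact: contact_xi.
rewrite vf_der_cst subr0 => /eqP; rewrite mulf_eq0 invr_eq0 pnatr_eq0 /= subr_eq0.
by move=> /eqP.
Qed.

Lemma dform1_0l p Y : sv p Y -> dform1 A eta (@vf_zero R M n) Y p = 0.
Proof.
move=> sY; rewrite /dform1 (_ : app_form eta (@vf_zero R M n) = fun=> 0); last first.
  by apply/funext => q; rewrite /app_form mul0mx mxE.
rewrite app_formE (lie0l hl)//.
by rewrite contact0 vf_der_cst vf_der_vf_zero !subr0 mulr0.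
Qed.

Lemma nijenhuis_tildeE p X Y : nijenhuis_tilde A xi eta phi X Y p =
  lie A (app_endo phi X) (app_endo phi Y) p + lie A X Y p *m phi p *m phi p
  - lie A (app_endo phi X) Y p *m phi p - lie A X (app_endo phi Y) p *m phi p
  + (2 * dform1 A eta (app_endo phi X) (app_endo phi Y) p) *: xi p.
Proof. by []. Qed.

(** With phi xi = 0, the condition on (xi, Z) reduces to phi(phi [xi, Z] - [xi, phi Z]) = 0. The
    vector in parentheses is also killed by eta, and phi is injective on ker eta. *)
Lemma lie_xi_phi p Z : sv p Z ->
  lie A xi Z p *m phi p = lie A xi (app_endo phi Z) p.
Proof.
move=> sZ; have sF := smooth_phi sZ.
case: hq => _ _ /(_ p xi Z (smooth_xi p) sZ) + _.
rewrite nijenhuis_tildeE (_ : app_endo phi xi = @vf_zero R M n); last first.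
  by apply/funext => q; exact: xi_phi.
rewrite dform1_0l// mulr0 scale0r addr0.
rewrite (lie0l hl)// add0r (lie0l hl)// mul0mx subr0 => H.
have {}H : (lie A xi Z p *m phi p - lie A xi (app_endo phi Z) p) *m phi p = 0.
  by rewrite mulmxBl.
have E : contact p (lie A xi Z p *m phi p - lie A xi (app_endo phi Z) p) = 0.
  rewrite contactD contactN contact_phi -lie_xi_contact// (_ : app_form eta _ = fun=> 0).
    by rewrite vf_der_cst subr0.
  by apply/funext => q; exact: contact_phi.
have := phi_phi p (lie A xi Z p *m phi p - lie A xi (app_endo phi Z) p).
rewrite H mul0mx E scale0r addr0 => /esym/eqP.
by rewrite oppr_eq0 subr_eq0 => /eqP.
Qed.

Lemma dform2_fundamentalE p X Y Z : dform2 A (fundamental_form phi g) X Y Z p = 3^-1 *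
  (vf_der A X (app_bil g Y (app_endo phi Z)) p - vf_der A Y (fundamental_form phi g X Z) p
   + vf_der A Z (fundamental_form phi g X Y) p - metric p (lie A X Y p) (Z p *m phi p)
   + metric p (lie A X Z p) (Y p *m phi p) - metric p (lie A Y Z p) (X p *m phi p)).
Proof. by []. Qed.

(** Omega(xi, .) = 0 leaves L_xi Omega = 0; skewness of phi and L_xi phi = 0 then move phi inside
    the second bracket. *)
Lemma lie_xi_metric_phi p Y Z : sv p Y -> sv p Z ->
  vf_der A xi (app_bil g Y (app_endo phi Z)) p =
  metric p (lie A xi Y p) (Z p *m phi p) + metric p (Y p) (lie A xi (app_endo phi Z) p).
Proof.
move=> sY sZ; case: hq => _ /(_ p xi Y Z (smooth_xi p) sY sZ) + _ _.
rewrite dform2_fundamentalE => /eqP; rewrite mulf_eq0 invr_eq0 pnatr_eq0 /=.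
have F0 W : fundamental_form phi g xi W = fun=> 0.
  apply/funext => q; rewrite /fundamental_form -[LHS]/(metric q (xi q) (W q *m phi q)).
  by rewrite metricC metric_xi contact_phi.
rewrite !F0 !vf_der_cst subr0 addr0.
move=> /eqP.
have := metric_phi p (lie A xi Z p) (Y p); rewrite lie_xi_phi//.
have E0 : metric p (lie A Y Z p) (xi p *m phi p) = 0 by rewrite xi_phi metric0r.
have alg (a b c d e z : R) : z = 0 -> e = d -> e = - c -> a - b + c - z = 0 -> a = b + d.
  by move=> -> <- ->; lra.
exact: alg E0 (metricC _ _ _).
Qed.

(** W = - phi^2 W + eta(W) xi: the first part is the previous lemma at phi W, the second uses g(Y,
    xi) = eta(Y) and L_xi eta = 0. *)
Lemma killing p Y W : sv p Y -> sv p W ->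
  vf_der A xi (app_bil g Y W) p =
  metric p (lie A xi Y p) (W p) + metric p (Y p) (lie A xi W p).
Proof.
move=> sY sW; have sx := smooth_xi p.
have sV := smooth_phi sW; have sV2 := smooth_phi sV.
have sm := smooth_contact sW; have sm' := smooth_contact sY.
have EW : W = vf_add (vf_opp (app_endo phi (app_endo phi W))) (vf_scale (app_form eta W) xi).
  apply/funext => q; rewrite /vf_add /vf_opp /vf_scale /app_endo phi_phi opprD opprK.
  by rewrite subrK.
have Eg : app_bil g Y W = fun q => (-1) * app_bil g Y (app_endo phi (app_endo phi W)) q
    + app_form eta W q * app_form eta Y q.
  apply/funext => q; rewrite {1}EW -[LHS]/(metric q (Y q) (- (W q *m phi q *m phi q) + contact q (W q) *: xi q)).
  by rewrite metricDr metricNr metricZr metric_xi mulN1r.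
have s1 : sf p (app_bil g Y (app_endo phi (app_endo phi W))) by exact: smooth_metric.
have sc : sf p (fun=> -1 : R) by exact: smooth_fun_cst.
have El : lie A xi W p = - lie A xi (app_endo phi (app_endo phi W)) p
    + vf_der A xi (app_form eta W) p *: xi p.
  rewrite {1}EW (lieDr hl)//; [|exact: smooth_vf_opp|exact: smooth_vf_scale].
  rewrite (lieZr hl)// vf_oppE (lieZr hl)// vf_der_cst scale0r add0r scaleN1r.
  by rewrite lie_self scaler0 addr0.
have E1 : vf_der A xi (app_bil g Y W) p =
    - vf_der A xi (app_bil g Y (app_endo phi (app_endo phi W))) p +
    (vf_der A xi (app_form eta W) p * contact p (Y p) +
     contact p (W p) * contact p (lie A xi Y p)).
  rewrite Eg vf_derD//; [|exact: smooth_funM|exact: smooth_funM].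
  by rewrite !vf_derM// vf_der_cst mul0r add0r mulN1r (lie_xi_contact sY).
have E2 : metric p (Y p) (lie A xi W p) =
    - metric p (Y p) (lie A xi (app_endo phi (app_endo phi W)) p) +
    vf_der A xi (app_form eta W) p * contact p (Y p).
  by rewrite El metricDr metricNr metricZr metric_xi.
have E3 : metric p (lie A xi Y p) (W p) =
    - metric p (lie A xi Y p) (W p *m phi p *m phi p) + contact p (W p) * contact p (lie A xi Y p).
  have EW' : W p = - (W p *m phi p *m phi p) + contact p (W p) *: xi p.
    by rewrite phi_phi opprD opprK subrK.
  by rewrite {1}EW' metricDr metricNr metricZr metric_xi.
have alg (v u a b d y w ly m l : R) : v = - u + (d * y + w * ly) -> u = m + l ->
    b = - l + d * y -> a = - m + w * ly -> v = a + b.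
  by move=> -> -> -> ->; ring.
exact: alg E1 (lie_xi_metric_phi sY sV) E2 E3.
Qed.

Hypothesis hC : is_C A xi g C.
Hypothesis hpsi : is_psi A eta g psi.

Lemma C0 p : C p = 0.
Proof.
apply/row_matrixP => i; rewrite rowE row0; apply: (@metric_inj p) => v.
have [X sX EX] := exists_extension A p (delta_mx 0 i).
have [Y sY EY] := exists_extension A p v.
have := hC sX sY; rewrite app_bilE app_endoE EX EY => ->.
have alg (a b c : R) : c = a + b -> 2^-1 * (c - a - b) = 0 by move=> ->; ring.
exact: alg (killing sX sY).
Qed.

Lemma metric_compat p X Y Z : sv p X -> sv p Y -> sv p Z ->
  vf_der A X (app_bil g Y Z) p = metric p (nabla X Y p) (Z p) + metric p (Y p) (nabla X Z p).
Proof. exact: (lc_metric hl). Qed.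

Lemma app_form_xi X : app_form eta X = app_bil g X xi.
Proof. by apply/funext => q; rewrite -[RHS]/(metric q (X q) (xi q)) metric_xi. Qed.

Lemma nabla_xi_skew p X Y : sv p X -> sv p Y ->
  metric p (nabla X xi p) (Y p) = - metric p (X p) (nabla Y xi p).
Proof.
move=> sX sY; have sx := smooth_xi p.
have := killing sX sY; rewrite (metric_compat sx sX sY) (lieE hl sx sX) (lieE hl sx sY).
rewrite metricDl metricDr metricNl metricNr => /eqP.
rewrite -subr_eq0 => /eqP H; apply/eqP; rewrite -subr_eq0 opprK; apply/eqP.
by rewrite -[RHS]H; ring.
Qed.

(** d eta(X, Y) is half of g(nabla_X xi, Y) - g(X, nabla_Y xi), and these two terms contribute
    equally by [nabla_xi_skew]. *)
Lemma psiE p X : sv p X -> X p *m psi p = nabla X xi p.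
Proof.
move=> sX; have sx := smooth_xi p; apply/eqP; rewrite -subr_eq0; apply/eqP.
apply: (@metric_inj p) => v; have [Y sY <-] := exists_extension A p v.
rewrite metricDl metricNl.
have := hpsi sX sY; rewrite app_bilE app_endoE => <-.
rewrite /dform1 !app_form_xi (metric_compat sX sY sx) (metric_compat sY sX sx).
rewrite app_bilE (lieE hl sX sY).
rewrite metricDl metricNl [metric p (Y p) _]metricC (nabla_xi_skew sX sY).
by field.
Qed.

Lemma psi_skew p u v : metric p (u *m psi p) v = - metric p u (v *m psi p).
Proof.
have [X sX <-] := exists_extension A p u; have [Y sY <-] := exists_extension A p v.
by rewrite !psiE// nabla_xi_skew.
Qed.

Lemma psi_dform1 p X Y : sv p X -> sv p Y -> dform1 A eta X Y p = metric p (X p *m psi p) (Y p).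
Proof. exact: hpsi. Qed.

Lemma xi_psi p : xi p *m psi p = 0.
Proof.
apply: (@metric_inj p) => v; have [Y sY <-] := exists_extension A p v.
by rewrite -psi_dform1//; [case: hq => _ _ _; apply|exact: smooth_xi].
Qed.

Lemma contact_psi p u : contact p (u *m psi p) = 0.
Proof. by rewrite -metric_xi psi_skew xi_psi metric0r oppr0. Qed.

Lemma smooth_psi p X : sv p X -> sv p (app_endo psi X).
Proof.
move=> sX; apply: (@smooth_vf_eq _ _ _ A p (nabla X xi)).
  by apply: filterS (smooth_vf_near sX) => q sq; rewrite -psiE.
by apply: (smooth_conn hn) => //; exact: smooth_xi.
Qed.

Definition nablaN : connection_op R M n :=
  canonical_connection A xi eta nabla C psi (fun p => 2 *: psi p).

Lemma cov_etaE p X Y : sv p X -> sv p Y -> cov_eta A eta nabla X Y p = metric p (X p *m psi p) (Y p).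
Proof.
move=> sX sY; have sx := smooth_xi p; rewrite /cov_eta !app_form_xi (metric_compat sX sY sx).
by rewrite addrAC subrr add0r psiE// metricC.
Qed.

(** The derivative of eta along xi drops out as psi xi = 0, and C + psi - N = - psi accounts for the
    sign of the last term. *)
Lemma nablaNE p X Y : sv p X -> sv p Y ->
  nablaN X Y p = nabla X Y p + metric p (X p *m psi p) (Y p) *: xi p
    - contact p (Y p) *: (X p *m psi p) + contact p (X p) *: (Y p *m psi p).
Proof.
move=> sX sY; have sx := smooth_xi p; rewrite /nablaN /canonical_connection.
rewrite !cov_etaE// xi_psi metric0l mulr0 scale0r subr0 C0 add0r -psiE//.
rewrite !app_formE.
rewrite (_ : psi p - 2 *: psi p = - psi p) ?mulmxN ?scalerN ?opprK//.
by rewrite scaler_nat mulr2n opprD addrA subrr add0r.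
Qed.

Lemma nablaN_connection : is_connection A nablaN.
Proof.
split.
- move=> p X Y sX sY; have sx := smooth_xi p.
  pose V := vf_add (vf_add (vf_add (nabla X Y) (vf_scale (app_bil g (app_endo psi X) Y) xi))
    (vf_opp (vf_scale (app_form eta Y) (app_endo psi X)))) (vf_scale (app_form eta X) (app_endo psi Y)).
  apply: (@smooth_vf_eq _ _ _ A p V).
    apply: filterS2 (smooth_vf_near sX) (smooth_vf_near sY) => q sX' sY'.
    exact: esym (nablaNE sX' sY').
  apply: smooth_vf_add; last by apply: smooth_vf_scale; [exact: smooth_contact|exact: smooth_psi].
  apply: smooth_vf_add.
    apply: smooth_vf_add; first exact: (smooth_conn hn).
    by apply: smooth_vf_scale => //; apply: smooth_metric => //; exact: smooth_psi.
  by apply/smooth_vf_opp/smooth_vf_scale; [exact: smooth_contact|exact: smooth_psi].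
- move=> p X X' Y sX sX' sY.
  apply: etrans (nablaNE (smooth_vf_add sX sX') sY) _.
  apply: etrans (esym (congr2 +%R (nablaNE sX sY) (nablaNE sX' sY))).
  rewrite (connDl hn)// /vf_add mulmxDl metricDl contactD.
  have alg (a a' u u' x y : 'rV[R]_n) (s s' e c c' : R) :
      (a + a') + (s + s') *: x - e *: (u + u') + (c + c') *: y =
      (a + s *: x - e *: u + c *: y) + (a' + s' *: x - e *: u' + c' *: y).
    by apply/rowP => i; rewrite !mxE; ring.
  exact: alg.
- move=> p f X Y s1 sX sY.
  apply: etrans (nablaNE (smooth_vf_scale s1 sX) sY) _.
  apply: etrans (esym (congr1 ( *:%R (f p)) (nablaNE sX sY))).
  rewrite (connZl hn)// /vf_scale -scalemxAl metricZl contactZ.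
  have alg (a u x y : 'rV[R]_n) (h s e c : R) :
      h *: a + (h * s) *: x - e *: (h *: u) + (h * c) *: y =
      h *: (a + s *: x - e *: u + c *: y).
    by apply/rowP => i; rewrite !mxE; ring.
  exact: alg.
- move=> p X Y Y' sX sY sY'.
  apply: etrans (nablaNE sX (smooth_vf_add sY sY')) _.
  apply: etrans (esym (congr2 +%R (nablaNE sX sY) (nablaNE sX sY'))).
  rewrite (connDr hn)// /vf_add mulmxDl metricDr contactD.
  have alg (a a' u y y' x : 'rV[R]_n) (s s' e e' c : R) :
      (a + a') + (s + s') *: x - (e + e') *: u + c *: (y + y') =
      (a + s *: x - e *: u + c *: y) + (a' + s' *: x - e' *: u + c *: y').
    by apply/rowP => i; rewrite !mxE; ring.
  exact: alg.
- move=> p f X Y s1 sX sY.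
  apply: etrans (nablaNE sX (smooth_vf_scale s1 sY)) _.
  apply: etrans (esym (congr1 (fun t => _ + f p *: t) (nablaNE sX sY))).
  rewrite (connZr hn)// /vf_scale -scalemxAl metricZr contactZ.
  have alg (z a u x y : 'rV[R]_n) (h s e c d : R) :
      (d *: z + h *: a) + (h * s) *: x - (h * e) *: u + c *: (h *: y) =
      d *: z + h *: (a + s *: x - e *: u + c *: y).
    by apply/rowP => i; rewrite !mxE; ring.
  exact: alg.
Qed.

Lemma nablaN_metric p X Y Z : sv p X -> sv p Y -> sv p Z ->
  vf_der A X (app_bil g Y Z) p = metric p (nablaN X Y p) (Z p) + metric p (Y p) (nablaN X Z p).
Proof.
move=> sX sY sZ; apply: etrans (metric_compat sX sY sZ) _.
have H u v w (a b : 'rV[R]_n) : metric p a w + metric p v b =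
    metric p (a + metric p (u *m psi p) v *: xi p - contact p v *: (u *m psi p)
       + contact p u *: (v *m psi p)) w +
    metric p v (b + metric p (u *m psi p) w *: xi p - contact p w *: (u *m psi p)
       + contact p u *: (w *m psi p)).
  rewrite !metricDl !metricDr !metricNl !metricNr !metricZl !metricZr metric_xi.
  rewrite (metricC p (xi p)) metric_xi (metricC p v (u *m psi p)) (psi_skew p v w).
  ring.
rewrite (nablaNE sX sY) (nablaNE sX sZ); exact: H.
Qed.

Lemma nablaN_xi p X : sv p X -> nablaN X xi p = 0.
Proof.
move=> sX; apply: etrans (nablaNE sX (smooth_xi p)) _.
by rewrite xi_psi -psiE// metric_xi contact_psi contact_xi scale0r scale1r scaler0 !addr0 subrr.
Qed.

Definition torsion_tensor p u v : 'rV[R]_n :=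
  (2 * metric p (u *m psi p) v) *: xi p + (2 * contact p u) *: (v *m psi p)
  - (2 * contact p v) *: (u *m psi p).

Lemma nablaN_torsion p X Y : sv p X -> sv p Y ->
  torsion A nablaN X Y p = torsion_tensor p (X p) (Y p).
Proof.
move=> sX sY; rewrite /torsion (nablaNE sX sY) (nablaNE sY sX) (lieE hl sX sY).
rewrite /torsion_tensor (psi_skew p (Y p)) (metricC p (Y p)).
have alg (a b x u v : 'rV[R]_n) (s c e : R) :
    a + s *: x - e *: u + c *: v - (b + (- s) *: x - c *: v + e *: u) - (a - b) =
    (2 * s) *: x + (2 * c) *: v - (2 * e) *: u.
  by apply/rowP => i; rewrite !mxE; ring.
exact: alg.
Qed.

End QuasiSasakian.

(** For row vectors the hypothesis says that E maps into the kernel of v. A trace only sees the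
    image, by cyclicity applied to a basis of that kernel. *)
Lemma tr_restrictmx (F : fieldType) n (v : 'cV[F]_n) (E : 'M[F]_n) :
  E *m v = 0 -> \tr (restrictmx (kermx v) E) = \tr E.
Proof.
move=> /sub_kermxP sE; rewrite /conjmx -mulmxA mxtrace_mulC mulmxKpV//.
by rewrite eq_row_base.
Qed.

(** * Curvature under parallel torsion *)

Section ParallelTorsion.
Context {R : realType} {M : topologicalType} {n : nat}.
Variable A : smooth_manifold R M n.
Variables (xi : vfield R M n) (eta : form1 R M n).
Variables (phi : endo_field R M n) (g : bil_field R M n).
Variable nabla : connection_op R M n.
Variables C psi : endo_field R M n.
Implicit Types (X Y Z W : vfield R M n) (f h : M -> R) (p q : M) (u v w : 'rV[R]_n).

Local Notation sv := (smooth_vf_at A).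
Local Notation sf := (smooth_fun_at A).
Local Notation metric := (metric g).
Local Notation contact := (contact eta).
Local Notation S := (torsion_tensor xi eta g psi).

Hypothesis hq : almost_quasi_sasakian A xi eta phi g.
Hypothesis hl : levi_civita A g nabla.
Hypothesis hC : is_C A xi g C.
Hypothesis hpsi : is_psi A eta g psi.

(* The connection and the bracket are kept opaque through equations, so that
   unification never unfolds them. *)
Variable D : connection_op R M n.
Hypothesis ED : D = nablaN A xi eta nabla C psi.
Variable br : vfield R M n -> vfield R M n -> vfield R M n.
Hypothesis Ebr : br = lie A.
Hypothesis hpar : parallel_torsion A g D.

Let hD : is_connection A D.
Proof. by rewrite ED; exact: (nablaN_connection hq hl hC hpsi). Qed.

Let D_metric p X Y Z : sv p X -> sv p Y -> sv p Z ->
  vf_der A X (app_bil g Y Z) p = metric p (D X Y p) (Z p) + metric p (Y p) (D X Z p).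
Proof. by rewrite ED; exact: (nablaN_metric hq hl hC hpsi). Qed.

Let D_xi p X : sv p X -> D X xi p = 0.
Proof. by rewrite ED; exact: (nablaN_xi hq hl hC hpsi). Qed.

Let br_D p X Y : sv p X -> sv p Y -> br X Y p = D X Y p - D Y X p - S p (X p) (Y p).
Proof.
move=> sX sY; have := nablaN_torsion hq hl hC hpsi sX sY; rewrite /torsion -ED -Ebr => <-.
by rewrite opprB addrC subrK.
Qed.

Let sx p : sv p xi := smooth_xi hq p.
Let sD p X Y : sv p X -> sv p Y -> sv p (D X Y). Proof. exact: (smooth_conn hD). Qed.
Let sbr p X Y : sv p X -> sv p Y -> sv p (br X Y).
Proof. by rewrite Ebr; exact: (smooth_lie hl). Qed.
Let spsi p X : sv p X -> sv p (app_endo psi X). Proof. exact: (smooth_psi hq hl hpsi). Qed.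
Let psiC p u v : metric p (u *m psi p) v = - metric p u (v *m psi p).
Proof. exact: (psi_skew hq hl hpsi). Qed.
Let xipsi p : xi p *m psi p = 0. Proof. exact: (xi_psi hq hpsi). Qed.
Let etapsi p u : contact p (u *m psi p) = 0. Proof. exact: (contact_psi hq hl hpsi). Qed.

Lemma metric_ext p u v : (forall w, metric p u w = metric p v w) -> u = v.
Proof.
move=> H; apply/eqP; rewrite -subr_eq0; apply/eqP; apply: (metric_inj hq (p := p)) => w.
by rewrite metricDl metricNl H subrr.
Qed.

Definition torsion_field X Y : vfield R M n := fun q => S q (X q) (Y q).

Lemma smooth_torsion_field p X Y : sv p X -> sv p Y -> sv p (torsion_field X Y).
Proof.
move=> sX sY.
pose V := vf_add (vf_add (vf_scale (fun q => 2 * app_bil g (app_endo psi X) Y q) xi)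
  (vf_scale (fun q => 2 * app_form eta X q) (app_endo psi Y)))
  (vf_opp (vf_scale (fun q => 2 * app_form eta Y q) (app_endo psi X))).
rewrite -[torsion_field X Y]/V.
apply: smooth_vf_add; first apply: smooth_vf_add; last apply: smooth_vf_opp.
- apply: smooth_vf_scale => //; apply: smooth_funM; first exact: smooth_fun_cst.
  by apply: (smooth_metric hq) => //; exact: spsi.
- apply: smooth_vf_scale; last exact: spsi.
  by apply: smooth_funM; [exact: smooth_fun_cst|exact: (smooth_contact hq)].
- apply: smooth_vf_scale; last exact: spsi.
  by apply: smooth_funM; [exact: smooth_fun_cst|exact: (smooth_contact hq)].
Qed.

(** The hypothesis concerns the lowered torsion; D being metric and g nondegenerate, the index can
    be raised. *)
Lemma parallel_torsion_field p W X Y : sv p W -> sv p X -> sv p Y ->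
  D W (torsion_field X Y) p = S p (D W X p) (Y p) + S p (X p) (D W Y p).
Proof.
move=> sW sX sY; have sS := smooth_torsion_field sX sY.
have T U V q : sv q U -> sv q V -> torsion A D U V q = S q (U q) (V q).
  by rewrite ED; exact: (nablaN_torsion hq hl hC hpsi).
apply: (@metric_ext p) => w; have [Z sZ <-] := exists_extension A p w.
have := hpar sW sX sY sZ; rewrite /lower_torsion.
have -> : vf_der A W (app_bil g (torsion A D X Y) Z) p = vf_der A W (app_bil g (torsion_field X Y) Z) p.
  apply: vf_der_eq; apply: filterS2 (smooth_vf_near sX) (smooth_vf_near sY) => q sX' sY'.
  by rewrite /app_bil T.
rewrite (D_metric sW sS sZ) metricDl.
rewrite {1 2 3}/app_bil (T _ _ _ (sD sW sX) sY) (T _ _ _ sX (sD sW sY)) (T _ _ _ sX sY).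
have alg (a b c d : R) : a + b - c - d - b = 0 -> a = c + d by lra.
exact: alg.
Qed.

Lemma torsion_xi p v : S p (xi p) v = 2 *: (v *m psi p).
Proof.
rewrite /torsion_tensor xipsi metric0l (contact_xi hq) mulr0 scale0r add0r mulr1 scaler0.
by rewrite subr0.
Qed.

Lemma torsion_skew p u v : S p u v = - S p v u.
Proof.
rewrite /torsion_tensor (psiC p v) (metricC hq p v).
by apply/rowP => i; rewrite !mxE; ring.
Qed.

Lemma torsion0l p v : S p 0 v = 0.
Proof.
by rewrite /torsion_tensor mul0mx metric0l contact0 !mulr0 !scale0r scaler0 !add0r oppr0.
Qed.

Lemma torsionDZl p (a : R) u u' v : S p (u + a *: u') v = S p u v + a *: S p u' v.
Proof.
rewrite /torsion_tensor mulmxDl -scalemxAl metricDl metricZl contactD contactZ.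
by apply/rowP => i; rewrite !mxE; ring.
Qed.

Lemma torsionDZr p (a : R) u v v' : S p u (v + a *: v') = S p u v + a *: S p u v'.
Proof. by rewrite torsion_skew torsionDZl opprD -scalerN -!torsion_skew. Qed.

Lemma parallel_psi p W Y : sv p W -> sv p Y -> D W (app_endo psi Y) p = D W Y p *m psi p.
Proof.
move=> sW sY; have := parallel_torsion_field sW (sx p) sY.
rewrite D_xi// torsion0l add0r torsion_xi.
have -> : torsion_field xi Y = vf_scale (fun=> 2) (app_endo psi Y).
  by apply/funext => q; rewrite /torsion_field torsion_xi.
rewrite (connZr hD) ?vf_der_cst ?scale0r ?add0r//; [|exact: smooth_fun_cst|exact: spsi].
by apply: scalerI; rewrite pnatr_eq0.
Qed.

Lemma D_xi_br p U : sv p U -> D xi U p = br xi U p + 2 *: (U p *m psi p).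
Proof.
move=> sU; rewrite br_D// (D_xi sU) subr0 torsion_xi.
by rewrite subrK.
Qed.

Local Notation K := (curvature A D).

Lemma curvature_br p X Y Z :
  K X Y Z p = D X (D Y Z) p - D Y (D X Z) p - D (br X Y) Z p.
Proof. by rewrite Ebr. Qed.

Lemma br_jacobi p X Y Z : sv p X -> sv p Y -> sv p Z ->
  br X (br Y Z) p - br Y (br X Z) p + br Z (br X Y) p = 0.
Proof. by rewrite Ebr; exact: (jacobi hl). Qed.

Lemma brDr p X Y Z : sv p X -> sv p Y -> sv p Z ->
  br X (vf_add Y Z) p = br X Y p + br X Z p.
Proof. by rewrite Ebr; exact: (lieDr hl). Qed.

(** psi acts as a derivation of S. Together with the vanishing derivative of S along xi this encodes
    L_xi S = 0. *)
Lemma torsion_psi p u v :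
  S p (u *m psi p) v + S p u (v *m psi p) = S p u v *m psi p.
Proof.
rewrite /torsion_tensor !etapsi !mulr0 !scale0r addr0 subr0.
rewrite mulmxBl mulmxDl -!scalemxAl xipsi scaler0 add0r psiC.
by apply/rowP => i; rewrite !mxE; ring.
Qed.

(** In effect the first Bianchi identity of D with xi in one slot: K(Y, Z) xi vanishes, and so do
    the quadratic torsion terms, by [torsion_psi]. *)
Lemma curvature_xi_sym p Y Z : sv p Y -> sv p Z -> K xi Y Z p = K xi Z Y p.
Proof.
move=> sY sZ; have sX := sx p.
have sS := smooth_torsion_field sY sZ.
(* Derivatives along xi are traded for brackets; psi, being parallel, comes out of D_U. *)
have D2 U V : sv p U -> sv p V -> D U (D xi V) p = D U (br xi V) p + 2 *: (D U V p *m psi p).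
  move=> sU sV; have sV' := spsi sV; have sB := sbr sX sV.
  have c2 : sf p (fun=> 2 : R) by exact: smooth_fun_cst.
  rewrite -parallel_psi//.
  have -> : D U (D xi V) p = D U (vf_add (br xi V) (vf_scale (fun=> 2) (app_endo psi V))) p.
    apply: (conn_localr hD) => //; first exact: sD.
    by apply: filterS (smooth_vf_near sV) => q sV1; exact: D_xi_br.
  rewrite (connDr hD)//; last exact: smooth_vf_scale.
  by rewrite (connZr hD)// vf_der_cst scale0r add0r.
have sT : sv p (vf_add (br Y Z) (torsion_field Y Z)) by apply: smooth_vf_add => //; exact: sbr.
have ET q : sv q Y -> sv q Z -> D Y Z q - D Z Y q = vf_add (br Y Z) (torsion_field Y Z) q.
  by move=> sY1 sZ1; rewrite /vf_add br_D// subrK.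
have E1 : D xi (D Y Z) p - D xi (D Z Y) p = D xi (vf_add (br Y Z) (torsion_field Y Z)) p.
  have s1 := sD sY sZ; have s2 := sD sZ sY.
  rewrite -(connNr hD)// -(connDr hD)//; last exact: smooth_vf_opp.
  apply: (conn_localr hD) => //; first by apply: smooth_vf_add => //; exact: smooth_vf_opp.
  by apply: filterS2 (smooth_vf_near sY) (smooth_vf_near sZ) => q; exact: ET.
have E2 := D_xi_br sT.
have E3 := brDr sX (sbr sY sZ) sS.
have E4 := D_xi_br sS.
rewrite (parallel_torsion_field sX sY sZ) (D_xi_br sY) (D_xi_br sZ) in E4.
rewrite torsionDZl torsionDZr in E4.
have E5 := br_jacobi sX sY sZ.
have E6 := br_D sY (sbr sX sZ); have E7 := br_D sZ (sbr sX sY).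
rewrite (torsion_skew p (Z p)) in E7.
have E8 := torsion_psi p (Y p) (Z p).
have E9 := ET p sY sZ.
have E10 := D2 _ _ sY sZ; have E11 := D2 _ _ sZ sY.
rewrite !curvature_br.
have E9' : D Y Z p *m psi p - D Z Y p *m psi p = vf_add (br Y Z) (torsion_field Y Z) p *m psi p.
  by rewrite -mulmxBl E9.
have alg (xyz xzy yxz zxy a b c d e1 e2 t s0 s1 s2 sy sz j2 j3 yb zb yz zy : 'rV[R]_n) :
    xyz - xzy = d -> d = c + 2 *: t -> c = e1 + e2 ->
    s1 + 2 *: sy + (s2 + 2 *: sz) = e2 + 2 *: s0 ->
    e1 - j2 + j3 = 0 -> j2 = yb - b - s2 -> j3 = zb - a - - s1 -> sy + sz = s0 ->
    yz - zy = t -> yxz = yb + 2 *: yz -> zxy = zb + 2 *: zy ->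
    xyz - yxz - a = xzy - zxy - b.
  move=> H1 H2 H3 H4 H5 H6 H7 H8 H9 H10 H11; apply/rowP => i.
  have c0 (u v : 'rV[R]_n) : u = v -> u 0 i = v 0 i by move=> ->.
  move: (c0 _ _ H1) (c0 _ _ H2) (c0 _ _ H3) (c0 _ _ H4) (c0 _ _ H5) (c0 _ _ H6) (c0 _ _ H7).
  move: (c0 _ _ H8) (c0 _ _ H9) (c0 _ _ H10) (c0 _ _ H11).
  by rewrite !mxE; lra.
exact: alg E1 E2 E3 E4 E5 E6 E7 E8 E9' E10 E11.
Qed.

Lemma D_D_metric p X Y Z W : sv p X -> sv p Y -> sv p Z -> sv p W ->
  vf_der A X (vf_der A Y (app_bil g Z W)) p =
  metric p (D X (D Y Z) p) (W p) + metric p (D Y Z p) (D X W p) +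
  (metric p (D X Z p) (D Y W p) + metric p (Z p) (D X (D Y W) p)).
Proof.
move=> sX sY sZ sW; have s1 := sD sY sZ; have s2 := sD sY sW.
rewrite -(D_metric sX s1 sW) -(D_metric sX sZ s2).
rewrite -vf_derD; [|exact: (smooth_metric hq)|exact: (smooth_metric hq)].
apply: vf_der_eq; apply: filterS3 (smooth_vf_near sY) (smooth_vf_near sZ) (smooth_vf_near sW).
by move=> q *; exact: D_metric.
Qed.

(** The second derivatives of g(Z, W) along X and Y, expanded by metric compatibility, must commute
    up to [X, Y]. *)
Lemma curvature_metric_skew p X Y Z W : sv p X -> sv p Y -> sv p Z -> sv p W ->
  metric p (K X Y Z p) (W p) = - metric p (Z p) (K X Y W p).
Proof.
have alg (l xy yx a b c d a' d' e e' : R) : l = xy - yx -> l = e + e' ->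
    xy = a + b + (c + d) -> yx = a' + c + (b + d') -> a - a' - e = - (d - d' - e') by lra.
move=> sX sY sZ sW; have sg := smooth_metric hq sZ sW.
have E1 := vf_der_lie sX sY sg; rewrite -Ebr in E1.
have E2 := D_metric (sbr sX sY) sZ sW.
have E3 := D_D_metric sX sY sZ sW; have E4 := D_D_metric sY sX sZ sW.
rewrite !curvature_br !metricDl !metricNl !metricDr !metricNr.
exact: alg E1 E2 E3 E4.
Qed.

Lemma curvature_xi p Y Z : sv p Y -> sv p Z -> K xi Y Z p = 0.
Proof.
move=> sY sZ; have sX := sx p.
apply: (metric_inj hq (p := p)) => w; have [W sW <-] := exists_extension A p w.
(* A trilinear form that is symmetric in its first two and skew in its last two
   arguments vanishes. *)
pose a U V T := metric p (K xi U V p) (T p).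
have sym U V T : sv p U -> sv p V -> a U V T = a V U T.
  by move=> sU sV; rewrite /a curvature_xi_sym.
have skew U V T : sv p U -> sv p V -> sv p T -> a U V T = - a U T V.
  by move=> sU sV sT; rewrite /a curvature_metric_skew// (metricC hq).
rewrite -[LHS]/(a Y Z W).
have E : a Y Z W = - a Y Z W.
  rewrite {1}sym// skew// sym// skew// opprK sym// skew//.
by have := E; lra.
Qed.

Lemma curvature_r_xi p X Y : sv p X -> sv p Y -> K X Y xi p = 0.
Proof.
move=> sX sY; rewrite curvature_br (D_xi (sbr sX sY)) subr0.
rewrite !(conn_near0r hD) ?subr0//.
  by apply: filterS (smooth_vf_near sX) => q; exact: D_xi.
by apply: filterS (smooth_vf_near sY) => q; exact: D_xi.
Qed.

(** Asked at every point, so that [app_form eta X] is the zero function and its derivatives vanish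
    outright. *)
Definition horizontal X := forall q, contact q (X q) = 0.

Lemma horizontal_projP X : horizontal (projP xi eta X).
Proof.
move=> q; rewrite /projP contactD contactN /projQ contactZ (contact_xi hq).
by rewrite mulr1 app_formE subrr.
Qed.

Lemma smooth_projP p X : sv p X -> sv p (projP xi eta X).
Proof.
move=> sX; apply: (smooth_vf_add sX); apply: smooth_vf_opp; apply: smooth_vf_scale => //.
exact: (smooth_contact hq).
Qed.

Lemma contact_D p X Y : sv p X -> sv p Y -> horizontal Y -> contact p (D X Y p) = 0.
Proof.
move=> sX sY hY; have := D_metric sX sY (sx p); rewrite (D_xi sX) metric0r addr0 (metric_xi hq) => <-.
rewrite (_ : app_bil g Y xi = fun=> 0) ?vf_der_cst//.
by apply/funext => q; rewrite app_bilE (metric_xi hq).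
Qed.

(** On horizontal fields D differs from nabla by a multiple of xi, and D X Y is horizontal, so that
    multiple is exactly what the projection removes. *)
Lemma inner_connectionE p X Y : sv p X -> sv p Y -> horizontal X -> horizontal Y ->
  inner_connection xi eta nabla X Y p = D X Y p.
Proof.
move=> sX sY hX hY; have := contact_D sX sY hY.
have -> : D X Y p = nabla X Y p + metric p (X p *m psi p) (Y p) *: xi p.
  by rewrite ED (nablaNE hq hl hC hpsi sX sY) hX hY !scale0r subr0 addr0.
rewrite contactD contactZ (contact_xi hq) mulr1 => E.
rewrite /inner_connection /projP /projQ app_formE.
by move/eqP: E; rewrite addr_eq0 => /eqP ->; rewrite scaleNr opprK.
Qed.

Lemma smooth_inner_connection p X Y : sv p X -> sv p Y -> horizontal X -> horizontal Y ->
  sv p (inner_connection xi eta nabla X Y).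
Proof.
move=> sX sY hX hY; apply: smooth_vf_eq (sD sX sY).
apply: filterS2 (smooth_vf_near sX) (smooth_vf_near sY) => q sX' sY'.
by rewrite inner_connectionE.
Qed.

Lemma inner_inner p X Y Z : sv p X -> sv p Y -> sv p Z ->
  horizontal X -> horizontal Y -> horizontal Z ->
  inner_connection xi eta nabla X (inner_connection xi eta nabla Y Z) p = D X (D Y Z) p.
Proof.
move=> sX sY sZ hX hY hZ; have sI := smooth_inner_connection sY sZ hY hZ.
rewrite inner_connectionE//; last exact: horizontal_projP.
apply: (conn_localr hD) => //.
apply: filterS2 (smooth_vf_near sY) (smooth_vf_near sZ) => q sY' sZ'.
by rewrite inner_connectionE.
Qed.

Lemma contact_br p X Y : sv p X -> sv p Y -> horizontal X -> horizontal Y ->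
  contact p (br X Y p) = - (2 * metric p (X p *m psi p) (Y p)).
Proof.
move=> sX sY hX hY; rewrite -(psi_dform1 hpsi sX sY) /dform1.
have E Z : horizontal Z -> app_form eta Z = fun=> 0 by move=> hZ; apply/funext => q; exact: hZ.
rewrite (E _ hX) (E _ hY) !vf_der_cst app_formE -Ebr subr0 sub0r.
by field.
Qed.

Lemma schouten_br p X Y Z : schouten A xi eta nabla X Y Z p =
  inner_connection xi eta nabla X (inner_connection xi eta nabla Y Z) p
  - inner_connection xi eta nabla Y (inner_connection xi eta nabla X Z) p
  - inner_connection xi eta nabla (projP xi eta (br X Y)) Z p
  - projP xi eta (br (projQ xi eta (br X Y)) Z) p.
Proof. by rewrite Ebr. Qed.

(** The two tensors treat the vertical part of [X, Y] differently: K uses D_xi Z, the Schouten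
    tensor uses [xi, Z]. These differ by 2 psi Z, and the vertical component is -2 g(psi X, Y); the
    product gives the factor 4. *)
Lemma schoutenE p X Y Z : sv p X -> sv p Y -> sv p Z ->
  horizontal X -> horizontal Y -> horizontal Z ->
  schouten A xi eta nabla X Y Z p =
  K X Y Z p - (4 * metric p (X p *m psi p) (Y p)) *: (Z p *m psi p).
Proof.
move=> sX sY sZ hX hY hZ; have sB := sbr sX sY.
have sb : sf p (app_form eta (br X Y)) by exact: (smooth_contact hq).
have sQ : sv p (projQ xi eta (br X Y)) by exact: smooth_vf_scale.
have sP := smooth_projP sB.
rewrite schouten_br !inner_inner// inner_connectionE//; last exact: horizontal_projP.
have -> : D (projP xi eta (br X Y)) Z p = D (br X Y) Z p - contact p (br X Y p) *: D xi Z p.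
  rewrite -[projP _ _ _]/(vf_add (br X Y) (vf_opp (projQ xi eta (br X Y)))).
  rewrite (connDl hD)//; last exact: smooth_vf_opp.
  by rewrite (connNl hD)// (connZl hD).
have -> : projP xi eta (br (projQ xi eta (br X Y)) Z) p = contact p (br X Y p) *: br xi Z p.
  have E : br (projQ xi eta (br X Y)) Z p =
      contact p (br X Y p) *: br xi Z p - vf_der A Z (app_form eta (br X Y)) p *: xi p.
    by rewrite {1 4}Ebr; exact: (lieZl hl).
  have e0 : contact p (br xi Z p) = 0.
    rewrite Ebr -(lie_xi_contact hq sZ) (_ : app_form eta Z = fun=> 0) ?vf_der_cst//.
    by apply/funext => q; exact: hZ.
  rewrite /projP /projQ app_formE E contactD contactN !contactZ e0 mulr0 sub0r (contact_xi hq) mulr1.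
  by rewrite scaleNr opprK subrK.
rewrite curvature_br (D_xi_br sZ) (contact_br sX sY hX hY).
have alg (a b c d z : 'rV[R]_n) (s : R) :
    a - b - (c - (- (2 * s)) *: (d + 2 *: z)) - (- (2 * s)) *: d = a - b - c - (4 * s) *: z.
  by apply/rowP => i; rewrite !mxE; ring.
exact: alg.
Qed.

(** The right-hand side is the trace of the rank one map Y |-> g(u, Y) v, the form in which the
    correction enters the Ricci tensor. *)
Lemma metric_sum p u v : metric p u v = \sum_i metric p u (delta_mx 0 i) * v 0 i.
Proof.
have -> : metric p u v = \sum_i (u *m g p) 0 i * v 0 i.
  by rewrite /metric mxE; apply: eq_bigr => i _; rewrite [X in _ * X]mxE.
apply: eq_bigr => i _; congr (_ * _).
by rewrite /metric trmx_delta -colE [RHS]mxE.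
Qed.

Lemma projP_decomp X : X = vf_add (projP xi eta X) (vf_scale (app_form eta X) xi).
Proof. by apply/funext => q; rewrite /vf_add /projP /projQ /vf_scale subrK. Qed.

(** As K(X, xi) Z = 0, coordinate fields in the Ricci trace may be projected to D, where the
    comparison with the Schouten tensor is available. *)
Lemma curvature_projP p X Y Z : sv p X -> sv p Y -> sv p Z ->
  K X (projP xi eta Y) Z p = K X Y Z p.
Proof.
move=> sX sY sZ; have sP := smooth_projP sY; have se := smooth_contact hq sY.
have E := curvatureZm hl hD se sX (sx p) sZ.
rewrite [in RHS](projP_decomp Y); apply/esym.
apply: etrans (curvatureDm hl hD sX sP (smooth_vf_scale se (sx p)) sZ) _.
have E0 : K X xi Z p = 0.
  by rewrite (curvature_skew hl hD sX (sx p) sZ) curvature_xi// oppr0.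
have alg (a b c : 'rV[R]_n) (s : R) : b = s *: c -> c = 0 -> a + b = a.
  by move=> -> ->; rewrite scaler0 addr0.
exact: alg E E0.
Qed.

Lemma coord_vf_at p i : coord_vf A (chart_at A p) i p = delta_mx 0 i.
Proof.
by apply: diff_transition_id; [exact: max_chart (chart_at_max A p)|exact: chart_at_dom].
Qed.

Lemma smooth_coord_vf_at p i : sv p (coord_vf A (chart_at A p) i).
Proof. by apply: smooth_coord_vf; [exact: chart_at_max|exact: chart_at_dom]. Qed.

Lemma contact_curvature p X Y Z : sv p X -> sv p Y -> sv p Z -> contact p (K X Y Z p) = 0.
Proof.
move=> sX sY sZ.
have E := curvature_metric_skew sX sY sZ (sx p).
by rewrite (metric_xi hq) curvature_r_xi// metric0r oppr0 in E.
Qed.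

Lemma ricci_horizontal p X Z : sv p X -> sv p Z -> horizontal X -> horizontal Z ->
  ricci A D X Z p =
  ricci_wagner A xi eta nabla X Z p + 4 * metric p (X p *m psi p) (Z p *m psi p).
Proof.
move=> sX sZ hX hZ.
pose c := chart_at A p.
have sc i : sv p (coord_vf A c i) := smooth_coord_vf_at p i.
have E i : K X (coord_vf A c i) Z p =
    schouten A xi eta nabla X (projP xi eta (coord_vf A c i)) Z p
    + (4 * metric p (X p *m psi p) (delta_mx 0 i)) *: (Z p *m psi p).
  have sP := smooth_projP (sc i).
  rewrite (schoutenE sX sP sZ hX (@horizontal_projP _) hZ) (curvature_projP sX (sc i) sZ).
  rewrite /projP metricDr metricNr /projQ metricZr (metric_xi hq) etapsi mulr0 subr0.
  by rewrite coord_vf_at subrK.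
(* The Schouten tensor has values in D, so its trace over D is a trace over the whole tangent space
   and can be compared with that of K coordinate by coordinate. *)
rewrite /ricci_wagner tr_restrictmx; last first.
  apply/row_matrixP => i; rewrite row_mul row0 rowK.
  apply/rowP => j; rewrite ord1 [RHS]mxE.
  rewrite -[LHS]/(contact p (schouten A xi eta nabla X (projP xi eta (coord_vf A c i)) Z p)).
  have sP := smooth_projP (sc i).
  rewrite (schoutenE sX sP sZ hX (@horizontal_projP _) hZ) contactD contactN contactZ etapsi.
  by rewrite contact_curvature// mulr0 subr0.
rewrite /ricci /mxtrace (metric_sum p _ (Z p *m psi p)) mulr_sumr -big_split /=.
apply: eq_bigr => i _; rewrite /endo_at [LHS]mxE [X in _ = X + _]mxE -/c E [LHS]mxE.
by congr (_ + _); rewrite [LHS]mxE mulrA.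
Qed.

Lemma ricciE p X Z : ricci A D X Z p = \sum_i K X (coord_vf A (chart_at A p) i) Z p 0 i.
Proof. by apply: eq_bigr => i _; rewrite mxE. Qed.

Lemma ricciDl p X X' Z : sv p X -> sv p X' -> sv p Z ->
  ricci A D (vf_add X X') Z p = ricci A D X Z p + ricci A D X' Z p.
Proof.
move=> sX sX' sZ; rewrite !ricciE -big_split; apply: eq_bigr => i _.
by rewrite (curvatureDl hl hD sX sX' (smooth_coord_vf_at p i) sZ) mxE.
Qed.

Lemma ricciZl p f X Z : sf p f -> sv p X -> sv p Z ->
  ricci A D (vf_scale f X) Z p = f p * ricci A D X Z p.
Proof.
move=> s1 sX sZ; rewrite !ricciE mulr_sumr; apply: eq_bigr => i _.
by rewrite (curvatureZl hl hD s1 sX (smooth_coord_vf_at p i) sZ) mxE.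
Qed.

Lemma ricciDr p X Z Z' : sv p X -> sv p Z -> sv p Z' ->
  ricci A D X (vf_add Z Z') p = ricci A D X Z p + ricci A D X Z' p.
Proof.
move=> sX sZ sZ'; rewrite !ricciE -big_split; apply: eq_bigr => i _.
by rewrite (curvatureDr hl hD sX (smooth_coord_vf_at p i) sZ sZ') mxE.
Qed.

Lemma ricciZr p f X Z : sf p f -> sv p X -> sv p Z ->
  ricci A D X (vf_scale f Z) p = f p * ricci A D X Z p.
Proof.
move=> s1 sX sZ; rewrite !ricciE mulr_sumr; apply: eq_bigr => i _.
by rewrite (curvatureZr hl hD s1 sX (smooth_coord_vf_at p i) sZ) mxE.
Qed.

Lemma ricci_xil p Z : sv p Z -> ricci A D xi Z p = 0.
Proof.
move=> sZ; rewrite ricciE big1// => i _.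
by rewrite (curvature_xi (smooth_coord_vf_at p i) sZ) mxE.
Qed.

Lemma ricci_xir p X : sv p X -> ricci A D X xi p = 0.
Proof.
move=> sX; rewrite ricciE big1// => i _.
by rewrite (curvature_r_xi sX (smooth_coord_vf_at p i)) mxE.
Qed.

End ParallelTorsion.

(** * The Einstein condition in adapted frames *)

Section Theorem2.
Context {R : realType} {M : topologicalType} {k : nat}.
Variable A : smooth_manifold R M k.+1.
Variables (xi : vfield R M k.+1) (eta : form1 R M k.+1).
Variables (phi : endo_field R M k.+1) (g : bil_field R M k.+1).
Variable nabla : connection_op R M k.+1.
Variables C psi : endo_field R M k.+1.
Implicit Types (X Y Z W : vfield R M k.+1) (p q : M) (u v w : 'rV[R]_k.+1).
Implicit Types c : chart R M k.+1.

Local Notation sv := (smooth_vf_at A).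
Local Notation sf := (smooth_fun_at A).
Local Notation metric := (metric g).
Local Notation contact := (contact eta).
Local Notation frame := (adapted_frame A xi eta).

Hypothesis hq : almost_quasi_sasakian A xi eta phi g.

Lemma projP_xi p X : X p = xi p -> projP xi eta X p = 0.
Proof. by move=> E; rewrite /projP /projQ app_formE E (contact_xi hq) scale1r subrr. Qed.

Lemma ord_max_or_widen (i : 'I_k.+1) :
  i = ord_max \/ exists a : 'I_k, i = widen_ord (leqnSn k) a.
Proof.
have [ik|ki] := ltnP i k; [right; exists (Ordinal ik)|left]; apply: val_inj => //=.
by apply/eqP; rewrite eqn_leq ki -ltnS ltn_ord.
Qed.

Lemma smooth_frame c p a : max_atlas A c -> cdom c p -> sv p (frame c a).
Proof. by move=> hc cp; apply: (smooth_projP hq); exact: smooth_coord_vf. Qed.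

(** Coordinate fields are frame fields up to multiples of xi. The projection of the last one
    vanishes on the chart domain, so it is replaced by the zero field through [tensor_local]. *)
Lemma tensor_frame_eq0 c p (T : vfield R M k.+1 -> R) X : adapted_chart A xi c -> cdom c p ->
  (forall X Y, sv p X -> sv p Y -> T (vf_add X Y) = T X + T Y) ->
  (forall f X, sf p f -> sv p X -> T (vf_scale f X) = f p * T X) ->
  T xi = 0 -> (forall a, T (frame c a) = 0) -> sv p X -> T X = 0.
Proof.
move=> [hc cxi] cp TD TZ Txi Te sX; apply: (tensor_eq0 hc cp TD TZ _ sX) => i.
have si : sv p (coord_vf A c i) by exact: smooth_coord_vf.
have sP := smooth_projP hq si; have sx := smooth_xi hq p.
have se := smooth_contact hq si.
rewrite (projP_decomp xi eta (coord_vf A c i)) TD//; last exact: smooth_vf_scale.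
rewrite (TZ _ _ se sx) Txi mulr0 addr0.
have [Ei|[a ->]] := ord_max_or_widen i; last exact: Te.
rewrite (@tensor_local _ _ _ A p T _ (vf_scale (fun=> 0) xi) TZ sP).
  by rewrite (TZ _ _ (smooth_fun_cst A p 0) sx) mul0r.
apply: filterS (near_cdom (max_chart hc) cp) => q cq.
by rewrite Ei /vf_scale scale0r projP_xi// cxi.
Qed.

(** Projecting the coordinate expansion of v to D fixes v and kills the last term, which is a
    multiple of xi. *)
Lemma frame_span c p v : adapted_chart A xi c -> cdom c p -> contact p v = 0 ->
  (v <= \matrix_(d < k) frame c d p)%MS.
Proof.
move=> [hc cxi] cp v0; have [X sX EX] := exists_extension A p v.
have Ev : v = \sum_i vf_comp A c X i p *: projP xi eta (coord_vf A c i) p.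
  have E := vf_decomp X hc cp; rewrite EX in E.
  have -> : v = v - contact p v *: xi p by rewrite v0 scale0r subr0.
  rewrite {1 2}E /contact mulmx_suml summxE scaler_suml -sumrB; apply: eq_bigr => i _.
  by rewrite /projP /projQ scalerBr scalerA /app_form -scalemxAl [in LHS]mxE.
rewrite Ev big_ord_recr /= (projP_xi (cxi p cp)) scaler0 addr0.
apply: summx_sub => a _; apply: scalemx_sub.
by rewrite -[X in (X <= _)%MS](rowK (fun d => frame c d p)) row_sub.
Qed.

Hypothesis hl : levi_civita A g nabla.
Hypothesis hpsi : is_psi A eta g psi.

(** psi e_b lies in D, so [endo_comp] gives its coefficients in the frame and the sum is g(psi psi
    e_b, e_a); skewness of psi produces the sign. *)
Lemma sum_dform1_frame c p a b : adapted_chart A xi c -> cdom c p ->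
  \sum_(d < k) dform1 A eta (frame c d) (frame c a) p * endo_comp A xi eta c psi d b p =
  - metric p (frame c a p *m psi p) (frame c b p *m psi p).
Proof.
move=> hc cp; have hc' := hc.1.
set E := \matrix_(d < k) frame c d p.
have sE : (frame c b p *m psi p <= E)%MS.
  by apply: frame_span => //; exact: (contact_psi hq hl hpsi).
set B := psi p *m g p *m (frame c a p)^T.
have mB (u : 'rV[R]_k.+1) : metric p (u *m psi p) (frame c a p) = (u *m B) 0 0.
  by rewrite /B !mulmxA.
transitivity (metric p (frame c b p *m psi p *m psi p) (frame c a p)).
  have Ew : frame c b p *m psi p = \sum_(d < k) endo_comp A xi eta c psi d b p *: frame c d p.
    rewrite -[LHS](mulmxKpV sE) mulmx_sum_row; apply: eq_bigr => d _.
    by rewrite rowK.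
  rewrite mB {1}Ew mulmx_suml summxE; apply: eq_bigr => d _.
  rewrite (psi_dform1 hpsi (smooth_frame _ hc' cp) (smooth_frame _ hc' cp)) mB.
  by rewrite -scalemxAl [RHS]mxE mulrC.
by rewrite (psi_skew hq hl hpsi) (metricC hq).
Qed.

Hypothesis hC : is_C A xi g C.
Variable D : connection_op R M k.+1.
Hypothesis ED : D = nablaN A xi eta nabla C psi.
Hypothesis hpar : parallel_torsion A g D.

Lemma ricci_frame c p a b : adapted_chart A xi c -> cdom c p ->
  ricci A D (frame c a) (frame c b) p = ricci_wagner A xi eta nabla (frame c a) (frame c b) p
    - 4 * \sum_(d < k) dform1 A eta (frame c d) (frame c a) p * endo_comp A xi eta c psi d b p.
Proof.
move=> hc cp; rewrite sum_dform1_frame// mulrN opprK.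
apply: (ricci_horizontal hq hl hC hpsi ED erefl hpar);
  do ?[exact: (smooth_frame _ hc.1 cp)|exact: (horizontal_projP hq)].
Qed.

Lemma einstein_ricci0 : einstein A g D <->
  (forall p X Z, sv p X -> sv p Z -> ricci A D X Z p = 0).
Proof.
split=> [[lam H] p X Z sX sZ|H]; last by exists (fun=> 0) => p X Z sX sZ; rewrite mul0r H.
have sx := smooth_xi hq p.
have := H p xi xi sx sx.
rewrite (ricci_xil hq hl hC hpsi ED erefl hpar sx) app_bilE (metric_xi hq) (contact_xi hq) mulr1.
by rewrite H// => <-; rewrite mul0r.
Qed.

Lemma einstein_frame : einstein A g D <->
  (forall c, adapted_chart A xi c -> forall p a b, cdom c p ->
     ricci_wagner A xi eta nabla (frame c a) (frame c b) p =
     4 * \sum_(d < k) dform1 A eta (frame c d) (frame c a) p * endo_comp A xi eta c psi d b p).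
Proof.
apply: (iff_trans einstein_ricci0); split=> [H c hc p a b cp|H p X Z sX sZ].
  have sf a' : sv p (frame c a') := smooth_frame a' hc.1 cp.
  by apply/eqP; rewrite -subr_eq0 -ricci_frame// H.
have xi0 : xi p != 0.
  apply/eqP => E; have := contact_xi hq p; rewrite E contact0 => /eqP.
  by rewrite eq_sym oner_eq0.
have [c hc cp] := exists_adapted_chart (smooth_xi hq) xi0.
have sf a : sv p (frame c a) := smooth_frame a hc.1 cp.
have sx := smooth_xi hq p.
(* The two slots of the Ricci tensor are treated in turn; a slot containing xi gives 0, which leaves
   the pairs of frame fields. *)
apply: (@tensor_frame_eq0 c p (fun X => ricci A D X Z p) X hc cp _ _ _ _ sX).
- by move=> U V sU sV; exact: (ricciDl hq hl hC hpsi ED).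
- by move=> f U s1 sU; exact: (ricciZl hq hl hC hpsi ED).
- exact: (ricci_xil hq hl hC hpsi ED erefl hpar).
move=> a; apply: (@tensor_frame_eq0 c p (fun Z => ricci A D (frame c a) Z p) Z hc cp _ _ _ _ sZ).
- by move=> U V sU sV; exact: (ricciDr hq hl hC hpsi ED).
- by move=> f U s1 sU; exact: (ricciZr hq hl hC hpsi ED).
- exact: (ricci_xir hq hl hC hpsi ED erefl).
by move=> b; rewrite ricci_frame// H// subrr.
Qed.

End Theorem2.

Theorem theorem2 (R : realType) (m : nat) (M : topologicalType)
  (A : smooth_manifold R M (2 * m)%N.+1)
  (xi : vfield R M (2 * m)%N.+1) (eta : form1 R M (2 * m)%N.+1)
  (phi : endo_field R M (2 * m)%N.+1) (g : bil_field R M (2 * m)%N.+1)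
  (nabla : connection_op R M (2 * m)%N.+1)
  (C psi : endo_field R M (2 * m)%N.+1) :
  almost_quasi_sasakian A xi eta phi g ->
  levi_civita A g nabla ->
  is_C A xi g C ->
  is_psi A eta g psi ->
  let nablaN := canonical_connection A xi eta nabla C psi
                  (fun p => 2 *: psi p) in
  parallel_torsion A g nablaN ->
  einstein A g nablaN <->
  (forall c : chart R M (2 * m)%N.+1, adapted_chart A xi c ->
   let e := adapted_frame A xi eta c in
   forall (p : M) (a b : 'I_(2 * m)), cdom c p ->
     ricci_wagner A xi eta nabla (e a) (e b) p
     = 4 * \sum_(d < 2 * m)
             dform1 A eta (e d) (e a) p * endo_comp A xi eta c psi d b p).
Proof.
move=> hq hl hC hpsi nablaN hpar.
exact: (einstein_frame hq hl hpsi hC erefl hpar).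
Qed.
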